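(* Let $Q_k(x,y)$ be any one of the fourteen families of polynomials listed in the context, and let $Z_k$ be the curve defined by $Q_k(x,y)=0$ (where $k$ is such that $Q_k$ is absolutely irreducible). Put $M_1=\{x,y\}$ and $M_2=\{x+1,y\}$. (1) If $k\in\mathbb{Z}$, then $M_1$ and $M_2$ are in $K_2^T(Z_k)_{\mathrm{int}}\otimes\mathbb{Q}$. (2) If $|k|\gg 0$ (i.e. there is a constant $K>0$ such that this holds for all $k\in\mathbb{C}$ with $|k|>K$), then $M_1$ and $M_2$ are linearly independent over $\mathbb{Q}$ in $K_2^T(Z_k)\otimes\mathbb{Q}$. In particular, if $k\in\mathbb{Z}$ and $|k|\gg0$, then $M_1$ and $M_2$ are two linearly independent elements of $K_2^T(Z_k)_{\mathrm{int}}\otimes\mathbb{Q}$.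
   Context: The fourteen families $Q_k(x,y)$, with parameter $k$: 1. $y^2+(x^3+kx^2+kx+1)y+x^3$ 2. $(x^2+x+1)(y^2+x)+(x^3+kx^2+kx+1)y$ 3. $(x^2+x+1)(y^2+x)+(kx^2+kx)y$ 4. $(x^2+x+1)^2(y^2+1)+(kx^3+(2k+2)x^2+kx)y$ 5. $y^2+(x^4+kx^3+(2k-4)x^2+kx+1)y+x^4$ 6. $y^2+(x^4+kx^3+2kx^2+kx+1)y+x^4$ 7. $(x^2+x+1)(y^2+x^2)+(x^4+kx^3+(2k-4)x^2+kx+1)y$ 8. $(x^2+x+1)(y^2+x^2)+(x^4+kx^3+2kx^2+kx+1)y$ 9. $(x^2+x+1)^2(y^2+1)+(x^4+kx^3+(2k-4)x^2+kx+1)y$ 10. $(x^2+x+1)^2(y^2+1)+(x^4+kx^3+2kx^2+kx+1)y$ 11. $(x^2+x+1)^2(y^2+1)+(2x^4+kx^3+(2k-6)x^2+kx+2)y$ 12. $(x^2+x+1)^2(y^2+1)+(2x^4+kx^3+(2k-2)x^2+kx+2)y$ 13. $(x^2+x+1)^3(y^2+1)+(2x^6+6x^5+kx^4+(2k-6)x^3+kx^2+6x+2)y$ 14. $(x^2+x+1)^3(y^2+1)+(2x^6+6x^5+kx^4+(2k-10)x^3+kx^2+6x+2)y$ The curve $Z_k$ is the normalization of the projective closure of the affine curve $Q_k(x,y)=0$; it is a smooth projective curve over $F=\mathbb{Q}(k)\subset\mathbb{C}$, and $x,y$ are regarded as rational functions on it. For a field $L$, $K_2(L)=L^*\otimes_{\mathbb{Z}}L^*/\langle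 a\otimes(1-a): a\in L,\ a\ne0,1\rangle$; the class of $a\otimes b$ is written $\{a,b\}$. For a smooth projective geometrically irreducible curve $C$ over a field $F$, the tame $K_2$ group $K_2^T(C)$ is the subgroup of $K_2(F(C))$ of elements $\alpha$ whose tame symbol $T_P(\alpha)$ is trivial at every closed point $P$ of $C$, where $T_P(\{a,b\})=(-1)^{\mathrm{ord}_P(a)\mathrm{ord}_P(b)}\frac{a^{\mathrm{ord}_P(b)}}{b^{\mathrm{ord}_P(a)}}(P)$. For $C$ over $\mathbb{Q}$, the integral tame $K_2$ group $K_2^T(C)_{\mathrm{int}}\subseteq K_2^T(C)$ is the subgroup of those elements that moreover have trivial tame symbol along every irreducible component $D$ of every fibre over a prime $p$ of a regular proper model $\mathcal{C}/\mathbb{Z}$ of $C$ (the tame symbol being that of the discrete valuation of $\mathbb{Q}(C)$ defined by $D$, with values in the multiplicative group of the function field of $D$); it is independent of the choice of model. Saying that a symbol $\{a,b\}$ lies in $K_2^T(C)\otimes\mathbb{Q}$ (resp. $K_2^T(C)_{\mathrm{int}}\otimes\mathbb{Q}$) means that its image in $K_2(F(C))\otimes\mathbb{Q}$ lies in the corresponding subspace, i.e. that some positive multiple of it lies in the corresponding subgroup modulo torsion. *)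

(* Defs.v *)
From HB Require Import structures.
From mathcomp Require Import all_boot all_order all_algebra.
From mathcomp Require Import ring_quotient generic_quotient.
From mathcomp Require Import boolp classical_sets reals.
From mathcomp Require Import complex.
From mathcomp Require Import freeg.
From mathcomp Require Import ring zify.

Set Implicit Arguments.
Unset Strict Implicit.
Unset Printing Implicit Defensive.

Import Order.TTheory GRing.Theory Num.Theory.

Local Open Scope classical_set_scope.
Local Open Scope ring_scope.

Section Quotient.
Variables (V : zmodType) (S : set V).

Definition is_subgroup (H : set V) : Prop :=
  H 0 /\ forall u w, H u -> H w -> H (u - w).

Definition subgroup_gen : set V := smallest is_subgroup S.

Definition gen_pred : V -> bool := fun u => `[< subgroup_gen u >].

Lemma gen_pred_closed : zmod_closed gen_pred.
Proof.
split=> [|u w /asboolP hu /asboolP hw]; apply/asboolP => H hH.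
  by case: hH => -[].
by have [[_ Hsub] _] := hH; apply: Hsub; [exact: hu hH | exact: hw hH].
Qed.

HB.instance Definition _ := GRing.isZmodClosed.Build V gen_pred gen_pred_closed.

Definition gen_closed : zmodClosed V := GRing.ZmodClosed.clone V gen_pred _.

Definition quotient : zmodType := Quotient.quot gen_closed.

Definition qpi (u : V) : quotient := (\pi_(Quotient.quot gen_closed) u)%qT.
Definition qrepr (u : quotient) : V := repr (u : Quotient.quot gen_closed).

Lemma qpi_is_zmod_morphism : zmod_morphism qpi.
Proof. by move=> u w; rewrite /qpi raddfB. Qed.

HB.instance Definition _ :=
  GRing.isZmodMorphism.Build V quotient qpi qpi_is_zmod_morphism.

Lemma qpi0P (u : V) : qpi u = 0 <-> subgroup_gen u.
Proof.
rewrite -(raddf0 qpi) /qpi; split.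
  by move/eqP; rewrite -Quotient.idealrBE subr0 => /asboolP.
by move=> h; apply/eqP; rewrite -Quotient.idealrBE subr0; apply/asboolP.
Qed.

Lemma qreprK (u : quotient) : qpi (qrepr u) = u.
Proof. exact: reprK. Qed.

Lemma subgroup_gen_sub (H : set V) :
  is_subgroup H -> S `<=` H -> subgroup_gen `<=` H.
Proof. by move=> hH hS u; apply. Qed.

Lemma qreprP (W : zmodType) (f : {additive V -> W}) :
  (forall u, S u -> f u = 0) -> forall u, f (qrepr (qpi u)) = f u.
Proof.
move=> fS u; apply/eqP; rewrite -subr_eq0 -raddfB; apply/eqP.
have /qpi0P : qpi (qrepr (qpi u) - u) = 0 by rewrite raddfB /= qreprK subrr.
apply: (@subgroup_gen_sub [set w | f w = 0]) => //.
by split=> [|v w /= fv fw] /=; rewrite ?raddf0 // raddfB fv fw subrr.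
Qed.

Lemma qrepr_lift_is_zmod_morphism (W : zmodType) (f : {additive V -> W}) :
  (forall u, S u -> f u = 0) -> zmod_morphism (f \o qrepr).
Proof.
move=> fS u w /=; rewrite -{1}(qreprK u) -{1}(qreprK w) -raddfB qreprP //.
by rewrite raddfB.
Qed.

End Quotient.

Section Tensor.
Variables (A B : zmodType).

Definition tensor_rel : set {freeg (A * B)%type / int} :=
  [set r | (exists a a' b,
             r = << (a + a', b) >> - << (a, b) >> - << (a', b) >>)
        \/ (exists a b b',
             r = << (a, b + b') >> - << (a, b) >> - << (a, b') >>)].

Definition tensor : zmodType := quotient tensor_rel.

Definition tens (a : A) (b : B) : tensor := qpi tensor_rel << (a, b) >>.

(* Defined through representatives; this is the homomorphism induced by f when f
   is bilinear *)
Definition tensor_lift (W : zmodType) (f : A -> B -> W) (t : tensor) : W :=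
  fglift (fun p => f p.1 p.2 : zmodule W) (qrepr t).

Section Lift.
Variables (W : zmodType) (f : A -> B -> W).
Hypothesis fDl : forall a a' b, f (a + a') b = f a b + f a' b.
Hypothesis fDr : forall a b b', f a (b + b') = f a b + f a b'.

Let g : {freeg (A * B)%type / int} -> W :=
  fglift (fun p => f p.1 p.2 : zmodule W).
Let g_add : zmod_morphism g.
Proof.
exact: (@lift_is_additive int (A * B)%type (zmodule W)
         (fun p => f p.1 p.2 : zmodule W)).
Qed.
HB.instance Definition _ := GRing.isZmodMorphism.Build _ _ g g_add.

Let gU a b : g << (a, b) >> = f a b.
Proof. by rewrite /g liftU /= scale1r. Qed.

Let g_rel u : tensor_rel u -> g u = 0.
Proof.
by case=> -[a] [b] [c] ->; rewrite !raddfB /= !gU ?fDl ?fDr addrAC addrK subrr.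
Qed.

Lemma tensor_liftE a b : tensor_lift f (tens a b) = f a b.
Proof. exact: (etrans (qreprP g_rel _) (gU a b)). Qed.

Lemma tensor_lift_is_zmod_morphism : zmod_morphism (tensor_lift f).
Proof. exact: (qrepr_lift_is_zmod_morphism g_rel). Qed.

End Lift.
End Tensor.

(* The multiplicative group of L as a zmodType: a + b is the product *)
Section MulGroup.
Variable L : fieldType.

Definition mulgrp := {a : L | a != 0}.
HB.instance Definition _ := Choice.on mulgrp.

Definition mulgrp1 : mulgrp := exist _ 1 (oner_neq0 L).
Definition mulgrpM (a b : mulgrp) : mulgrp :=
  exist _ (val a * val b) (mulf_neq0 (valP a) (valP b)).
Definition mulgrpV (a : mulgrp) : mulgrp :=
  exist _ (val a)^-1 (invr_neq0 (valP a)).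

Lemma mulgrpA : associative mulgrpM.
Proof. by move=> a b c; apply: val_inj; rewrite /= mulrA. Qed.
Lemma mulgrpC : commutative mulgrpM.
Proof. by move=> a b; apply: val_inj; rewrite /= mulrC. Qed.
Lemma mulgrp1M : left_id mulgrp1 mulgrpM.
Proof. by move=> a; apply: val_inj; rewrite /= mul1r. Qed.
Lemma mulgrpVM : left_inverse mulgrp1 mulgrpV mulgrpM.
Proof. by move=> a; apply: val_inj; rewrite /= mulVf ?(valP a). Qed.

HB.instance Definition _ :=
  GRing.isZmodule.Build mulgrp mulgrpA mulgrpC mulgrp1M mulgrpVM.

(* With a junk value at a = 0 *)
Definition tomul (a : L) : mulgrp := insubd mulgrp1 a.

Lemma tomulE (a : L) : a != 0 -> val (tomul a) = a.
Proof. by move=> a0; rewrite val_insubd a0. Qed.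

Lemma val_mulgrpD (a b : mulgrp) : val (a + b) = val a * val b.
Proof. by []. Qed.

End MulGroup.

Section K2.
Variable L : fieldType.

Definition steinberg_rel : set (tensor (mulgrp L) (mulgrp L)) :=
  [set t | exists a b : mulgrp L, val a + val b = 1 /\ t = tens a b].

Definition K2 : zmodType := quotient steinberg_rel.

Definition symb (a b : mulgrp L) : K2 := qpi steinberg_rel (tens a b).

(* To be used for nonzero a and b only.  On Z_k the functions x, x + 1 and y are
   nonzero: Q_k has degree 2 in y, so it divides none of them in F[x,y]. *)
Definition symbol (a b : L) : K2 := symb (tomul a) (tomul b).

(* The homomorphism induced by f when f is bilinear and kills a \otimes (1 - a) *)
Definition K2_lift (W : zmodType) (f : mulgrp L -> mulgrp L -> W) (u : K2) : W :=
  tensor_lift f (qrepr u).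

Section Lift.
Variables (W : zmodType) (f : mulgrp L -> mulgrp L -> W).
Hypothesis fDl : forall a a' b, f (a + a') b = f a b + f a' b.
Hypothesis fDr : forall a b b', f a (b + b') = f a b + f a b'.
Hypothesis f_steinberg : forall a b : mulgrp L, val a + val b = 1 -> f a b = 0.

Let g := tensor_lift f.
HB.instance Definition _ :=
  GRing.isZmodMorphism.Build _ _ g (tensor_lift_is_zmod_morphism fDl fDr).

Let g_rel u : steinberg_rel u -> g u = 0.
Proof.
by case=> a [b] [ab ->]; exact: etrans (tensor_liftE fDl fDr _ _) (f_steinberg ab).
Qed.

Lemma K2_liftE a b : K2_lift f (symb a b) = f a b.
Proof. exact: etrans (qreprP g_rel _) (tensor_liftE fDl fDr _ _). Qed.

Lemma K2_lift_is_zmod_morphism : zmod_morphism (K2_lift f).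
Proof. exact: (qrepr_lift_is_zmod_morphism g_rel). Qed.

End Lift.
End K2.

Section Tame.
Variable L : fieldType.

(* v is a normalized discrete valuation; its value at 0 is irrelevant *)
Definition discrete_valuation (v : L -> int) : Prop :=
  [/\ forall a b : L, a != 0 -> b != 0 -> v (a * b) = v a + v b,
      forall a b : L, a != 0 -> b != 0 -> a + b != 0 ->
        Num.min (v a) (v b) <= v (a + b)
    & exists2 a : L, a != 0 & v a = 1].

Definition valuation_subring (v : L -> int) : set L :=
  [set a | a = 0 \/ 0 <= v a].

Definition one_units (v : L -> int) : set (mulgrp L) :=
  [set u | val u = 1 \/ 0 < v (val u - 1)].

(* With U = 1 + m_v, the quotient O_v^* / U is the multiplicative group of the
   residue field; tame symbols are computed in the larger group L^* / U *)
Definition tame_symb (v : L -> int) (a b : mulgrp L) : quotient (one_units v) :=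
  qpi (one_units v)
    (tomul ((-1) ^ (v (val a) * v (val b))
            * (val a ^ v (val b) / val b ^ v (val a)))).

Definition tame (v : L -> int) (u : K2 L) : quotient (one_units v) :=
  K2_lift (tame_symb v) u.

Section TameTheory.
Variable v : L -> int.
Hypothesis hv : discrete_valuation v.

Let vM (a b : L) : a != 0 -> b != 0 -> v (a * b) = v a + v b.
Proof. by case: hv => h _ _; apply: h. Qed.

Let v1 : v 1 = 0.
Proof.
have := vM (oner_neq0 L) (oner_neq0 L).
by rewrite mulr1 => /eqP; rewrite -subr_eq subrr eq_sym => /eqP.
Qed.

Let vN1 : v (-1) = 0.
Proof.
have N0 : (-1 : L) != 0 by rewrite oppr_eq0 oner_neq0.
have := vM N0 N0; rewrite mulrNN mulr1 v1 -mulr2n => /esym/eqP.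
by rewrite mulrn_eq0 /= => /eqP.
Qed.

Let vN (a : L) : a != 0 -> v (- a) = v a.
Proof.
move=> a0; have N0 : (-1 : L) != 0 by rewrite oppr_eq0 oner_neq0.
by rewrite -mulN1r vM // vN1 add0r.
Qed.

Let vV (a : L) : a != 0 -> v a^-1 = - v a.
Proof.
move=> a0; have := vM a0 (invr_neq0 a0); rewrite mulfV // v1 => /esym/eqP.
by rewrite addrC addr_eq0 => /eqP.
Qed.

Let vD (a b : L) : a != 0 -> b != 0 -> a + b != 0 ->
  Num.min (v a) (v b) <= v (a + b).
Proof. by case: hv => _ h _; apply: h. Qed.

Let tame_val (a b : L) := (-1) ^ (v a * v b) * (a ^ v b / b ^ v a).

Let tame_val_neq0 (a b : L) : a != 0 -> b != 0 -> tame_val a b != 0.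
Proof.
by move=> a0 b0; rewrite /tame_val !mulf_neq0 ?invr_neq0 ?expfz_neq0 //
  oppr_eq0 oner_neq0.
Qed.

Let tame_symbE (a b : mulgrp L) :
  tame_symb v a b = qpi (one_units v) (tomul (tame_val (val a) (val b))).
Proof. by []. Qed.

Let tomulM (a b : L) : a != 0 -> b != 0 -> tomul (a * b) = tomul a + tomul b.
Proof.
by move=> a0 b0; apply: val_inj; rewrite val_mulgrpD !tomulE ?mulf_neq0.
Qed.

Lemma tame_symbDl a a' b :
  tame_symb v (a + a') b = tame_symb v a b + tame_symb v a' b.
Proof.
rewrite !tame_symbE -raddfD -tomulM ?tame_val_neq0 ?(valP a, valP a', valP b) //.
congr (qpi _ (tomul _)); rewrite /tame_val val_mulgrpD vM ?(valP a, valP a') //.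
have N0 : (-1 : L) != 0 by rewrite oppr_eq0 oner_neq0.
rewrite mulrDl !expfzDr ?(valP b) // expfzMl invfM; ring.
Qed.

Lemma tame_symbDr a b b' :
  tame_symb v a (b + b') = tame_symb v a b + tame_symb v a b'.
Proof.
rewrite !tame_symbE -raddfD -tomulM ?tame_val_neq0 ?(valP a, valP b', valP b) //.
congr (qpi _ (tomul _)); rewrite /tame_val val_mulgrpD vM ?(valP b, valP b') //.
have N0 : (-1 : L) != 0 by rewrite oppr_eq0 oner_neq0.
rewrite mulrDr !expfzDr ?(valP a) // expfzMl invfM; ring.
Qed.

Let one_unit_qpi (a : L) : a != 0 -> a = 1 \/ 0 < v (a - 1) ->
  qpi (one_units v) (tomul a) = 0.
Proof. by move=> a0 h; apply/qpi0P => H [_]; apply; rewrite /one_units /= tomulE. Qed.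

Let one_unit1 : qpi (one_units v) (tomul (1 : L)) = 0.
Proof. by apply: one_unit_qpi; [exact: oner_neq0 | left]. Qed.

Let one_unitX (c : L) (n : int) : c != 0 -> c = 1 \/ 0 < v (c - 1) ->
  qpi (one_units v) (tomul (c ^ n)) = 0.
Proof.
move=> c0 hc; have -> : tomul (c ^ n) = tomul c *~ n.
  apply: val_inj; rewrite tomulE ?expfz_neq0 //.
  have pw (m : nat) : val (tomul c *+ m) = c ^+ m.
    elim: m => [|m IH]; first by rewrite mulr0n expr0.
    by rewrite mulrS val_mulgrpD IH tomulE // exprS.
  by case: n => m; rewrite /intmul /exprz /= pw.
by rewrite raddfMz /= one_unit_qpi // mul0rz.
Qed.

Lemma tame_symb_steinberg (a b : mulgrp L) :
  val a + val b = 1 -> tame_symb v a b = 0.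
Proof.
rewrite tame_symbE; move: (valP a) (valP b) => /=.
move: (val a) (val b) => {}a {}b a0 b0 ab.
have hb : b = 1 + - a by rewrite -ab addrAC subrr add0r.
have ha : a = 1 + - b by rewrite -ab addrK.
have Na0 : - a != 0 by rewrite oppr_eq0.
have Nb0 : - b != 0 by rewrite oppr_eq0.
have h1 : Num.min 0 (v a) <= v b.
  by have := vD (oner_neq0 L) Na0; rewrite -hb v1 vN //; apply.
have h2 : Num.min 0 (v b) <= v a.
  by have := vD (oner_neq0 L) Nb0; rewrite -ha v1 vN //; apply.
have h3 : Num.min (v a) (v b) <= 0.
  by have := vD a0 b0; rewrite ab v1; apply; exact: oner_neq0.
rewrite !ge_min in h1 h2 h3.
have [va|va] := ltP 0 (v a).
  have vb : v b = 0 by lia.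
  rewrite /tame_val vb mulr0 !expr0z mul1r mul1r.
  by rewrite invr_expz one_unitX //; right; rewrite hb addrAC subrr add0r vN.
have [vb|vb] := ltP 0 (v b).
  have {}va : v a = 0 by lia.
  rewrite /tame_val va mul0r !expr0z mul1r divr1.
  by rewrite one_unitX //; right; rewrite ha addrAC subrr add0r vN.
have vab : v a = v b by lia.
have [vb0|vb0] := eqVneq (v b) 0.
  by rewrite /tame_val vab vb0 !expr0z invr1 !mulr1.
set n := v b; rewrite /tame_val vab -/n.
have -> : (-1) ^ (n * n) = (-1) ^ n :> L.
  rewrite -exprz_exp; have : ((-1) ^ n) ^+ 2 == 1 :> L.
    by rewrite expr2 -expfzMl mulrNN mulr1 exp1rz.
  by rewrite sqrf_eq1 => /orP[] /eqP E; rewrite E ?exp1rz ?E.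
have -> : (-1) ^ n * (a ^ n / b ^ n) = (- a / b) ^ n.
  by rewrite -[- a]mulN1r !expfzMl -expfV mulrA.
rewrite one_unitX ?mulf_neq0 ?invr_neq0 //; right.
have -> : - a / b - 1 = - b^-1 by rewrite ha; field.
by rewrite vN ?invr_neq0 // vV //; lia.
Qed.

Lemma tameE (a b : mulgrp L) : tame v (symb a b) = tame_symb v a b.
Proof. exact: (K2_liftE tame_symbDl tame_symbDr tame_symb_steinberg). Qed.

Lemma tame_is_zmod_morphism : zmod_morphism (tame v).
Proof.
exact: (K2_lift_is_zmod_morphism tame_symbDl tame_symbDr tame_symb_steinberg).
Qed.

End TameTheory.
End Tame.

Section Qadj.
Variables (C : numFieldType) (k : C).

Definition Qadj_pred : C -> bool := fun z =>
  `[< exists p q : {poly rat}, (map_poly ratr q).[k] != 0 /\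
        z = (map_poly ratr p).[k] / (map_poly ratr q).[k] >].

Lemma Qadj_closed : divring_closed Qadj_pred.
Proof.
split.
- apply/asboolP; exists 1, 1.
  by rewrite rmorph1 hornerC divr1; split=> //; rewrite oner_neq0.
- move=> z w /asboolP[p [q [q0 ->]]] /asboolP[p' [q' [q'0 ->]]].
  apply/asboolP; exists (p * q' - p' * q), (q * q').
  rewrite rmorphB !rmorphM !(hornerM, hornerD, hornerN) mulf_neq0 //.
  by split=> //=; rewrite ?hornerM; field; rewrite q0 q'0.
- move=> z w /asboolP[p [q [q0 ->]]] /asboolP[p' [q' [q'0 ->]]].
  apply/asboolP; have [p'0|p'0] := eqVneq (map_poly ratr p').[k] 0.
    exists 0, 1; rewrite p'0 mul0r invr0 mulr0 rmorph0 rmorph1 !hornerC mul0r.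
    by split=> //; rewrite oner_neq0.
  exists (p * q'), (q * p').
  rewrite !rmorphM !hornerM mulf_neq0 //.
  by split=> //=; field; rewrite q0 p'0 q'0.
Qed.

HB.instance Definition _ := GRing.isDivringClosed.Build C Qadj_pred Qadj_closed.

(* The subfield Q(k) of C *)
Definition Qadj := {z : C | Qadj_pred z}.
HB.instance Definition _ := [isSub of Qadj for @sval _ _].
HB.instance Definition _ := [Choice of Qadj by <:].
HB.instance Definition _ := [SubChoice_isSubIntegralDomain of Qadj by <:].
HB.instance Definition _ := [SubIntegralDomain_isSubField of Qadj by <:].

Lemma Qadj_gen_subproof : Qadj_pred k.
Proof.
apply/asboolP; exists 'X, 1.
by rewrite rmorph1 hornerC divr1 map_polyX hornerX; split=> //; rewrite oner_neq0.
Qed.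

Definition Qadj_gen : Qadj := exist _ k Qadj_gen_subproof.

End Qadj.

Section RationalSpan.
Variable A : zmodType.

(* The image of B \otimes Q in A \otimes Q *)
Definition tensorQ (B : set A) : set (tensor A rat) :=
  subgroup_gen [set t | exists b q, B b /\ t = tens b q].

Definition in_tensorQ (B : set A) (a : A) : Prop :=
  tensorQ B (tens a (1 : rat)).

(* tens a q is q * (a \otimes 1) in the Q-vector space A \otimes Q *)
Definition Q_lin_indep2 (a b : A) : Prop :=
  forall q r : rat, tens a q + tens b r = 0 -> q = 0 /\ r = 0.

End RationalSpan.

Section Families.

Definition Q_families (A : comNzRingType) (k x y : A) : seq A :=
  [:: y^+2 + (x^+3 + k*x^+2 + k*x + 1)*y + x^+3;
      (x^+2+x+1)*(y^+2+x) + (x^+3 + k*x^+2 + k*x + 1)*y;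
      (x^+2+x+1)*(y^+2+x) + (k*x^+2 + k*x)*y;
      (x^+2+x+1)^+2*(y^+2+1) + (k*x^+3 + (2*k+2)*x^+2 + k*x)*y;
      y^+2 + (x^+4 + k*x^+3 + (2*k-4)*x^+2 + k*x + 1)*y + x^+4;
      y^+2 + (x^+4 + k*x^+3 + 2*k*x^+2 + k*x + 1)*y + x^+4;
      (x^+2+x+1)*(y^+2+x^+2) + (x^+4 + k*x^+3 + (2*k-4)*x^+2 + k*x + 1)*y;
      (x^+2+x+1)*(y^+2+x^+2) + (x^+4 + k*x^+3 + 2*k*x^+2 + k*x + 1)*y;
      (x^+2+x+1)^+2*(y^+2+1) + (x^+4 + k*x^+3 + (2*k-4)*x^+2 + k*x + 1)*y;
      (x^+2+x+1)^+2*(y^+2+1) + (x^+4 + k*x^+3 + 2*k*x^+2 + k*x + 1)*y;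
      (x^+2+x+1)^+2*(y^+2+1) + (2*x^+4 + k*x^+3 + (2*k-6)*x^+2 + k*x + 2)*y;
      (x^+2+x+1)^+2*(y^+2+1) + (2*x^+4 + k*x^+3 + (2*k-2)*x^+2 + k*x + 2)*y;
      (x^+2+x+1)^+3*(y^+2+1)
        + (2*x^+6 + 6*x^+5 + k*x^+4 + (2*k-6)*x^+3 + k*x^+2 + 6*x + 2)*y;
      (x^+2+x+1)^+3*(y^+2+1)
        + (2*x^+6 + 6*x^+5 + k*x^+4 + (2*k-10)*x^+3 + k*x^+2 + 6*x + 2)*y].

(* Q_k(x,y) as a polynomial in y with coefficients in F[x] *)
Definition Qpoly (F : fieldType) (i : 'I_14) (k : F) : {poly {poly F}} :=
  nth 0 (Q_families k%:P%:P 'X%:P 'X) i.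

Definition irreducible_elt (A : idomainType) (a : A) : Prop :=
  [/\ a != 0, a \isn't a GRing.unit
    & forall b c, a = b * c -> (b \is a GRing.unit) || (c \is a GRing.unit)].

(* Irreducibility in C[x,y], C being algebraically closed and containing Q(k) *)
Definition absolutely_irreducible (R : realType) (i : 'I_14) (k : R[i]) : Prop :=
  irreducible_elt (Qpoly i k).

End Families.

Section Curve.
Variables (F K : fieldType) (iota : {rmorphism F -> K}).

(* P(a,b), where the outer variable of P is y *)
Definition eval2 (P : {poly {poly F}}) (a b : K) : K :=
  (map_poly (map_poly iota) P).[b%:P].[a].

(* K, with its elements x and y, is the field of fractions of F[x,y]/(Q) *)
Definition function_field_of (Q : {poly {poly F}}) (x y : K) : Prop :=
  (forall P, eval2 P x y = 0 <-> exists A, P = A * Q)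
  /\ (forall z, exists A B, eval2 B x y != 0 /\ z = eval2 A x y / eval2 B x y).

(* When K is a function field in one variable over F, the closed points of the
   regular projective curve C with F(C) = K are the normalized discrete
   valuations of K that are trivial on F: P corresponds to ord_P *)
Definition closed_point (v : K -> int) : Prop :=
  discrete_valuation v /\ forall c : F, c != 0 -> v (iota c) = 0.

Definition K2T : set (K2 K) :=
  [set u | forall v, closed_point v -> tame v u = 0].

(* An integral separated scheme of finite type over Z with function field K is
   encoded, following Zariski and Chevalley, by the set of its local rings, which
   are subrings of K.  Specialization is reverse inclusion, and such a set is
   separated and proper over Z iff every valuation ring of K dominates exactly one
   of its members. *)
Definition subring (A : set K) : Prop :=
  A 1 /\ forall a b, A a -> A b -> A (a - b) /\ A (a * b).

Definition subring_gen (s : seq K) : set K := smallest subring [set` s].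

Definition ideal (A I : set K) : Prop :=
  [/\ I `<=` A, I 0, forall a b, I a -> I b -> I (a + b)
    & forall r a, A r -> I a -> I (r * a)].

Definition ideal_gen (A : set K) (s : seq K) : set K :=
  smallest (ideal A) [set` s].

Definition prime_ideal (A P : set K) : Prop :=
  [/\ ideal A P, ~ P 1 & forall a b, A a -> A b -> P (a * b) -> P a \/ P b].

Definition localization (A P : set K) : set K :=
  [set z | exists a b, [/\ A a, A b, ~ P b & z = a / b]].

Definition spec (A : set K) : set (set K) :=
  [set localization A P | P in prime_ideal A].

(* The maximal ideal of A, if A is local *)
Definition nonunits (A : set K) : set K :=
  [set a | A a /\ forall b, A b -> a * b != 1].

Definition valuation_ring (V : set K) : Prop :=
  subring V /\ forall a, a != 0 -> V a \/ V a^-1.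

Definition dominates (V A : set K) : Prop :=
  A `<=` V /\ nonunits A `<=` nonunits V.

Definition has_prime_chain (A : set K) (d : nat) : Prop :=
  exists P : nat -> set K,
    (forall i, (i <= d)%N -> prime_ideal A (P i))
    /\ (forall i, (i < d)%N -> P i `<` P i.+1).

Definition krull_dim (A : set K) (d : nat) : Prop :=
  has_prime_chain A d /\ ~ has_prime_chain A d.+1.

(* For a noetherian local ring A *)
Definition regular_local (A : set K) : Prop :=
  exists s : seq K, krull_dim A (size s) /\ nonunits A = ideal_gen A s.

(* For F = Q: X is a regular proper model over Z of the curve C with F(C) = K.
   The last clause says that its generic fibre is C. *)
Definition regular_proper_model (X : set (set K)) : Prop :=
  [/\ exists2 charts : seq (seq K),
        forall s, s \in charts -> forall z, exists a b,
          [/\ subring_gen s a, subring_gen s b, b != 0 & z = a / b]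
        & X = \bigcup_(s in [set` charts]) spec (subring_gen s),
      forall V, valuation_ring V -> exists! A, X A /\ dominates V A,
      forall A, X A -> regular_local A
    & [set A | X A /\ forall p, prime p -> A p%:R^-1]
      = [set A | A = setT \/ exists2 v, closed_point v & A = valuation_subring v]].

(* A is the local ring of the generic point of an irreducible component of the
   fibre of X over p *)
Definition fibre_component (X : set (set K)) (p : nat) (A : set K) : Prop :=
  [/\ X A, nonunits A p%:R
    & forall B, X B -> nonunits B p%:R -> A `<=` B -> B = A].

Definition K2T_int (X : set (set K)) : set (K2 K) :=
  [set u | K2T u /\
     forall p D v, prime p -> fibre_component X p D ->
       discrete_valuation v -> D = valuation_subring v -> tame v u = 0].

End Curve.

(* Main.v *)
(* Every family has the shape [Phi^m (y^2 + x^l) + B y = 0] with [Phi = x^2 + x + 1]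
   and [B = k x^r (x + 1)^s + b], [b] an integral polynomial, and it is invariant
   under [(x, y) -> (1 / x, y / x^l)].

   Part (1): at any discrete valuation for which [k] is integral, the tame symbols of
   [{x, y}] and [{x + 1, y}] are roots of unity of bounded order: modulo the maximal
   ideal, [x] is a cube root of unity where [y] has a zero or pole but [x] does not,
   and on the other branches [y] is a root of unity, up to powers of [x].  This
   covers the closed points of the curve as well as the components of the fibres of
   any model.

   Part (2): choose a circle [x = p + rho e^(it)], [p = 0] or [p = -1], all of whose
   points are transcendental over [Q(k)].  If [|k|] is large, one root [y] of the
   equation is close to [- k x^r (x + 1)^s / Phi^m] along it, and each point of the
   lifted loop gives an embedding of the function field into the complex numbers.
   Integrating [log|f| d arg g - log|g| d arg f] along the loop defines a
   homomorphism on K_2: it kills Steinberg symbols because the integrand is then the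
   differential of the Bloch-Wigner dilogarithm.  On [{x, y}] and [{x + 1, y}] it
   takes the values [- 2 pi log|k| + O(1)] and [O(1)] for [p = 0], and the reverse
   for [p = -1], so the 2 x 2 regulator matrix is invertible.  The statement is over
   an arbitrary [realType]; the integrals live over the reals of Stdlib, into which
   it embeds. *)
Require Import Defs.
From HB Require Import structures.
From Stdlib Require Reals Lra.
From Coquelicot Require Coquelicot.
From mathcomp Require Import ssreflect.

Set Implicit Arguments.
Unset Strict Implicit.
Unset Printing Implicit Defensive.

(** * The Bloch-Wigner dilogarithm and the regulator form *)

Module RegulatorForm.
Import Reals Lra Coquelicot.
Local Open Scope R_scope.

Ltac side_conditions := repeat split; try (eexists; eassumption); try lra.

(** The classical regulator pairs a symbol with loops avoiding the zeros and poles of its entries,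
    so a fixed loop need not give a homomorphism on all of [K_2] of the function field.
    Transcendental loops remove this obstacle: where [x] is transcendental over Q(k), evaluation is
    injective on the function field, so every nonzero function stays nonzero along the loop, and
    every function other than 0 and 1 avoids both values, as the Steinberg relation requires.
    Suitable radii exist because Q(k) is countable: only countably many circles about a given centre
    meet a number algebraic over it.

    The principal logarithm yields a primitive on a slit plane only, so the Bloch-Wigner function is
    given by two branches, one off [1, +oo) and one off (-oo, 0]; they agree on the overlap and form
    a global primitive.

    The error terms are explicit: the factor by which [y] differs from its leading term is within
    1/2 of 1 and costs at most [5 * 2 pi] after an integration by parts, so [log|k| > 10] makes the
    regulator matrix diagonally dominant. *)

Definition C1_pair (f df : R -> R) : Prop :=
  (forall t, is_derive f t (df t)) /\ (forall t, continuous df t).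

(* Below, [u, v] are the real and imaginary parts of a complex number and
   [du, dv] (or [a', b'], ...) those of its derivative along a curve. *)
Definition nrm2 (u v : R) := u * u + v * v.
Definition lnabs (u v : R) := / 2 * ln (nrm2 u v).
Definition darg (u v du dv : R) := (u * dv - v * du) / nrm2 u v.
Definition dlnabs (u v du dv : R) := (u * du + v * dv) / nrm2 u v.

(* The principal argument by the half-angle formula; off [slit] it is a junk value. *)
Definition Arg (u v : R) := 2 * atan (v / (sqrt (nrm2 u v) + u)).

Definition slit (u v : R) := v <> 0 \/ 0 < u.

Lemma is_derive_ext_val (f : R -> R) (t l l' : R) :
  is_derive f t l -> l = l' -> is_derive f t l'.
Proof. by move=> h <-. Qed.

Lemma nrm2_gt0 u v : u <> 0 \/ v <> 0 -> 0 < nrm2 u v.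
Proof. by rewrite /nrm2 => -[h|h]; nra. Qed.

Lemma slit_nrm2 u v : slit u v -> 0 < nrm2 u v.
Proof. by move=> [h|h]; apply: nrm2_gt0; [right | left; lra]. Qed.

Lemma slit_den u v : slit u v -> 0 < sqrt (nrm2 u v) + u.
Proof.
move=> h; have p := slit_nrm2 h; have q := sqrt_lt_R0 _ p.
have e := sqrt_sqrt (nrm2 u v) (Rlt_le _ _ p).
move: q e; set s := sqrt _; rewrite /nrm2 => q e.
case: h => [h|h]; nra.
Qed.

Lemma is_derive_nrm2 (a b : R -> R) (a' b' t : R) : is_derive a t a' -> is_derive b t b' ->
  is_derive (fun t => nrm2 (a t) (b t)) t (2 * (a t * a' + b t * b')).
Proof.
move=> ha hb; rewrite /nrm2; auto_derive.
  by side_conditions.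
by rewrite (is_derive_unique _ _ _ ha) (is_derive_unique _ _ _ hb); ring.
Qed.

Lemma is_derive_half_ln (n : R -> R) (n' t : R) : is_derive n t n' -> 0 < n t ->
  is_derive (fun t => / 2 * ln (n t)) t (/ 2 * (n' / n t)).
Proof.
move=> hn h; auto_derive; first by side_conditions.
by rewrite (is_derive_unique _ _ _ hn); field; lra.
Qed.

Lemma is_derive_lnabs (a b : R -> R) (a' b' t : R) : is_derive a t a' -> is_derive b t b' ->
  0 < nrm2 (a t) (b t) ->
  is_derive (fun t => lnabs (a t) (b t)) t (dlnabs (a t) (b t) a' b').
Proof.
move=> ha hb h; have hn := is_derive_half_ln (is_derive_nrm2 ha hb) h.
apply: is_derive_ext_val hn _.  rewrite /dlnabs.  field; lra.
Qed.

Lemma is_derive_half_angle (a b n : R -> R) (a' b' n' t : R) :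
  is_derive a t a' -> is_derive b t b' -> is_derive n t n' ->
  0 < n t -> 0 < sqrt (n t) + a t ->
  is_derive (fun t => 2 * atan (b t / (sqrt (n t) + a t))) t
    (2 * ((b' * (sqrt (n t) + a t) - b t * (n' / (2 * sqrt (n t)) + a'))
     / ((sqrt (n t) + a t) ^ 2 + b t ^ 2))).
Proof.
move=> ha hb hn h0 h1; have q := sqrt_lt_R0 _ h0.
auto_derive; first by side_conditions.
rewrite (is_derive_unique _ _ _ hn) (is_derive_unique _ _ _ ha)
  (is_derive_unique _ _ _ hb).
by field; repeat split; nra.
Qed.

Lemma is_derive_Arg (a b : R -> R) (a' b' t : R) : is_derive a t a' -> is_derive b t b' ->
  slit (a t) (b t) ->
  is_derive (fun t => Arg (a t) (b t)) t (darg (a t) (b t) a' b').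
Proof.
move=> ha hb h; have hn := is_derive_nrm2 ha hb.
have h0 := slit_nrm2 h; have h1 := slit_den h.
apply: is_derive_ext_val (is_derive_half_angle ha hb hn h0 h1) _.
have q := sqrt_lt_R0 _ h0; have e := sqrt_sqrt _ (Rlt_le _ _ h0).
move: q e h1; set s := sqrt _ => q e h1; rewrite /darg -e.
have eb : b t * b t = s * s - a t * a t by rewrite e /nrm2; ring.
have p : 0 < s * (s + a t) by apply: Rmult_lt_0_compat.
have -> : (s + a t) ^ 2 + b t ^ 2 = 2 * s * (s + a t).
  have e2 : b t ^ 2 = b t * b t by ring.
  by rewrite e2 eb; ring.
(* The difference of the two derivatives is a multiple of [s^2 - a^2 - b^2], which vanishes by
   [eb]. *)
have E : 2 * ((b' * (s + a t) - b t * (2 * (a t * a' + b t * b') / (2 * s) + a')) /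
    (2 * s * (s + a t))) - (a t * b' - b t * a') / (s * s) =
  b' * (s * s - a t * a t - b t * b t) / (s * s * (s + a t)).
  by field; lra.
apply: Rminus_diag_uniq.
by rewrite E eb /Rminus Rplus_opp_r Rmult_0_r /Rdiv Rmult_0_l.
Qed.

Lemma slit_locally (a b : R -> R) t : continuous a t -> continuous b t ->
  slit (a t) (b t) -> locally t (fun t => slit (a t) (b t)).
Proof.
move=> ha hb [h|h].
  have : locally t (fun s => b s <> 0) by apply: (hb (fun v => v <> 0)); exact: open_neq.
  by apply: filter_imp => s hs; left.
have : locally t (fun s => 0 < a s) by apply: (ha (fun v => 0 < v)); exact: open_gt.
by apply: filter_imp => s hs; right.
Qed.

(** The slit plane is star-shaped about 1, so the segment from 1 to [1 - z] stays inside it. *)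
Lemma slit_scale u v s : slit (1 - u) (- v) -> 0 <= s <= 1 ->
  slit (1 - s * u) (- (s * v)).
Proof.
rewrite /slit => h hs; have [->|s0] := Req_dec s 0; first by right; lra.
by case: h => h; [left | right]; nra.
Qed.

Lemma C1_cont f df t : C1_pair f df -> continuous f t.
Proof. by move=> [h _]; apply: ex_derive_continuous; exists (df t). Qed.

Lemma continuous_div (f g : R -> R) t : continuous f t -> continuous g t ->
  g t <> 0 -> continuous (fun t => f t / g t) t.
Proof.
move=> hf hg h; apply: (continuous_mult f (fun t => / g t)) => //.
exact: continuous_Rinv_comp.
Qed.

(* [Im log (1 - s z) / s] with [z = u + iv], extended by its limit to [s = 0]. *)
Definition dilog_kernel (u v s : R) : R :=
  match Req_EM_T s 0 with
  | left _ => - v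
  | right _ => Arg (1 - s * u) (- (s * v)) / s
  end.

(** Imaginary part of the dilogarithm, [Li_2 z] being minus the integral of [log (1 - s z) / s] over
    [0 <= s <= 1]. *)
Definition ImLi2 (u v : R) : R := - RInt (dilog_kernel u v) 0 1.

(** The imaginary part of [- z' / (1 - s z)]. The factor [1 / s] of the kernel has cancelled, so
    there is no singularity left at [s = 0]. *)
Definition dkernel (u v u' v' s : R) : R :=
  - (v' - s * (u * v' - v * u')) / nrm2 (1 - s * u) (- (s * v)).

Lemma is_derive_dilog_kernel (a b : R -> R) (a' b' t s : R) :
  is_derive a t a' -> is_derive b t b' ->
  slit (1 - s * a t) (- (s * b t)) ->
  is_derive (fun t => dilog_kernel (a t) (b t) s) t (dkernel (a t) (b t) a' b' s).
Proof.
move=> ha hb h1; rewrite /dilog_kernel.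
have h0 := slit_nrm2 h1.
case: (Req_EM_T s 0) => [s0|s0].
  apply: is_derive_ext_val (is_derive_opp _ _ _ hb) _.
  by rewrite /dkernel s0 /nrm2 /opp /=; field.
have ha1 : is_derive (fun t => 1 - s * a t) t (- (s * a')).
  by auto_derive; [side_conditions | rewrite (is_derive_unique _ _ _ ha); ring].
have hb1 : is_derive (fun t => - (s * b t)) t (- (s * b')).
  by auto_derive; [side_conditions | rewrite (is_derive_unique _ _ _ hb); ring].
have hA := is_derive_Arg ha1 hb1 h1.
apply: is_derive_ext_val (is_derive_scal_l _ _ _ (/ s) hA) _.
by rewrite /scal /= /mult /= /darg /dkernel; field; lra.
Qed.

Lemma Arg_10 : Arg 1 0 = 0.
Proof. by rewrite /Arg /Rdiv Rmult_0_l atan_0 Rmult_0_r. Qed.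

Lemma ex_RInt_dilog_kernel u v : slit (1 - u) (- v) ->
  ex_RInt (dilog_kernel u v) 0 1.
Proof.
move=> h; apply: ex_RInt_continuous => s.
rewrite Rmin_left ?Rmax_right; try lra; move=> hs.
have ha (r : R) : is_derive (fun s => 1 - s * u) r (- u) by auto_derive => //; ring.
have hb (r : R) : is_derive (fun s => - (s * v)) r (- v) by auto_derive => //; ring.
have hA := is_derive_Arg (ha s) (hb s) (slit_scale h hs).
have [s0|s0] := Req_dec s 0; last first.
  apply: (continuous_ext_loc _ (fun s => Arg (1 - s * u) (- (s * v)) / s)).
    have : locally s (fun v => v <> 0) by exact: open_neq.
    by apply: filter_imp => r hr; rewrite /dilog_kernel; case: Req_EM_T.
  apply: (continuous_div (f := fun s => Arg (1 - s * u) (- (s * v))) (g := fun s => s)) => //.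
    by apply: ex_derive_continuous; eexists; exact: hA.
subst s; apply/filterlim_locally => eps.
(* [Arg] vanishes at 1, so the kernel is a difference quotient of [Arg (1 - s z)] at [s = 0]: its
   continuity there is the differentiability of [Arg]. *)
have : derivable_pt_lim (fun s => Arg (1 - s * u) (- (s * v))) 0 (- v).
  apply/is_derive_Reals; apply: is_derive_ext_val hA _.
  by rewrite /darg /nrm2; field; lra.
move=> /(_ _ (cond_pos eps)) [d hd]; exists d => r hr.
rewrite /ball /= /AbsRing_ball /= /abs /minus /plus /opp /= /dilog_kernel.
case: (Req_EM_T 0 0) => [_|//]; case: (Req_EM_T r 0) => [e|r0].
  by rewrite Rplus_opp_r Rabs_R0; apply: cond_pos.
have := hd r r0; rewrite !Rplus_0_l !Rmult_0_l Rminus_0_r Ropp_0 Arg_10 Rminus_0_r.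
apply; move: hr; rewrite /ball /= /AbsRing_ball /= /abs /minus /plus /opp /=.
by rewrite Ropp_0 Rplus_0_r.
Qed.

(** As a function of [s], [- z' / (1 - s z)] has the primitive [log (1 - s z) * z' / z]; [P] is the
    imaginary part of the latter. *)
Lemma RInt_dkernel u v u' v' : slit (1 - u) (- v) -> 0 < nrm2 u v ->
  RInt (dkernel u v u' v') 0 1 =
  lnabs (1 - u) (- v) * darg u v u' v' + Arg (1 - u) (- v) * dlnabs u v u' v'.
Proof.
move=> h h0; apply: is_RInt_unique.
have ha (r : R) : is_derive (fun s => 1 - s * u) r (- u) by auto_derive => //; ring.
have hb (r : R) : is_derive (fun s => - (s * v)) r (- v) by auto_derive => //; ring.
pose P s := lnabs (1 - s * u) (- (s * v)) * darg u v u' v' +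
            Arg (1 - s * u) (- (s * v)) * dlnabs u v u' v'.
have -> : lnabs (1 - u) (- v) * darg u v u' v' + Arg (1 - u) (- v) * dlnabs u v u' v'
  = minus (P 1) (P 0).
  rewrite /P /minus /plus /opp /= !Rmult_1_l !Rmult_0_l Ropp_0 Rminus_0_r Arg_10.
  by rewrite /lnabs /nrm2 Rmult_0_l Rmult_1_l Rplus_0_r ln_1; ring.
apply: is_RInt_derive => s; rewrite Rmin_left ?Rmax_right; try lra; move=> hs.
  have h1 := slit_scale h hs; have h2 := slit_nrm2 h1.
  have hA := is_derive_Arg (ha s) (hb s) h1.
  have hL := is_derive_lnabs (ha s) (hb s) h2.
  apply: is_derive_ext_val (is_derive_plus _ _ _ _ _ (is_derive_scal_l _ _ _ _ hL)
    (is_derive_scal_l _ _ _ _ hA)) _.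
  rewrite /plus /scal /= /mult /= /dkernel /darg /dlnabs.
  move: h0 h2; rewrite /nrm2 => h0 h2.
  by field; lra.
have h2 := slit_nrm2 (slit_scale h hs).
rewrite /dkernel; apply: ex_derive_continuous; rewrite /nrm2; auto_derive.
by move: h2; rewrite /nrm2; lra.
Qed.

Lemma locally_2d_gt (f : R -> R -> R) x y : continuity_2d_pt f x y -> 0 < f x y ->
  locally_2d (fun u v => 0 < f u v) x y.
Proof.
move=> /continuity_2d_pt_filterlim hf h; apply/locally_2d_locally.
by apply: (hf (fun z => 0 < z)); exact: open_gt.
Qed.

Lemma continuity_2d_pt_fst f x y : continuous f x -> continuity_2d_pt (fun u _ => f u) x y.
Proof.
move=> hf; apply: continuity_1d_2d_pt_comp; last exact: continuity_2d_pt_id1.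
by apply/continuity_pt_filterlim.
Qed.

(** Imaginary part of [d Li_2 (z) = - log (1 - z) dz / z], obtained by differentiation under the
    integral sign. Most of the work is the joint continuity of the differentiated kernel, which
    holds because the slit condition is open. *)
Lemma is_derive_ImLi2 (a b a' b' : R -> R) (t : R) :
  C1_pair a a' -> C1_pair b b' -> slit (1 - a t) (- b t) -> 0 < nrm2 (a t) (b t) ->
  is_derive (fun t => ImLi2 (a t) (b t)) t
   (- (lnabs (1 - a t) (- b t) * darg (a t) (b t) (a' t) (b' t)
      + Arg (1 - a t) (- b t) * dlnabs (a t) (b t) (a' t) (b' t))).
Proof.
move=> ha hb h h0.
have hloc : locally t (fun t => slit (1 - a t) (- b t)).
  apply: (@slit_locally (fun t => 1 - a t) (fun t => - b t)) => //.
    apply: (continuous_minus (fun _ => 1) a); first exact: continuous_const.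
    exact: C1_cont ha.
  by apply: (continuous_opp b); exact: C1_cont hb.
apply: is_derive_opp; rewrite -RInt_dkernel //.
have D : forall r t, slit (1 - r * a t) (- (r * b t)) -> 
   Derive (fun t => dilog_kernel (a t) (b t) r) t = dkernel (a t) (b t) (a' t) (b' t) r.
  by move=> r s hs; apply: is_derive_unique;
     apply: is_derive_dilog_kernel => //; [exact: (proj1 ha) | exact: (proj1 hb)].
rewrite -(RInt_ext (fun s => Derive (fun t => dilog_kernel (a t) (b t) s) t)); last first.
  move=> s; rewrite Rmin_left ?Rmax_right; try lra; move=> hs; apply: D => //.
  by apply: slit_scale => //; lra.
apply: is_derive_RInt_param.
- apply: filter_imp hloc => s hs r; rewrite Rmin_left ?Rmax_right; try lra; move=> hr.
  eexists; apply: is_derive_dilog_kernel => //; [exact: (proj1 ha) | exact: (proj1 hb) |].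
  exact: slit_scale.
- move=> s; rewrite Rmin_left ?Rmax_right; try lra; move=> hs.
  have c1 : continuity_2d_pt (fun u v => 1 - v * a u) t s.
    apply: continuity_2d_pt_minus; first exact: continuity_2d_pt_const.
    apply: continuity_2d_pt_mult; first exact: continuity_2d_pt_id2.
    by apply: continuity_2d_pt_fst; exact: C1_cont ha.
  have c2 : continuity_2d_pt (fun u v => - (v * b u)) t s.
    apply: continuity_2d_pt_opp.
    apply: continuity_2d_pt_mult; first exact: continuity_2d_pt_id2.
    by apply: continuity_2d_pt_fst; exact: C1_cont hb.
  have hs1 := slit_scale h hs.
  have l : locally_2d (fun u v => slit (1 - v * a u) (- (v * b u))) t s.
    case: hs1 => hs1.
      move: (continuity_2d_pt_neq_0 _ _ _ c2 hs1); apply: locally_2d_impl.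
      by apply: locally_2d_forall => u v; left.
    move: (locally_2d_gt c1 hs1); apply: locally_2d_impl.
    by apply: locally_2d_forall => u v; right.
  apply: (continuity_2d_pt_ext_loc (fun u v => dkernel (a u) (b u) (a' u) (b' u) v)).
    move: l; apply: locally_2d_impl; apply: locally_2d_forall => u v huv.
    by rewrite D.
  have k1 : continuous a t := C1_cont ha; have k2 : continuous b t := C1_cont hb.
  have k3 : continuous a' t := proj2 ha t; have k4 : continuous b' t := proj2 hb t.
  rewrite /dkernel; apply: continuity_2d_pt_mult.
    apply: continuity_2d_pt_opp; apply: continuity_2d_pt_minus.
      exact: continuity_2d_pt_fst.
    apply: continuity_2d_pt_mult; first exact: continuity_2d_pt_id2.
    by apply: continuity_2d_pt_minus; apply: continuity_2d_pt_mult;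
      exact: continuity_2d_pt_fst.
  apply: continuity_2d_pt_inv; last by have := slit_nrm2 hs1; lra.
  by rewrite /nrm2; apply: continuity_2d_pt_plus; apply: continuity_2d_pt_mult.
- by apply: filter_imp hloc => s hs; apply: ex_RInt_dilog_kernel.
Qed.
(* The form [log|f| d arg g - log|g| d arg f] at [f = a + ib], [g = c + id]. *)
Definition eta (a b a' b' c d c' d' : R) : R :=
  lnabs a b * darg c d c' d' - lnabs c d * darg a b a' b'.

Lemma continuous_nrm2 (a b : R -> R) t : continuous a t -> continuous b t ->
  continuous (fun t => nrm2 (a t) (b t)) t.
Proof.
move=> ha hb; apply: (continuous_plus (fun t => a t * a t) (fun t => b t * b t)).
  exact: (continuous_mult a a).
exact: (continuous_mult b b).
Qed.

Lemma continuous_lnabs (a b : R -> R) t : continuous a t -> continuous b t ->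
  0 < nrm2 (a t) (b t) -> continuous (fun t => lnabs (a t) (b t)) t.
Proof.
move=> ha hb h; apply: (continuous_mult (fun _ => / 2) (fun t => ln (nrm2 (a t) (b t)))).
  exact: continuous_const.
apply: (continuous_comp (fun t => nrm2 (a t) (b t)) ln); first exact: continuous_nrm2.
exact: continuous_ln.
Qed.

Lemma continuous_darg (a b a' b' : R -> R) t : continuous a t -> continuous b t ->
  continuous a' t -> continuous b' t -> 0 < nrm2 (a t) (b t) ->
  continuous (fun t => darg (a t) (b t) (a' t) (b' t)) t.
Proof.
move=> ha hb ha' hb' h.
apply: (continuous_div (f := fun t => a t * b' t - b t * a' t)
   (g := fun t => nrm2 (a t) (b t))); last 2 first.
- exact: continuous_nrm2.
- lra.
apply: (continuous_minus (fun t => a t * b' t) (fun t => b t * a' t)).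
  exact: (continuous_mult a b').
exact: (continuous_mult b a').
Qed.

Lemma continuous_dlnabs (a b a' b' : R -> R) t : continuous a t -> continuous b t ->
  continuous a' t -> continuous b' t -> 0 < nrm2 (a t) (b t) ->
  continuous (fun t => dlnabs (a t) (b t) (a' t) (b' t)) t.
Proof.
move=> ha hb ha' hb' h.
apply: (continuous_div (f := fun t => a t * a' t + b t * b' t)
   (g := fun t => nrm2 (a t) (b t))); last 2 first.
- exact: continuous_nrm2.
- lra.
apply: (continuous_plus (fun t => a t * a' t) (fun t => b t * b' t)).
  exact: (continuous_mult a a').
exact: (continuous_mult b b').
Qed.

Lemma continuous_eta (a b a' b' c d c' d' : R -> R) t :
  C1_pair a a' -> C1_pair b b' -> C1_pair c c' -> C1_pair d d' ->
  0 < nrm2 (a t) (b t) -> 0 < nrm2 (c t) (d t) ->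
  continuous (fun t => eta (a t) (b t) (a' t) (b' t) (c t) (d t) (c' t) (d' t)) t.
Proof.
move=> ha hb hc hd h1 h2.
have ca : continuous a t by exact: C1_cont ha.
have cb : continuous b t by exact: C1_cont hb.
have cc : continuous c t by exact: C1_cont hc.
have cd : continuous d t by exact: C1_cont hd.
have [ca' cb'] := (proj2 ha t, proj2 hb t).
have [cc' cd'] := (proj2 hc t, proj2 hd t).
apply: (continuous_minus (fun t => lnabs (a t) (b t) * darg (c t) (d t) (c' t) (d' t))
 (fun t => lnabs (c t) (d t) * darg (a t) (b t) (a' t) (b' t))).
  apply: (continuous_mult (fun t => lnabs (a t) (b t))
    (fun t => darg (c t) (d t) (c' t) (d' t))).
    exact: continuous_lnabs.
  exact: continuous_darg.
apply: (continuous_mult (fun t => lnabs (c t) (d t))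
  (fun t => darg (a t) (b t) (a' t) (b' t))).
  exact: continuous_lnabs.
exact: continuous_darg.
Qed.

(* The Bloch-Wigner function on the complement of [1, +oo). *)
Definition BW1 (u v : R) : R := ImLi2 u v + Arg (1 - u) (- v) * lnabs u v.
(** The functional equation [D (z) = - D (1 - z)] used as a definition: it gives the Bloch-Wigner
    function on the complement of (-oo, 0]. *)
Definition BW2 (u v : R) : R := - BW1 (1 - u) (- v).

(* [eta] at [g = 1 - f]. *)
Definition steta (a b a' b' : R) := eta a b a' b' (1 - a) (- b) (- a') (- b').

Lemma C1_pair_compl a a' : C1_pair a a' -> C1_pair (fun t => 1 - a t) (fun t => - a' t).
Proof.
move=> [h c]; split=> t; last by apply: (continuous_opp a').
apply: is_derive_ext_val (is_derive_minus (fun _ => 1) a t _ _ (is_derive_const _ _) (h t)) _.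
by rewrite /minus /plus /opp /zero /=; ring.
Qed.

Lemma C1_pair_opp a a' : C1_pair a a' -> C1_pair (fun t => - a t) (fun t => - a' t).
Proof.
move=> [h c]; split=> t; last by apply: (continuous_opp a').
exact: (is_derive_opp a t _ (h t)).
Qed.

(** The terms [Arg (1 - z) d log|z|] coming from [ImLi2] and from the product cancel, and only the
    form [steta] is left. *)
Lemma is_derive_BW1 (a b a' b' : R -> R) (t : R) :
  C1_pair a a' -> C1_pair b b' -> slit (1 - a t) (- b t) -> 0 < nrm2 (a t) (b t) ->
  is_derive (fun t => BW1 (a t) (b t)) t (steta (a t) (b t) (a' t) (b' t)).
Proof.
move=> ha hb h h0.
have hI := is_derive_ImLi2 ha hb h h0.
have hA : is_derive (fun t => Arg (1 - a t) (- b t)) t _ :=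
   is_derive_Arg (proj1 (C1_pair_compl ha) t) (proj1 (C1_pair_opp hb) t) h.
have hL := is_derive_lnabs (proj1 ha t) (proj1 hb t) h0.
have hM : is_derive (fun t => Arg (1 - a t) (- b t) * lnabs (a t) (b t)) t _ :=
   is_derive_mult _ _ _ _ _ hA hL Rmult_comm.
apply: is_derive_ext_val (is_derive_plus _ _ _ _ _ hI hM) _.
by rewrite /plus /mult /= /steta /eta; ring.
Qed.

Lemma is_derive_BW2 (a b a' b' : R -> R) (t : R) :
  C1_pair a a' -> C1_pair b b' -> slit (a t) (b t) -> 0 < nrm2 (1 - a t) (- b t) ->
  is_derive (fun t => BW2 (a t) (b t)) t (steta (a t) (b t) (a' t) (b' t)).
Proof.
move=> ha hb h h0.
have := is_derive_opp _ _ _ (is_derive_BW1 (t := t) (C1_pair_compl ha) (C1_pair_opp hb) _ h0).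
have e1 : 1 - (1 - a t) = a t by ring.
have e2 : - - b t = b t by ring.
rewrite e1 e2 => /(_ h) H; apply: is_derive_ext_val H _.
by rewrite /opp /= /steta /eta e1 e2 !Ropp_involutive; ring.
Qed.

Lemma Arg_pos u : 0 < u -> Arg u 0 = 0.
Proof. by rewrite /Arg /Rdiv Rmult_0_l atan_0 Rmult_0_r. Qed.

Lemma BW1_real u : 0 < u < 1 -> BW1 u 0 = 0.
Proof.
move=> hu; rewrite /BW1 Ropp_0 Arg_pos; last by lra.
rewrite Rmult_0_l Rplus_0_r /ImLi2 (RInt_ext _ (fun _ => 0)); last first.
  move=> s; rewrite Rmin_left ?Rmax_right; try lra; move=> hs.
  rewrite /dilog_kernel Ropp_0; case: Req_EM_T => // _.
  by rewrite Rmult_0_r Ropp_0 Arg_pos ?/Rdiv ?Rmult_0_l //; nra.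
by rewrite RInt_const /scal /= /mult /=; ring.
Qed.

(* Both are primitives of the same form on a domain which is star-shaped about
   1/2, where both vanish. *)
Lemma BW1_BW2 u v : slit (1 - u) (- v) -> slit u v -> BW1 u v = BW2 u v.
Proof.
move=> h1 h2.
pose a s := / 2 + s * (u - / 2); pose b s := s * v.
have ha : C1_pair a (fun _ => u - / 2).
  split=> s; last exact: continuous_const.
  by rewrite /a; auto_derive => //; ring.
have hb : C1_pair b (fun _ => v).
  split=> s; last exact: continuous_const.
  by rewrite /b; auto_derive => //; ring.
have k1 s : 0 <= s <= 1 -> slit (1 - a s) (- b s).
  by rewrite /slit /a /b => hs; case: h1 => h1; have [s0|s0] := Req_dec s 0;
    [right; subst s; lra | left; nra | right; nra | right; nra].
have k2 s : 0 <= s <= 1 -> slit (a s) (b s).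
  by rewrite /slit /a /b => hs; case: h2 => h2; have [s0|s0] := Req_dec s 0;
    [right; subst s; lra | left; nra | right; nra | right; nra].
pose f s := minus (BW1 (a s) (b s)) (BW2 (a s) (b s)).
have hf s : 0 <= s <= 1 -> is_derive f s 0.
  move=> hs; have n1 := slit_nrm2 (k1 _ hs); have n2 := slit_nrm2 (k2 _ hs).
  apply: is_derive_ext_val (is_derive_minus _ _ _ _ _
    (is_derive_BW1 ha hb (k1 _ hs) n2) (is_derive_BW2 ha hb (k2 _ hs) n1)) _.
  by rewrite /minus /plus /opp /=; ring.
have I : is_RInt (fun _ => 0) 0 1 (minus (f 1) (f 0)).
  apply: is_RInt_derive => s; rewrite Rmin_left ?Rmax_right; try lra; move=> hs.
    exact: hf.
  exact: continuous_const.
have := is_RInt_unique _ _ _ _ I; rewrite RInt_const /f /a /b.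
rewrite !Rmult_0_l !Rmult_1_l !Rplus_0_r.
have -> : BW2 (/ 2) 0 = 0 by rewrite /BW2 Ropp_0 BW1_real; lra.
rewrite BW1_real; last by lra.
rewrite /minus /plus /opp /scal /= /mult /=.
have -> : / 2 + (u - / 2) = u by ring.
lra.
Qed.

(** The domains of [BW1] and [BW2] cover the plane, so the two branches glue to a primitive along
    any loop avoiding 0 and 1, and its increment over a closed loop is zero. *)
Lemma is_RInt_steinberg (a b a' b' : R -> R) T : 0 <= T ->
  C1_pair a a' -> C1_pair b b' ->
  (forall t, 0 < nrm2 (a t) (b t)) -> (forall t, 0 < nrm2 (1 - a t) (- b t)) ->
  a T = a 0 -> b T = b 0 ->
  is_RInt (fun t => steta (a t) (b t) (a' t) (b' t)) 0 T 0.
Proof.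
move=> T0 ha hb n1 n2 aT bT.
have dec u v : {slit (1 - u) (- v)} + {v = 0 /\ 1 <= u}.
  have [v0|v0] := Req_EM_T v 0; last by left; left; lra.
  by have [h|h] := Rlt_dec 0 (1 - u); [left; right | right; lra].
pose D u v := match dec u v with left _ => BW1 u v | right _ => BW2 u v end.
have D1 u v : slit (1 - u) (- v) -> D u v = BW1 u v.
  by rewrite /D; case: (dec _ _) => // -[-> h] [] ; lra.
have D2 u v : slit u v -> D u v = BW2 u v.
  by rewrite /D; case: (dec _ _) => // h1 h2; exact: BW1_BW2.
have cc t : continuous (fun t => 1 - a t) t by exact: C1_cont (C1_pair_compl ha).
have cd t : continuous (fun t => - b t) t by exact: C1_cont (C1_pair_opp hb).
have ca t : continuous a t by exact: C1_cont ha.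
have cb t : continuous b t by exact: C1_cont hb.
pose F t := D (a t) (b t).
have e : minus (F T) (F 0) = 0 by rewrite /F aT bT /minus /plus /opp /=; ring.
suff : is_RInt (fun t => steta (a t) (b t) (a' t) (b' t)) 0 T (minus (F T) (F 0)).
  by rewrite {1}e.
apply: is_RInt_derive => t _; last first.
  exact: continuous_eta (C1_pair_compl ha) (C1_pair_opp hb) (n1 t) (n2 t).
case: (dec (a t) (b t)) => [h|h].
  apply: is_derive_ext_loc (is_derive_BW1 ha hb h (n1 t)).
  by apply: filter_imp (slit_locally (cc t) (cd t) h) => s hs; rewrite /F D1.
have {}h : slit (a t) (b t) by right; lra.
apply: is_derive_ext_loc (is_derive_BW2 ha hb h (n2 t)).
by apply: filter_imp (slit_locally (ca t) (cb t) h) => s hs; rewrite /F D2.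
Qed.

(** * Calculus of C^1 functions, bilinearity of the form, integration by parts *)

Lemma C1_pair_ext f g df dg : (forall t, f t = g t) -> (forall t, df t = dg t) ->
  C1_pair f df -> C1_pair g dg.
Proof.
move=> e e' [h c]; split=> t.
  by rewrite -e'; apply: is_derive_ext (h t).
by apply: continuous_ext (c t) => s; rewrite e'.
Qed.

Lemma C1_pair_const c : C1_pair (fun _ => c) (fun _ => 0).
Proof.
split=> t; last exact: continuous_const.
exact: (is_derive_const c t).
Qed.

Lemma C1_pair_add f g df dg : C1_pair f df -> C1_pair g dg ->
  C1_pair (fun t => f t + g t) (fun t => df t + dg t).
Proof.
move=> [h c] [h' c']; split=> t; last exact: (continuous_plus df dg).
exact: (is_derive_plus f g).
Qed.

Lemma C1_pair_mul f g df dg : C1_pair f df -> C1_pair g dg ->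
  C1_pair (fun t => f t * g t) (fun t => df t * g t + f t * dg t).
Proof.
move=> hf hg; split=> t.
  exact: (is_derive_mult f g t _ _ (proj1 hf t) (proj1 hg t) Rmult_comm).
have cf : continuous f t by exact: C1_cont hf.
have cg : continuous g t by exact: C1_cont hg.
apply: (continuous_plus (fun t => df t * g t) (fun t => f t * dg t)).
  by apply: (continuous_mult df g) => //; exact: (proj2 hf t).
by apply: (continuous_mult f dg) => //; exact: (proj2 hg t).
Qed.

Lemma C1_pair_inv f df : C1_pair f df -> (forall t, f t <> 0) ->
  C1_pair (fun t => / f t) (fun t => - df t / f t ^ 2).
Proof.
move=> hf h; split=> t; first exact: (is_derive_inv f t _ (proj1 hf t) (h t)).
have cf : continuous f t by exact: C1_cont hf.
apply: (continuous_div (f := fun t => - df t) (g := fun t => f t ^ 2)).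
- exact: (continuous_opp df t (proj2 hf t)).
- apply: (continuous_ext (fun t => f t * f t)); last exact: (continuous_mult f f).
  by move=> s /=; ring.
- exact: pow_nonzero.
Qed.

Lemma C1_pair_sqrt f df : C1_pair f df -> (forall t, 0 < f t) ->
  C1_pair (fun t => sqrt (f t)) (fun t => df t / (2 * sqrt (f t))).
Proof.
move=> hf h; split=> t; first exact: (is_derive_sqrt f t _ (proj1 hf t) (h t)).
have cf : continuous f t by exact: C1_cont hf.
apply: (continuous_div (f := df) (g := fun t => 2 * sqrt (f t))).
- exact: (proj2 hf t).
- apply: (continuous_mult (fun _ => 2) (fun t => sqrt (f t))); first exact: continuous_const.
  exact: (continuous_comp f sqrt t cf (continuous_sqrt _)).
- by have := sqrt_lt_R0 _ (h t); lra.
Qed.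

Lemma C1_pair_cos : C1_pair cos (fun t => - sin t).
Proof.
split=> t; first by apply: is_derive_cos.
exact: (continuous_opp sin t (continuous_sin t)).
Qed.

Lemma C1_pair_sin : C1_pair sin cos.
Proof. by split=> t; [apply: is_derive_sin | exact: continuous_cos]. Qed.

Lemma nrm2_mul a b c d : nrm2 (a * c - b * d) (a * d + b * c) = nrm2 a b * nrm2 c d.
Proof. by rewrite /nrm2; ring. Qed.

Lemma lnabs_mul a b c d : 0 < nrm2 a b -> 0 < nrm2 c d ->
  lnabs (a * c - b * d) (a * d + b * c) = lnabs a b + lnabs c d.
Proof. by move=> h h'; rewrite /lnabs nrm2_mul ln_mult //; ring. Qed.

Lemma darg_mul a b c d a' b' c' d' : 0 < nrm2 a b -> 0 < nrm2 c d ->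
  darg (a * c - b * d) (a * d + b * c)
    (a' * c + a * c' - (b' * d + b * d')) (a' * d + a * d' + (b' * c + b * c'))
  = darg a b a' b' + darg c d c' d'.
Proof.
move=> h h'; rewrite /darg nrm2_mul.
by move: h h'; rewrite /nrm2 => h h'; field; split; lra.
Qed.

Lemma eta_mull a b c d a' b' c' d' e f e' f' : 0 < nrm2 a b -> 0 < nrm2 c d ->
  eta (a * c - b * d) (a * d + b * c)
    (a' * c + a * c' - (b' * d + b * d')) (a' * d + a * d' + (b' * c + b * c')) e f e' f'
  = eta a b a' b' e f e' f' + eta c d c' d' e f e' f'.
Proof. by move=> h h'; rewrite /eta darg_mul // lnabs_mul //; ring. Qed.

Lemma eta_anti a b a' b' c d c' d' :
  eta a b a' b' c d c' d' = - eta c d c' d' a b a' b'.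
Proof. by rewrite /eta; ring. Qed.

(** With [f = a + ib] and [g = c + id], the integrand is the differential of [log|f| Arg g], which
    is single-valued because [g] stays in the slit plane. *)
Lemma is_RInt_by_parts (a b a' b' c d c' d' : R -> R) T : 
  C1_pair a a' -> C1_pair b b' -> C1_pair c c' -> C1_pair d d' ->
  (forall t, 0 < nrm2 (a t) (b t)) -> (forall t, slit (c t) (d t)) ->
  a T = a 0 -> b T = b 0 -> c T = c 0 -> d T = d 0 ->
  is_RInt (fun t => lnabs (a t) (b t) * darg (c t) (d t) (c' t) (d' t)
     + dlnabs (a t) (b t) (a' t) (b' t) * Arg (c t) (d t)) 0 T 0.
Proof.
move=> ha hb hc hd h1 h2 eA eb ec ed.
pose F t := lnabs (a t) (b t) * Arg (c t) (d t).
have e : minus (F T) (F 0) = 0 by rewrite /F eA eb ec ed /minus /plus /opp /=; ring.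
rewrite -{2}e.
have ca t : continuous a t by exact: C1_cont ha.
have cb t : continuous b t by exact: C1_cont hb.
have cc t : continuous c t by exact: C1_cont hc.
have cd t : continuous d t by exact: C1_cont hd.
have dL t := is_derive_lnabs (proj1 ha t) (proj1 hb t) (h1 t).
have dA t := is_derive_Arg (proj1 hc t) (proj1 hd t) (h2 t).
apply: is_RInt_derive => t _.
  have hM : is_derive F t _ := is_derive_mult _ _ _ _ _ (dL t) (dA t) Rmult_comm.
  apply: is_derive_ext_val hM _.
  by rewrite /plus /mult /=; ring.
apply: (continuous_plus (fun t => lnabs (a t) (b t) * darg (c t) (d t) (c' t) (d' t))
   (fun t => dlnabs (a t) (b t) (a' t) (b' t) * Arg (c t) (d t))).
  apply: (continuous_mult (fun t => lnabs (a t) (b t))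
      (fun t => darg (c t) (d t) (c' t) (d' t))); first exact: continuous_lnabs.
  by apply: continuous_darg => //; [exact: (proj2 hc) | exact: (proj2 hd) | exact: slit_nrm2].
apply: (continuous_mult (fun t => dlnabs (a t) (b t) (a' t) (b' t))
    (fun t => Arg (c t) (d t))).
  by apply: continuous_dlnabs => //; [exact: (proj2 ha) | exact: (proj2 hb)].
by apply: ex_derive_continuous; eexists; exact: dA.
Qed.

Lemma is_RInt_darg_slit (c d c' d' : R -> R) T : 
  C1_pair c c' -> C1_pair d d' -> (forall t, slit (c t) (d t)) ->
  c T = c 0 -> d T = d 0 ->
  is_RInt (fun t => darg (c t) (d t) (c' t) (d' t)) 0 T 0.
Proof.
move=> hc hd h2 ec ed.
have dA t := is_derive_Arg (proj1 hc t) (proj1 hd t) (h2 t).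
pose F t := Arg (c t) (d t).
have e : minus (F T) (F 0) = 0 by rewrite /F ec ed /minus /plus /opp /=; ring.
rewrite -{2}e.
apply: (@is_RInt_derive _ F) => t _; first exact: dA.
by apply: continuous_darg; [exact: C1_cont hc | exact: C1_cont hd | exact: (proj2 hc)
   | exact: (proj2 hd) | exact: slit_nrm2].
Qed.

(** * Bounds for the integral of the form *)

Lemma Arg_bound u v : Rabs (Arg u v) <= 4.
Proof.
rewrite /Arg; have := atan_bound (v / (sqrt (nrm2 u v) + u)).
move: (atan _) => a ha; have := PI_4; move=> hp.
by apply: Rabs_le; lra.
Qed.

Lemma lnabs_bound u v : / 4 <= nrm2 u v <= 9 / 4 -> Rabs (lnabs u v) <= 1.
Proof.
move=> [h1 h2]; rewrite /lnabs.
have p : 0 < nrm2 u v by lra.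
have i1 : ln (nrm2 u v) <= 2.
  by have := exp_ineq1_le (ln (nrm2 u v)); rewrite exp_ln //; lra.
have i2 : - ln (nrm2 u v) <= 2 * 1.
  rewrite -ln_Rinv //.
  (* Applying [ln w <= w - 1] to [w = 1 / nrm2] itself would only give 3; applied to the square
     root, which is at most 2, it gives [2 * (2 - 1)]. *)
  have -> : / nrm2 u v = sqrt (/ nrm2 u v) * sqrt (/ nrm2 u v).
    by rewrite sqrt_sqrt //; apply: Rlt_le; exact: Rinv_0_lt_compat.
  have q : 0 < / nrm2 u v by exact: Rinv_0_lt_compat.
  have q' := sqrt_lt_R0 _ q.
  rewrite ln_mult //.
  have : sqrt (/ nrm2 u v) <= 2.
    rewrite -[2](sqrt_square 2); last by lra.
    apply: sqrt_le_1; [lra | lra |].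
    have -> : 2 * 2 = / / 4 by field.
    by apply: Rinv_le_contravar; lra.
  by have := exp_ineq1_le (ln (sqrt (/ nrm2 u v))); rewrite exp_ln //; lra.
by apply: Rabs_le; lra.
Qed.

(** [darg] is the imaginary part of [f' / f], a number of modulus at most 1; the identity [e] is
    Lagrange's. *)
Lemma darg_bound u v u' v' : 0 < nrm2 u v -> nrm2 u' v' <= nrm2 u v ->
  Rabs (darg u v u' v') <= 1.
Proof.
move=> h h'; rewrite /darg.
have e : nrm2 u v * nrm2 u' v' = (u * v' - v * u') ^ 2 + (u * u' + v * v') ^ 2.
  by rewrite /nrm2; ring.
have k : (u * v' - v * u') ^ 2 <= nrm2 u v ^ 2.
  have k1 : nrm2 u v * nrm2 u' v' <= nrm2 u v * nrm2 u v.
    by apply: Rmult_le_compat_l; lra.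
  have := pow2_ge_0 (u * u' + v * v'); rewrite /= in k1 *; lra.
rewrite /Rdiv Rabs_mult Rabs_inv (Rabs_pos_eq (nrm2 u v)); last by lra.
apply: (Rmult_le_reg_r (nrm2 u v)) => //.
rewrite Rmult_assoc Rinv_l ?Rmult_1_r ?Rmult_1_l; last by lra.
move: k; set z := _ - _; move=> k; apply: Rabs_le; split; nra.
Qed.

Lemma dlnabs_bound u v u' v' : 0 < nrm2 u v -> nrm2 u' v' <= nrm2 u v ->
  Rabs (dlnabs u v u' v') <= 1.
Proof.
move=> h h'; have -> : dlnabs u v u' v' = darg u v (- v') u'.
  by rewrite /dlnabs /darg; congr (_ / _); ring.
by apply: darg_bound => //; move: h'; rewrite /nrm2; nra.
Qed.

(* Integrating by parts moves the derivative from the factor close to 1 to [a + ib]. *)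
Lemma RInt_eta_bound (a b a' b' c d c' d' : R -> R) T : 0 <= T ->
  C1_pair a a' -> C1_pair b b' -> C1_pair c c' -> C1_pair d d' ->
  (forall t, 0 < nrm2 (a t) (b t)) ->
  (forall t, nrm2 (a' t) (b' t) <= nrm2 (a t) (b t)) ->
  (forall t, nrm2 (c t - 1) (d t) <= / 4) ->
  a T = a 0 -> b T = b 0 -> c T = c 0 -> d T = d 0 ->
  Rabs (RInt (fun t => eta (a t) (b t) (a' t) (b' t) (c t) (d t) (c' t) (d' t)) 0 T)
  <= 5 * T.
Proof.
move=> T0 ha hb hc hd h1 h2 h3 eA eb ec ed.
have near1 t : / 2 <= c t /\ / 4 <= nrm2 (c t) (d t) <= 9 / 4.
  have := h3 t; rewrite /nrm2 => h.
  have k2 : / 2 <= c t <= 3 / 2 by split; nra.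
  by split; [lra | nra].
have hs t : slit (c t) (d t) by right; have := near1 t; lra.
have I := is_RInt_by_parts ha hb hc hd h1 hs eA eb ec ed.
pose H t := lnabs (c t) (d t) * darg (a t) (b t) (a' t) (b' t)
  + dlnabs (a t) (b t) (a' t) (b' t) * Arg (c t) (d t).
have E : ex_RInt (fun t => eta (a t) (b t) (a' t) (b' t) (c t) (d t) (c' t) (d' t)) 0 T.
  apply: ex_RInt_continuous => t _; apply: continuous_eta => //.
  exact: slit_nrm2.
have J := is_RInt_minus _ _ _ _ _ _ I (RInt_correct _ _ _ E).
set I0 := RInt _ _ _ in J *.
have K : is_RInt H 0 T (minus 0 I0).
  apply: is_RInt_ext J => t _.
  by rewrite /H /eta /minus /plus /opp /=; ring.
have eH : RInt H 0 T = - I0.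
  by rewrite (is_RInt_unique _ _ _ _ K) /minus /plus /opp /=; ring.
rewrite -Rabs_Ropp -eH Rmult_comm -[T in T * 5]Rminus_0_r.
apply: abs_RInt_le_const => //; first by eexists; exact: K.
move=> t _; rewrite /H.
have b1 := lnabs_bound (proj2 (near1 t)).
have b2 := darg_bound (h1 t) (h2 t).
have b3 := dlnabs_bound (h1 t) (h2 t).
have b4 := Arg_bound (c t) (d t).
apply: Rle_trans (Rabs_triang _ _) _.
(* The bounds are 1 for [log|g|], for [darg f] and for [dlnabs f], and 4, an upper bound of [pi],
   for [Arg g]. *)
have -> : 5 = 1 * 1 + 1 * 4 by ring.
by apply: Rplus_le_compat; rewrite Rabs_mult; apply: Rmult_le_compat => //; exact: Rabs_pos.
Qed.

End RegulatorForm.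

From mathcomp Require Import all_boot all_order all_algebra.
From mathcomp Require Import boolp classical_sets reals cardinality.
From mathcomp Require Import ereal lebesgue_measure complex Rstruct.
From mathcomp Require Import ring lra zify.

Import Order.TTheory GRing.Theory Num.Theory.
Import RegulatorForm.

Local Open Scope classical_set_scope.
Local Open Scope ring_scope.
Local Open Scope complex_scope.

(** * The regulator pairing of complex-valued periodic functions *)

Local Notation RR := Rdefinitions.R.
Local Notation CC := (complex Rdefinitions.R).

Section RegulatorPairing.
Import Coquelicot.Hierarchy Coquelicot.Derive Coquelicot.RInt.
Local Notation Re := complex.Re.
Local Notation Im := complex.Im.

Definition C1c (g : RR -> CC) : Prop := exists dg : RR -> CC,
  C1_pair (fun t => Re (g t)) (fun t => Re (dg t)) /\
  C1_pair (fun t => Im (g t)) (fun t => Im (dg t)).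

(** The total operator [Derive] makes [ceta] and [reg] depend on the functions alone, not on a
    chosen witness of differentiability. *)
Definition dC (g : RR -> CC) (t : RR) : CC :=
  Complex (Derive (fun t => Re (g t)) t) (Derive (fun t => Im (g t)) t).

Lemma C1_pair_Derive f df : C1_pair f df -> Derive f = df.
Proof. by move=> [h _]; apply/funext => t; exact: is_derive_unique. Qed.

Lemma dC_eq g dg :
  C1_pair (fun t => Re (g t)) (fun t => Re (dg t)) ->
  C1_pair (fun t => Im (g t)) (fun t => Im (dg t)) -> dC g = dg.
Proof.
move=> h1 h2; apply/funext => t.
by rewrite /dC (C1_pair_Derive h1) (C1_pair_Derive h2); case: (dg t).
Qed.

Lemma C1cP g : C1c g ->
  C1_pair (fun t => Re (g t)) (fun t => Re (dC g t)) /\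
  C1_pair (fun t => Im (g t)) (fun t => Im (dC g t)).
Proof. by move=> [dg [h1 h2]]; rewrite (dC_eq h1 h2). Qed.

Lemma Re_mul (z w : CC) : Re (z * w) = Re z * Re w - Im z * Im w.
Proof. by case: z => a b; case: w. Qed.
Lemma Im_mul (z w : CC) : Im (z * w) = Re z * Im w + Im z * Re w.
Proof. by case: z => a b; case: w. Qed.
Lemma Re_add (z w : CC) : Re (z + w) = Re z + Re w.
Proof. by case: z => a b; case: w. Qed.
Lemma Im_add (z w : CC) : Im (z + w) = Im z + Im w.
Proof. by case: z => a b; case: w. Qed.
Lemma Re_opp (z : CC) : Re (- z) = - Re z. Proof. by case: z. Qed.
Lemma Im_opp (z : CC) : Im (- z) = - Im z. Proof. by case: z. Qed.

Lemma C1c_pair g dg :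
  C1_pair (fun t => Re (g t)) (fun t => Re (dg t)) ->
  C1_pair (fun t => Im (g t)) (fun t => Im (dg t)) -> C1c g /\ dC g = dg.
Proof. by move=> h1 h2; split; [exists dg | exact: dC_eq]. Qed.

Lemma C1c_const c : C1c (fun=> c) /\ dC (fun=> c) = (fun=> 0).
Proof. by apply: C1c_pair; exact: C1_pair_const. Qed.

Lemma C1c_mul g h : C1c g -> C1c h -> C1c (fun t => g t * h t) /\
  dC (fun t => g t * h t) = fun t => dC g t * h t + g t * dC h t.
Proof.
move=> /C1cP[g1 g2] /C1cP[h1 h2]; apply: C1c_pair.
  apply: C1_pair_ext (C1_pair_add (C1_pair_mul g1 h1) (C1_pair_opp (C1_pair_mul g2 h2))).
    by move=> t; rewrite Re_mul.
  by move=> t; rewrite Re_add !Re_mul !RplusE !RoppE !RmultE; ring.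
apply: C1_pair_ext (C1_pair_add (C1_pair_mul g1 h2) (C1_pair_mul g2 h1)).
  by move=> t; rewrite Im_mul.
by move=> t; rewrite Im_add !Im_mul !RplusE !RmultE; ring.
Qed.

Lemma C1c_add g h : C1c g -> C1c h -> C1c (fun t => g t + h t) /\
  dC (fun t => g t + h t) = fun t => dC g t + dC h t.
Proof.
move=> /C1cP[g1 g2] /C1cP[h1 h2]; apply: C1c_pair.
  apply: C1_pair_ext (C1_pair_add g1 h1) => t; by rewrite Re_add.
by apply: C1_pair_ext (C1_pair_add g2 h2) => t; rewrite Im_add.
Qed.

Lemma C1c_opp g : C1c g -> C1c (fun t => - g t) /\
  dC (fun t => - g t) = fun t => - dC g t.
Proof.
move=> /C1cP[g1 g2]; apply: C1c_pair.
  apply: C1_pair_ext (C1_pair_opp g1) => t; by rewrite Re_opp.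
by apply: C1_pair_ext (C1_pair_opp g2) => t; rewrite Im_opp.
Qed.

Lemma nrm2c_gt0 (z : CC) : z != 0 -> Rdefinitions.Rlt 0 (nrm2 (Re z) (Im z)).
Proof.
move=> z0; apply: nrm2_gt0; case: z z0 => a b /=; rewrite eq_complex negb_and /=.
by move=> /orP[] /eqP h; [left | right].
Qed.

Lemma C1c_inv g : C1c g -> (forall t, g t != 0) -> C1c (fun t => (g t)^-1).
Proof.
move=> /C1cP[g1 g2] g0.
have N0 t : nrm2 (Re (g t)) (Im (g t)) <> 0.
  by have /RltP/lt0r_neq0/eqP := nrm2c_gt0 (g0 t).
have N := C1_pair_inv (C1_pair_add (C1_pair_mul g1 g1) (C1_pair_mul g2 g2)) N0.
have P1 := C1_pair_mul g1 N; have P2 := C1_pair_opp (C1_pair_mul g2 N).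
move: P1 P2.
set e1 := (X in C1_pair _ X -> _) => P1; set e2 := (X in C1_pair _ X -> _) => P2.
exists (fun t => Complex (e1 t) (e2 t)); split.
  apply: C1_pair_ext P1 => // t.
  by case: (g t) => a b /=; rewrite RplusE !RmultE RinvE !expr2.
apply: C1_pair_ext P2 => // t.
by case: (g t) => a b /=; rewrite RplusE !RmultE RinvE RoppE !expr2.
Qed.

Definition ceta (g h : RR -> CC) (t : RR) : RR :=
  eta (Re (g t)) (Im (g t)) (Re (dC g t)) (Im (dC g t))
      (Re (h t)) (Im (h t)) (Re (dC h t)) (Im (dC h t)).

Definition twopi : RR := Rdefinitions.Rmult 2 Rtrigo1.PI.

Lemma twopi_ge0 : Rdefinitions.Rle 0 twopi.
Proof.
apply: RIneq.Rmult_le_pos; first by apply/RleP; rewrite ler0n.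
exact: RIneq.Rlt_le Rtrigo1.PI_RGT_0.
Qed.

Definition reg (g h : RR -> CC) : RR := RInt (ceta g h) 0 twopi.

Definition nonvan (g : RR -> CC) := C1c g /\ forall t, g t != 0.

Lemma ex_RInt_ceta g h : nonvan g -> nonvan h -> ex_RInt (ceta g h) 0 twopi.
Proof.
move=> [/C1cP[g1 g2] g0] [/C1cP[h1 h2] h0].
apply: ex_RInt_continuous => t _.
by apply: (continuous_eta g1 g2 h1 h2); exact: nrm2c_gt0.
Qed.

Lemma reg_mull g1 g2 h : nonvan g1 -> nonvan g2 -> nonvan h ->
  reg (fun t => g1 t * g2 t) h = reg g1 h + reg g2 h.
Proof.
move=> n1 n2 nh; rewrite /reg.
rewrite -[RHS](RInt_plus _ _ _ _ (ex_RInt_ceta n1 nh) (ex_RInt_ceta n2 nh)).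
apply: RInt_ext => t _; case: n1 n2 => c1 z1 [c2 z2].
rewrite /ceta (C1c_mul c1 c2).2 Re_add Im_add !Re_mul !Im_mul.
rewrite -[RHS](eta_mull _ _ _ _ _ _ _ _ (nrm2c_gt0 (z1 t)) (nrm2c_gt0 (z2 t))).
by rewrite /eta /darg !(RplusE, RmultE, RoppE, RminusE); congr (_ * _ - _ * _);
  congr (_ / _); ring.
Qed.

Lemma reg_anti g h : nonvan g -> nonvan h -> reg g h = - reg h g.
Proof.
move=> n1 n2; rewrite /reg -[RHS](RInt_opp _ _ _ (ex_RInt_ceta n2 n1)).
by apply: RInt_ext => t _; rewrite /ceta eta_anti.
Qed.

Lemma reg_steinberg g : nonvan g -> (forall t, g t != 1) -> g twopi = g 0 ->
  reg g (fun t => 1 - g t) = 0.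
Proof.
move=> [c z] z1 per; have [c1 c2] := C1cP c.
have n1 t := nrm2c_gt0 (z t).
have n2 t : Rdefinitions.Rlt 0 (nrm2 (Rdefinitions.Rminus 1 (Re (g t)))
    (Rdefinitions.Ropp (Im (g t)))).
  have : 1 - g t != 0 by rewrite subr_eq0 eq_sym.
  by move/nrm2c_gt0; rewrite Re_add Im_add Re_opp Im_opp /= add0r.
apply: is_RInt_unique.
have := is_RInt_steinberg twopi_ge0 c1 c2 n1 n2 (congr1 _ per) (congr1 _ per).
apply: is_RInt_ext => t _; rewrite /ceta /steta.
have [cc ->] := C1c_add (C1c_const 1).1 (C1c_opp c).1.
rewrite (C1c_const 1).2 (C1c_opp c).2 !Re_add !Im_add !Re_opp !Im_opp /=.
by rewrite !add0r.
Qed.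

Definition lnn (z : CC) : RR := lnabs (Re z) (Im z).

(** For a nonvanishing loop, [2 pi] times the winding number about 0. *)
Definition wind (g : RR -> CC) : RR :=
  RInt (fun t => darg (Re (g t)) (Im (g t)) (Re (dC g t)) (Im (dC g t))) 0 twopi.

Lemma reg_const g c : nonvan g -> c != 0 -> reg g (fun=> c) = - lnn c * wind g.
Proof.
move=> [/C1cP[g1 g2] z] c0; rewrite /reg /wind.
rewrite -[RHS](RInt_scal (fun t => darg (Re (g t)) (Im (g t)) (Re (dC g t)) (Im (dC g t)))
   0 twopi (- lnn c)).
  apply: RInt_ext => t _; rewrite /ceta (C1c_const c).2 /eta /Hierarchy.scal /=
    /Hierarchy.mult /=.
  have -> : darg (Re c) (Im c) 0 0 = 0.
    by rewrite /darg !(RmultE, RminusE, RdivE) !mulr0 subrr mul0r.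
  by rewrite !(RmultE, RminusE) mulr0 sub0r mulNr.
apply: ex_RInt_continuous => t _.
apply: (@continuous_darg (fun t => Re (g t)) (fun t => Im (g t))).
- exact: C1_cont g1.
- exact: C1_cont g2.
- exact: (proj2 g1).
- exact: (proj2 g2).
- exact: nrm2c_gt0.
Qed.

Definition circ (q rho : RR) (t : RR) : CC :=
  Complex (q + rho * Rtrigo_def.cos t) (rho * Rtrigo_def.sin t).

Lemma C1c_circ q rho : C1c (circ q rho) /\
  dC (circ q rho) = fun t => Complex (- (rho * Rtrigo_def.sin t)) (rho * Rtrigo_def.cos t).
Proof.
apply: C1c_pair.
  apply: C1_pair_ext (C1_pair_add (C1_pair_const q)
    (C1_pair_mul (C1_pair_const rho) C1_pair_cos)) => // t.
  by rewrite !(RplusE, RmultE, RoppE) /= mul0r !add0r mulrN.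
apply: C1_pair_ext (C1_pair_mul (C1_pair_const rho) C1_pair_sin) => // t.
by rewrite !(RplusE, RmultE) /= mul0r add0r.
Qed.

(* [Rtrigo1.cos_2PI] is stated with the [R_scope] numeral [IZR 2]. *)
Lemma twopiE : twopi = Rdefinitions.Rmult
  (Rdefinitions.IZR (BinNums.Zpos (BinNums.xO BinNums.xH))) Rtrigo1.PI.
Proof. by []. Qed.

Lemma circ_periodic q rho : circ q rho twopi = circ q rho 0.
Proof.
rewrite /circ twopiE Rtrigo1.cos_2PI Rtrigo1.sin_2PI.
by rewrite Rtrigo_def.cos_0 Rtrigo_def.sin_0.
Qed.

Lemma cos2sin2 t : Rtrigo_def.cos t * Rtrigo_def.cos t +
  Rtrigo_def.sin t * Rtrigo_def.sin t = 1 :> RR.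
Proof. by rewrite addrC; exact: Rtrigo1.sin2_cos2. Qed.

Lemma nrm2E (a b : RR) : nrm2 a b = a ^+ 2 + b ^+ 2.
Proof. by rewrite /nrm2 RplusE !RmultE !expr2. Qed.

Lemma nrm2_norm (z : CC) (r : RR) : 0 <= r -> 
  (`|z| <= r%:C) = (nrm2 (Re z) (Im z) <= r ^+ 2).
Proof.
move=> r0; rewrite nrm2E normc_def lecR -[r in LHS]ger0_norm // -sqrtr_sqr.
by rewrite ler_sqrt // sqr_ge0.
Qed.

Lemma nrm2_norm_ge (z : CC) (r : RR) : 0 <= r -> 
  (r%:C <= `|z|) = (r ^+ 2 <= nrm2 (Re z) (Im z)).
Proof.
move=> r0; rewrite nrm2E normc_def lecR -[r in LHS]ger0_norm // -sqrtr_sqr.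
by rewrite ler_sqrt // addr_ge0 // sqr_ge0.
Qed.

Lemma circ0_nrm2 rho t : nrm2 (Re (circ 0 rho t)) (Im (circ 0 rho t)) = rho ^+ 2.
Proof. by rewrite nrm2E /= add0r !exprMn -mulrDr !expr2 cos2sin2 mulr1. Qed.

Lemma wind_circ0 (rho : RR) : rho != 0 -> wind (circ 0 rho) = twopi.
Proof.
move=> r0; rewrite /wind (C1c_circ 0 rho).2.
rewrite (RInt_ext _ (fun=> 1 : RR)); last first.
  move=> t _; rewrite /darg circ0_nrm2 /= RdivE RminusE !RmultE add0r.
  have -> : rho * Rtrigo_def.cos t * (rho * Rtrigo_def.cos t) -
   rho * Rtrigo_def.sin t * - (rho * Rtrigo_def.sin t) = rho ^+ 2.
    rewrite mulrN opprK -[RHS]mulr1 -(cos2sin2 t); ring.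
  by rewrite mulfV // expf_neq0.
by rewrite RInt_const /Hierarchy.scal /= /Hierarchy.mult /= RmultE RminusE subr0 mulr1.
Qed.

Lemma cos_bound t : -1 <= (Rtrigo_def.cos t : RR) <= 1.
Proof. have := cos2sin2 t; set c := Rtrigo_def.cos t; set s := Rtrigo_def.sin t; nra. Qed.

Lemma circ1_nrm2 (q rho t : RR) : q ^+ 2 = 1 -> 0 < rho < 1/2 -> 
  1 / 4 <= nrm2 (Re (circ q rho t)) (Im (circ q rho t)).
Proof.
move=> q1 hr; rewrite nrm2E /=.
have -> : (q + rho * Rtrigo_def.cos t) ^+ 2 + (rho * Rtrigo_def.sin t) ^+ 2 =
  q ^+ 2 + 2 * q * rho * Rtrigo_def.cos t + rho ^+ 2 *
   (Rtrigo_def.cos t * Rtrigo_def.cos t + Rtrigo_def.sin t * Rtrigo_def.sin t) by ring.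
rewrite q1 cos2sin2; have := cos_bound t.
have /eqP : q ^+ 2 = 1 by []. rewrite sqrf_eq1 => /orP[] /eqP ->; nra.
Qed.

Lemma nonvan_circ (q rho : RR) : (q == 0) || (q ^+ 2 == 1) -> 0 < rho < 1/2 ->
  nonvan (circ q rho).
Proof.
move=> hq hr; split; first exact: (C1c_circ q rho).1.
move=> t; apply/eqP => e.
have : nrm2 (Re (circ q rho t)) (Im (circ q rho t)) = 0.
  by rewrite e nrm2E expr0n addr0.
case/orP: hq => /eqP hq; last by have := circ1_nrm2 t hq hr; lra.
by rewrite hq circ0_nrm2 => /eqP; rewrite expf_eq0 /= => /eqP; lra.
Qed.

Lemma circ_slit (rho t : RR) : 0 < rho < 1/2 -> slit (Re (circ 1 rho t)) (Im (circ 1 rho t)).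
Proof.
move=> hr; right; apply/RltP; change (0 < 1 + rho * Rtrigo_def.cos t).
have := cos_bound t; nra.
Qed.

Lemma wind_circ1 (rho : RR) : 0 < rho < 1/2 -> wind (circ 1 rho) = 0.
Proof.
move=> hr; apply: is_RInt_unique.
have [c1 c2] := C1cP (C1c_circ 1 rho).1.
exact: (is_RInt_darg_slit c1 c2 (fun t => @circ_slit rho t hr)
  (congr1 (@complex.Re _) (circ_periodic 1 rho))
  (congr1 (@complex.Im _) (circ_periodic 1 rho))).
Qed.

Lemma wind_opp g : C1c g -> wind (fun t => - g t) = wind g.
Proof.
move=> c; rewrite /wind (C1c_opp c).2; apply: RInt_ext => t _.
rewrite !Re_opp !Im_opp /darg !RdivE !RminusE !RmultE !nrm2E !sqrrN; congr (_ / _).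
by ring.
Qed.

(** After a change of sign the circle lies in the right half-plane, where [Arg] is a global
    primitive. *)
Lemma wind_circN1 (rho : RR) : 0 < rho < 1/2 -> wind (circ (-1) rho) = 0.
Proof.
move=> hr; rewrite -wind_opp; last exact: (C1c_circ _ _).1.
have [c1 c2] := C1cP (C1c_opp (C1c_circ (-1) rho).1).1.
apply: is_RInt_unique; apply: (is_RInt_darg_slit c1 c2); last 2 first.
- by rewrite circ_periodic.
- by rewrite circ_periodic.
move=> t; right; apply/RltP; change (0 < - (- 1 + rho * Rtrigo_def.cos t)).
have := cos_bound t; nra.
Qed.

Lemma reg_bound (q rho : RR) V : (q == 0) || (q ^+ 2 == 1) -> 0 < rho < 1/2 ->
  C1c V -> V twopi = V 0 -> (forall t, `|V t - 1| <= (1/2)%:C) ->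
  `|reg (circ q rho) V| <= 5 * twopi.
Proof.
move=> hq hr cV pV hV; have [n z] := nonvan_circ hq hr.
have [c1 c2] := C1cP n; have [v1 v2] := C1cP cV.
rewrite -RabsE; apply/RleP.
have e5 : (5%:R : RR) =
    Rdefinitions.IZR (BinNums.Zpos (BinNums.xI (BinNums.xO BinNums.xH))).
  by rewrite -INRE RIneq.INR_IZR_INZ.
rewrite e5 /reg /ceta.
have p1 := congr1 (@complex.Re _) (circ_periodic q rho).
have p2 := congr1 (@complex.Im _) (circ_periodic q rho).
have p3 := congr1 (@complex.Re _) pV; have p4 := congr1 (@complex.Im _) pV.
apply: (RInt_eta_bound twopi_ge0 c1 c2 v1 v2 (fun t => nrm2c_gt0 (z t)) _ _ p1 p2 p3 p4).
  (* The condition [|x'| <= |x|]: both sides are [rho] when the centre is 0, and [rho < 1/2 <= |x|]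
     when it is 1 or -1. *)
  move=> t; apply/RleP; rewrite (C1c_circ q rho).2 /=.
  have -> : nrm2 (- (rho * Rtrigo_def.sin t)) (rho * Rtrigo_def.cos t) = rho ^+ 2.
    by rewrite nrm2E sqrrN !exprMn -mulrDr addrC !expr2 cos2sin2 mulr1.
  case/orP: hq => /eqP hq; last by have := circ1_nrm2 t hq hr; rewrite /= ; nra.
  by have := circ0_nrm2 rho t; rewrite hq => /= ->.
move=> t; apply/RleP; have := hV t; rewrite nrm2_norm; last by lra.
rewrite Re_add Im_add Re_opp Im_opp /= oppr0 addr0 => h; apply: le_trans h _.
have e4 : (4%:R : RR) =
    Rdefinitions.IZR (BinNums.Zpos (BinNums.xO (BinNums.xO BinNums.xH))).
  by rewrite -INRE RIneq.INR_IZR_INZ.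
rewrite -e4 RinvE; lra.
Qed.

Lemma C1c_complex (a b : RR -> RR) a' b' : C1_pair a a' -> C1_pair b b' ->
  C1c (fun t => Complex (a t) (b t)).
Proof. by move=> h1 h2; exists (fun t => Complex (a' t) (b' t)). Qed.

(** The principal square root, with real part [s = sqrt ((|w| + Re w) / 2)] and imaginary part
    [Im w / (2 s)]. It is C^1 because both radicands are positive when [Re w > 0]. *)
Lemma exists_csqrt (w : RR -> CC) : C1c w -> w twopi = w 0 ->
  (forall t, 0 < Re (w t)) ->
  exists s : RR -> CC, [/\ C1c s, s twopi = s 0, forall t, s t ^+ 2 = w t
    & forall t, 0 < Re (s t)].
Proof.
move=> /C1cP[c1 c2] per pos.
pose n t := nrm2 (Re (w t)) (Im (w t)).
have n0 t : 0 < n t by have := pos t; rewrite /n nrm2E; nra.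
have n0' t : Rdefinitions.Rlt 0 (n t) by apply/RltP.
have C1n : C1_pair n _ := C1_pair_add (C1_pair_mul c1 c1) (C1_pair_mul c2 c2).
have C1N := C1_pair_sqrt C1n n0'.
have C1m := C1_pair_mul (C1_pair_const (1/2)) (C1_pair_add C1N c1).
set m := (X in C1_pair X _) in C1m.
have m0 t : 0 < m t.
  rewrite /m !RmultE RplusE RsqrtE ?(ltW (n0 t)) //.
  have := pos t; have := sqrtr_ge0 (n t); lra.
have m0' t : Rdefinitions.Rlt 0 (m t) by apply/RltP.
have C1s := C1_pair_sqrt C1m m0'.
set s := (X in C1_pair X _) in C1s.
have s0 t : 0 < s t.
  by rewrite /s RsqrtE ?(ltW (m0 t)) // sqrtr_gt0.
have s0' t : s t <> 0 by apply/eqP; rewrite gt_eqF.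
have C1r := C1_pair_mul (C1_pair_mul (C1_pair_const (1/2)) c2) (C1_pair_inv C1s s0').
set r := (X in C1_pair X _) in C1r.
exists (fun t => Complex (s t) (r t)); split.
- exact: C1c_complex C1s C1r.
- by rewrite /r /s /m /n per.
- move=> t.
  have es : s t * s t = m t by rewrite /s; apply: R_sqrt.sqrt_sqrt; apply/RleP/ltW.
  have er : r t = 1/2 * Im (w t) / s t by [].
  have em : m t = 1/2 * (R_sqrt.sqrt (n t) + Re (w t)) by [].
  have en : R_sqrt.sqrt (n t) ^+ 2 = Re (w t) ^+ 2 + Im (w t) ^+ 2.
    rewrite expr2 -nrm2E -/(n t); apply: R_sqrt.sqrt_sqrt; exact/RleP/ltW.
  case: (w t) em en er => a b /= em en er.
  apply/eqP; rewrite eq_complex expr2 /=; apply/andP; split; apply/eqP; last first.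
    by rewrite er; field; apply: lt0r_neq0.
  have -> : r t * r t = (1/4) * b ^+ 2 / m t.
    by rewrite er -es; field; apply: lt0r_neq0.
  rewrite es; have -> : b ^+ 2 = 4 * m t ^+ 2 - 4 * a * m t.
    by rewrite em; move: en; set N := R_sqrt.sqrt _ => en; nra.
  by field; apply: lt0r_neq0.
- by move=> t /=.
Qed.

(** Quadratic formula. The discriminant [w = (1 + e)^2 - 4 d] is within [2/20 + 1/400 + 4/20 < 1/2]
    of 1, so it has a closed C^1 square root [s] with positive real part. Then [|s - 1| <= |w - 1|],
    as [|s + 1| >= 1], and [(1 + e + s) / 2] is the root near 1. *)
Lemma exists_root_near1 (e d : RR -> CC) : C1c e -> C1c d ->
  e twopi = e 0 -> d twopi = d 0 ->
  (forall t, `|e t| <= (1/20)%:C) -> (forall t, `|d t| <= (1/20)%:C) ->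
  exists V : RR -> CC, [/\ C1c V, V twopi = V 0,
    forall t, V t ^+ 2 - (1 + e t) * V t + d t = 0
    & forall t, `|V t - 1| <= (1/2)%:C].
Proof.
move=> ce cd pe pd he hd.
pose w t := (1 + e t) * (1 + e t) + (- 4) * d t.
have c1e := (C1c_add (C1c_const 1).1 ce).1.
have cw : C1c w := (C1c_add (C1c_mul c1e c1e).1 (C1c_mul (C1c_const (-4)).1 cd).1).1.
have pw : w twopi = w 0 by rewrite /w pe pd.
have ew t : w t - 1 = e t * 2 + e t * e t + (- 4) * d t by rewrite /w; ring.
have bw t : `|w t - 1| <= (1/2)%:C.
  rewrite ew; apply: le_trans (ler_normD _ _) _; rewrite normrM normrN (ger0_norm (ler0n _ _)).
  have h1 : `|e t * 2 + e t * e t| <= (1/20)%:C * 2 + (1/20)%:C * (1/20)%:C.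
    apply: le_trans (ler_normD _ _) _; rewrite !normrM (ger0_norm (ler0n _ 2)).
    by apply: lerD; [apply: ler_wpM2r => // | apply: ler_pM].
  have h2 : 4%:R * `|d t| <= 4%:R * (1/20)%:C by apply: ler_wpM2l => //.
  apply: le_trans (lerD h1 h2) _.
  rewrite -[2]/(2%:R) -[4]/(4%:R) -!(rmorph_nat (real_complex RR)).
  rewrite -!rmorphM -!rmorphD lecR /=; lra.
have rw t : 0 < Re (w t).
  have := bw t; rewrite nrm2_norm ?nrm2E; last by lra.
  rewrite Re_add Im_add Re_opp Im_opp /=; nra.
have [s [cs ps ss s0]] := exists_csqrt cw pw rw.
pose V t := (1/2) * (1 + e t + s t).
have bs t : `|s t - 1| <= `|w t - 1|.
  have -> : w t - 1 = (s t - 1) * (s t + 1) by rewrite -ss; ring.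
  rewrite normrM ler_peMr //.
  have := nrm2_norm_ge (s t + 1) (@ler01 RR); rewrite rmorph1 => ->.
  rewrite nrm2E Re_add Im_add /=; have := s0 t; nra.
exists V; split.
- exact: (C1c_mul (C1c_const (1/2)).1 (C1c_add c1e cs).1).1.
- by rewrite /V pe ps.
- move=> t; have -> : V t ^+ 2 - (1 + e t) * V t + d t = (1/4) * (s t ^+ 2 - w t).
    by rewrite /V /w; field.
  by rewrite ss subrr mulr0.
- move=> t; have -> : V t - 1 = (1/2) * (e t + (s t - 1)) by rewrite /V; field.
  have -> : (1/2)%:C = (1/2) * 1 :> CC.
    by rewrite mulr1 rmorphM fmorphV rmorph_nat rmorph1.
  rewrite normrM ger0_norm; last by rewrite divr_ge0.
  apply: ler_wpM2l; first by rewrite divr_ge0.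
  apply: le_trans (ler_normD _ _) _.
  apply: le_trans (lerD (he t) (le_trans (bs t) (bw t))) _.
  by rewrite -rmorphD -(rmorph1 (real_complex RR)) lecR; lra.
Qed.

End RegulatorPairing.

(** * Embeddings of real and function fields *)

Section RealEmbedding.
Variables R S : realType.

(** The conclusions are weak inequalities: this is enough to determine [y], and it makes a supremum
    of rationals satisfy the condition directly. *)
Definition same_cut (x : R) (y : S) : Prop := forall q : rat,
  (ratr q < x -> ratr q <= y) /\ (x < ratr q -> y <= ratr q).

Lemma rat_between (T : realType) (a b : T) : a < b ->
  exists q : rat, a < ratr q < b.
Proof. by move=> /rat_in_itvoo[q]; rewrite in_itv /=; exists q. Qed.

Lemma same_cut_le x y y' : same_cut x y -> same_cut x y' -> y' <= y.
Proof.
move=> h h'; rewrite leNgt; apply/negP => /rat_between[q /andP[q1 q2]].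
have [xq|qx|xq] := ltgtP x (ratr q).
- by have := (h' q).2 xq; rewrite leNgt q2.
- by have := (h q).1 qx; rewrite leNgt q1.
(* Here [x] is the rational [q] itself, which its cut does not separate; a second rational strictly
   above [q] does. *)
have [r /andP[r1 r2]] := rat_between q2.
have xr : x < ratr r by rewrite xq ltr_rat -(ltr_rat S).
by have := (h' r).2 xr; rewrite leNgt r2.
Qed.

Lemma same_cut_uniq x y y' : same_cut x y -> same_cut x y' -> y = y'.
Proof. by move=> h h'; apply: le_anti; rewrite !(same_cut_le (x := x)). Qed.

Lemma same_cut_exists x : exists y, same_cut x y.
Proof.
pose E := [set (ratr q : S) | q in [set q : rat | ratr q < x]].
have ubE r : x < ratr r -> ubound E (ratr r).
  move=> xr _ [q /= qx <-]; rewrite ler_rat -(ler_rat R); exact/ltW/(lt_trans qx).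
have hE : has_sup E.
  split.
    have [q /andP[_ q2]] := rat_between (ltac:(lra) : x - 1 < x).
    by exists (ratr q), q.
  have [q /andP[q1 _]] := rat_between (ltac:(lra) : x < x + 1).
  by exists (ratr q); exact: ubE.
exists (sup E) => q; split=> h.
  by apply: ub_le_sup; [exact: hE.2 | exists q].
by apply: ge_sup; [exact: hE.1 | exact: ubE].
Qed.

Lemma same_cutN x y : same_cut x y -> same_cut (- x) (- y).
Proof.
move=> h q; have [h1 h2] := h (- q); rewrite !raddfN /= in h1 h2.
by split=> ?; [rewrite lerNr; apply: h2 | rewrite lerNl; apply: h1]; lra.
Qed.

Lemma same_cutD x y x' y' : same_cut x y -> same_cut x' y' -> same_cut (x + x') (y + y').
Proof.
move=> h h' q; split=> hq.
  have [r /andP[r1 r2]] := rat_between (ltac:(lra) : ratr q - x' < x).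
  have := (h r).1 r2; have := (h' (q - r)).1; rewrite !raddfB /= => k1 k2.
  by have := k1 ltac:(lra); lra.
have [r /andP[r1 r2]] := rat_between (ltac:(lra) : x < ratr q - x').
have := (h r).2 r1; have := (h' (q - r)).2; rewrite !raddfB /= => k1 k2.
by have := k1 ltac:(lra); lra.
Qed.

Lemma same_cut_ge0 x y : same_cut x y -> 0 < x -> 0 <= y.
Proof. by move=> h x0; have := (h 0).1; rewrite !raddf0; apply. Qed.

(** Only squares of positive elements are compared through cuts, by separating [x] from the square
    root of a rational. General products then follow by changing signs and by polarization. *)
Lemma same_cut_sqr x y : same_cut x y -> 0 < x -> same_cut (x * x) (y * y).
Proof.
move=> h x0 q; have y0 := same_cut_ge0 h x0; split=> hq.
  have [q0|q0] := lerP q 0.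
    by apply: le_trans (mulr_ge0 y0 y0); rewrite lerq0.
  have sq : Num.sqrt (ratr q) < x.
    by rewrite -[x]ger0_norm ?ltW // -sqrtr_sqr ltr_sqrt ?exprn_gt0 // expr2.
  have [r /andP[r1 r2]] := rat_between sq.
  have r0 : 0 < r by rewrite -(ltr0q R); apply: le_lt_trans r1; exact: sqrtr_ge0.
  have qr : q <= r * r.
    rewrite -(ler_rat R) rmorphM /= -expr2 -[leLHS]sqr_sqrtr ?ler0q ?(ltW q0) //.
    by rewrite ler_pXn2r ?nnegrE ?sqrtr_ge0 ?ler0q ?(ltW r0) // ltW.
  have := (h r).1 r2; move: qr; rewrite -(ler_rat S) rmorphM /= => qr ry.
  apply: le_trans qr _; apply: ler_pM => //; rewrite ler0q ltW //.
have q0 : 0 < q by rewrite -(ltr0q R); apply: lt_trans hq; exact: mulr_gt0.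
have sq : x < Num.sqrt (ratr q).
  by rewrite -[x]ger0_norm ?ltW // -sqrtr_sqr ltr_sqrt ?ltr0q // expr2.
have [r /andP[r1 r2]] := rat_between sq.
have r0 : 0 < r by rewrite -(ltr0q R); exact: lt_trans r1.
have rq : r * r <= q.
  rewrite -(ler_rat R) rmorphM /= -expr2 -[leRHS]sqr_sqrtr ?ler0q ?(ltW q0) //.
  by rewrite ler_pXn2r ?nnegrE ?sqrtr_ge0 ?ler0q ?(ltW r0) // ltW.
have := (h r).2 r1; move: rq; rewrite -(ler_rat S) rmorphM /= => rq yr.
by apply: le_trans rq; apply: ler_pM.
Qed.

Lemma same_cut_rat q : same_cut (ratr q) (ratr q).
Proof. by move=> r; rewrite !ltr_rat !ler_rat; split=> /ltW. Qed.

(** An element goes to the real number with the same rational cut. Nonnegative elements are squares,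
    so the ring morphism preserves them. *)
Lemma realType_embedding : exists f : {rmorphism R -> S}, forall x, 0 <= x -> 0 <= f x.
Proof.
have [f hf] := choice same_cut_exists.
have fD x y : f (x + y) = f x + f y.
  exact: same_cut_uniq (hf _) (same_cutD (hf x) (hf y)).
have fN x : f (- x) = - f x by exact: same_cut_uniq (hf _) (same_cutN (hf x)).
have f1 : f 1 = 1.
  by apply: same_cut_uniq (hf _) _; have := same_cut_rat 1; rewrite !rmorph1.
have f0 : f 0 = 0.
  by apply: same_cut_uniq (hf _) _; have := same_cut_rat 0; rewrite !rmorph0.
have fpos x : 0 < x -> f (x * x) = f x * f x.
  by move=> x0; exact: same_cut_uniq (hf _) (same_cut_sqr (hf x) x0).
have fsq x : f (x * x) = f x * f x.
  have [x0|x0|->] := ltgtP x 0; last by rewrite mulr0 f0 mulr0.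
    by rewrite -mulrNN fpos ?fN ?mulrNN // oppr_gt0.
  exact: fpos.
have fM x y : f (x * y) = f x * f y.
  have e : f ((x + y) * (x + y)) = f (x + y) * f (x + y) by exact: fsq.
  have e2 : (x + y) * (x + y) = x * x + x * y + x * y + y * y by ring.
  rewrite e2 !fD !fsq in e.
  have : (f (x * y)) *+ 2 = (f x * f y) *+ 2 by rewrite !mulr2n; lra.
  by rewrite !mulr2n; lra.
have fB : zmod_morphism f by move=> x y; rewrite fD fN.
pose fa := GRing.isZmodMorphism.Build _ _ f fB.
pose fm := GRing.isMonoidMorphism.Build _ _ f (f1, fM).
pose F : {rmorphism R -> S} := HB.pack f fa fm.
exists F => x x0 /=; rewrite -[x]sqr_sqrtr // expr2.
by have : f (Num.sqrt x * Num.sqrt x) = _ := fsq _; move=> ->; rewrite -expr2 sqr_ge0.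
Qed.
End RealEmbedding.

Section ComplexEmbedding.
Variables R S : realType.

(** The bound on moduli transports the assumption that [|k|] is large to the complex numbers over
    the Stdlib reals. *)
Lemma complex_embedding : exists f : {rmorphism R[i] -> S[i]},
  forall (z : R[i]) (n : nat), (n%:R)%:C < `|z| -> (n%:R)%:C < `|f z|.
Proof.
have [h hge] := realType_embedding R S.
pose f (z : R[i]) : S[i] := let: a +i* b := z in h a +i* h b.
have fB : zmod_morphism f.
  by case=> a b [c d]; apply/eqP; rewrite eq_complex /= !raddfB !eqxx.
have f1 : f 1 = 1 by rewrite /f /= rmorph1 rmorph0.
have fM (z w : R[i]) : f (z * w) = f z * f w.
  case: z w => a b [c d]; apply/eqP.
  by rewrite eq_complex /= rmorphB rmorphD !rmorphM /= !eqxx.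
pose fa := GRing.isZmodMorphism.Build _ _ f fB.
pose fm := GRing.isMonoidMorphism.Build _ _ f (f1, fM).
exists (HB.pack f fa fm : {rmorphism R[i] -> S[i]}) => -[a b] n.
rewrite !normc_def /= !ltcR => hn.
have hs : 0 < a ^+ 2 + b ^+ 2 by rewrite -sqrtr_gt0; apply: le_lt_trans hn; exact: ler0n.
have -> : h a ^+ 2 + h b ^+ 2 = h (a ^+ 2 + b ^+ 2) by rewrite rmorphD !rmorphXn.
have hmono (u v : R) : u < v -> h u < h v.
  move=> uv; rewrite lt_neqAle (inj_eq (fmorph_inj h)) (lt_eqF uv) /=.
  by rewrite -subr_ge0 -rmorphB; apply: hge; rewrite subr_ge0 ltW.
have n2 : n%:R ^+ 2 < a ^+ 2 + b ^+ 2.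
  by rewrite -[ltRHS]sqr_sqrtr ?(ltW hs) // ltr_pXn2r ?nnegrE // ?ler0n // sqrtr_ge0.
rewrite -[n%:R]ger0_norm ?ler0n // -sqrtr_sqr ltr_sqrt.
  by have := hmono _ _ n2; rewrite rmorphXn rmorph_nat.
by rewrite -(rmorph0 h); exact: hmono.
Qed.
End ComplexEmbedding.

(** * Embeddings of the function field given by points of the curve *)

Section Eval2.
Variables (F K : fieldType) (iota : {rmorphism F -> K}) (a b : K).

Definition ev2 (P : {poly {poly F}}) : K := eval2 iota P a b.

Lemma ev2_is_zmod_morphism : zmod_morphism ev2.
Proof. by move=> P Q; rewrite /ev2 /eval2 rmorphB !hornerE. Qed.

Lemma ev2_is_monoid_morphism : monoid_morphism ev2.
Proof.
split=> [|P Q]; first by rewrite /ev2 /eval2 rmorph1 !hornerE.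
by rewrite /ev2 /eval2 rmorphM !hornerE.
Qed.

HB.instance Definition _ := GRing.isZmodMorphism.Build _ _ ev2 ev2_is_zmod_morphism.
HB.instance Definition _ := GRing.isMonoidMorphism.Build _ _ ev2 ev2_is_monoid_morphism.

Lemma ev2X : ev2 'X = b.
Proof. by rewrite /ev2 /eval2 map_polyX hornerX hornerC. Qed.

Lemma ev2C p : ev2 p%:P = (map_poly iota p).[a].
Proof. by rewrite /ev2 /eval2 map_polyC /= hornerC. Qed.

Lemma ev2XC : ev2 'X%:P = a.
Proof. by rewrite ev2C map_polyX hornerX. Qed.

Lemma ev2CC c : ev2 c%:P%:P = iota c.
Proof. by rewrite ev2C map_polyC hornerC. Qed.

Lemma ev2E P : ev2 P = eval2 iota P a b. Proof. by []. Qed.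

End Eval2.

Section FunctionFieldEmbedding.
Variables (F K L : fieldType) (iota : {rmorphism F -> K}) (psi : {rmorphism F -> L}).
Variables (Q : {poly {poly F}}) (x y : K) (X Y : L).
Hypothesis hK : function_field_of iota Q x y.

(** Evaluation at [(X, Y)] and at [(x, y)] have the same kernel on F[x,y], so the former factors
    through fractions [e A / e B], of which [f] chooses one for each element of [K]. *)
Lemma function_field_embedding :
  (forall P, eval2 psi P X Y = 0 <-> eval2 iota P x y = 0) ->
  exists s : {rmorphism K -> L}, [/\ s x = X, s y = Y & forall c, s (iota c) = psi c].
Proof.
move=> hker; pose e : {rmorphism {poly {poly F}} -> K} := ev2 iota x y.
pose E : {rmorphism {poly {poly F}} -> L} := ev2 psi X Y.
have ker P : E P = 0 <-> e P = 0 by exact: hker.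
have [f hf] : exists f : K -> {poly {poly F}} * {poly {poly F}},
    forall z, e (f z).2 != 0 /\ z = e (f z).1 / e (f z).2.
  have /choice[f hf] : forall z,
      exists f : {poly {poly F}} * {poly {poly F}}, e f.2 != 0 /\ z = e f.1 / e f.2.
    by move=> z; have [A [B h]] := hK.2 z; exists (A, B).
  by exists f.
have nz P : e P != 0 -> E P != 0 by apply: contra_neq; rewrite ker.
pose s z := E (f z).1 / E (f z).2.
have sE A B : e B != 0 -> s (e A / e B) = E A / E B.
  move=> B0; rewrite /s; have [d0 ed] := hf (e A / e B).
  have : e (A * (f (e A / e B)).2 - (f (e A / e B)).1 * B) = 0.
    by rewrite rmorphB !rmorphM; move: ed => /(congr1 (fun z => z * e B * e (f (e A / e B)).2));
      rewrite !divfK // => ->; field.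
  move/ker; rewrite rmorphB !rmorphM => /eqP; rewrite subr_eq0 => /eqP ek.
  by apply/eqP; rewrite eqr_div ?nz // ek.
have sB : zmod_morphism s.
  move=> z w; have [z0 ez] := hf z; have [w0 ew] := hf w.
  rewrite ez ew.
  have -> : e (f z).1 / e (f z).2 - e (f w).1 / e (f w).2 =
     e ((f z).1 * (f w).2 - (f w).1 * (f z).2) / e ((f z).2 * (f w).2).
    by rewrite rmorphB !rmorphM; field; rewrite w0 z0.
  rewrite !sE // ?rmorphM ?mulf_neq0 // rmorphB !rmorphM; field.
  by rewrite !nz // z0.
have sM : monoid_morphism s.
  split.
    have -> : 1 = e 1 / e 1 by rewrite rmorph1 divr1.
    by rewrite sE ?rmorph1 ?oner_neq0 // divr1.
  move=> z w; have [z0 ez] := hf z; have [w0 ew] := hf w.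
  rewrite ez ew.
  have -> : e (f z).1 / e (f z).2 * (e (f w).1 / e (f w).2) =
     e ((f z).1 * (f w).1) / e ((f z).2 * (f w).2).
    by rewrite !rmorphM; field; rewrite w0 z0.
  rewrite !sE // ?rmorphM ?mulf_neq0 //; field.
  by rewrite !nz.
pose fa := GRing.isZmodMorphism.Build _ _ s sB.
pose fm := GRing.isMonoidMorphism.Build _ _ s sM.
have s1 A : s (e A) = E A.
  have -> : e A = e A / e 1 by rewrite rmorph1 divr1.
  by rewrite sE ?rmorph1 ?oner_neq0 // divr1.
exists (HB.pack s fa fm : {rmorphism K -> L}); split=> [||c] /=.
- by rewrite -(ev2XC iota x y) -[ev2 _ _ _ _]/(e _) s1 /E /= ev2XC.
- by rewrite -(ev2X iota x y) -[ev2 _ _ _ _]/(e _) s1 /E /= ev2X.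
- by rewrite -(ev2CC iota x y) -[ev2 _ _ _ _]/(e _) s1 /E /= ev2CC.
Qed.

Definition transcendental (z : L) := forall p : {poly F}, p != 0 -> (map_poly psi p).[z] != 0.

Hypothesis hQ : size Q = 3%N.

(** A nonzero multiple of [Q] has degree at least 2 in [y]. *)
Lemma function_field_dvd P : eval2 iota P x y = 0 -> (size P < 3)%N -> P = 0.
Proof.
move=> /hK.1[A ->]; have [->|A0] := eqVneq A 0; first by rewrite mul0r.
rewrite size_mul // ?hQ; last by rewrite -size_poly_eq0 hQ.
by move: A0; rewrite -size_poly_gt0; case: (size A) => // n _; rewrite addn3.
Qed.

(** Pseudo-division by [Q] leaves a remainder [r = b y + a] over F[x] that vanishes at [(X, Y)]. Up
    to a factor its norm is a polynomial [N] in [x], which vanishes at the transcendental [X] and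
    hence is 0. So [r s] is a multiple of [Q], where [s] is the conjugate of [r], and in the field
    [K] one of the two factors vanishes; if it is [s], its degree forces [s = 0] and then
    [r = 0]. *)
Lemma function_field_kernel : transcendental X -> eval2 psi Q X Y = 0 ->
  forall P, eval2 psi P X Y = 0 <-> eval2 iota P x y = 0.
Proof.
move=> tX QXY P; split; last first.
  move=> /hK.1[A ->]; rewrite -(ev2E psi X Y) rmorphM /=.
  by rewrite (_ : ev2 psi X Y Q = 0) ?mulr0.
pose e : {rmorphism {poly {poly F}} -> K} := ev2 iota x y.
pose E : {rmorphism {poly {poly F}} -> L} := ev2 psi X Y.
have eQ : e Q = 0 by apply/hK.1; exists 1; rewrite mul1r.
have EQ : E Q = 0 by [].
have Ecst p : E p%:P = 0 -> p = 0.
  by move=> h; apply/eqP; apply/negP => /negP/tX; rewrite -(ev2C psi X Y) -/E h eqxx.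
have ecst p : e p%:P = 0 -> p = 0.
  move=> h; have := function_field_dvd h; rewrite size_polyC => /(_ _)/eqP.
  by rewrite polyC_eq0 => /(_ _)/eqP; apply; case: eqP.
change (E P = 0 -> e P = 0) => hP.
have Q0 : Q != 0 by rewrite -size_poly_eq0 hQ.
have dv := Pdiv.Idomain.divp_eq P Q.
set u := lead_coef Q ^+ scalp P Q in dv; set r : {poly {poly F}} := P %% Q in dv.
have u0 : u != 0 by rewrite expf_neq0 // lead_coef_eq0.
have rs : (size r < 3)%N by rewrite -hQ ltn_modp.
have dv' : u%:P * P = P %/ Q * Q + r by rewrite -dv mul_polyC.
have Er : E r = 0.
  by have := congr1 E dv'; rewrite rmorphD !rmorphM hP EQ !mulr0 add0r.
suff er : e r = 0.
  have := congr1 e dv'; rewrite rmorphD !rmorphM eQ er mulr0 addr0 => /eqP.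
  by rewrite mulf_eq0 => /orP[/eqP/ecst e0|/eqP //]; rewrite e0 eqxx in u0.
have rE : r = (r`_1)%:P * 'X + (r`_0)%:P.
  apply/polyP => -[|[|n]]; rewrite coefD coefMX !coefC /= ?add0r ?addr0 ?coefC //.
  by rewrite nth_default //; case: n; case: (size r) rs => [|[|[]]].
have QE : Q = (Q`_2)%:P * 'X^2 + (Q`_1)%:P * 'X + (Q`_0)%:P.
  apply/polyP => -[|[|[|n]]]; rewrite !coefD coefMX coefMXn !coefC /= ?add0r ?addr0 ?coefC //.
  by rewrite nth_default // hQ.
have A0 : Q`_2 != 0.
  by have : lead_coef Q != 0; [rewrite lead_coef_eq0 | rewrite lead_coefE hQ].
move: rE QE A0; set b := r`_1; set a := r`_0; set A := Q`_2; set B := Q`_1; set C := Q`_0.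
move=> rE QE A0.
(* [s] is [A] times the conjugate of [r] under [y -> - B / A - y], and [N] is [A] times the norm of
   [r]. *)
pose s := (- (b * A))%:P * 'X + (A * a - b * B)%:P.
pose N := A * a ^+ 2 - a * b * B + b ^+ 2 * C.
have rs_eq : r * s = N%:P - (b ^+ 2)%:P * Q.
  by rewrite rE QE /s /N !(rmorphD, rmorphB, rmorphM, rmorphN, rmorphXn) /=; ring.
have N0 : N = 0.
  apply: Ecst; have := congr1 E rs_eq.
  by rewrite rmorphB !rmorphM Er EQ mul0r mulr0 subr0 => <-.
have := congr1 e rs_eq; rewrite rmorphB !rmorphM eQ N0 mulr0 subr0 rmorph0 => /eqP.
rewrite mulf_eq0 => /orP[/eqP //|/eqP es].
have ss : (size s < 3)%N.
  rewrite ltnS; apply: leq_trans (size_polyD _ _) _; rewrite geq_max size_polyC.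
  apply/andP; split; last by case: eqP.
  apply: leq_trans (size_mul_leq _ _) _.
  by rewrite size_polyX size_polyC addn2; case: eqP.
have s0 := function_field_dvd es ss.
have b0 : b = 0.
  have := congr1 (fun p : {poly _} => p`_1) s0.
  rewrite coefD coefMX !coefC /= addr0 => /eqP.
  by rewrite oppr_eq0 mulf_eq0 (negbTE A0) orbF => /eqP.
have a0 : a = 0.
  have := congr1 (fun p : {poly _} => p`_0) s0.
  rewrite coefD coefMX !coefC /= add0r b0 mul0r subr0 => /eqP.
  by rewrite mulf_eq0 (negbTE A0) => /eqP.
by rewrite rE a0 b0 mul0r addr0 rmorph0.
Qed.
End FunctionFieldEmbedding.

(** * Circles consisting of transcendental points *)

Lemma countable_surj (T U : Type) (f : T -> U) :
  countable [set: T] -> (forall u, exists t, f t = u) -> countable [set: U].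
Proof.
move=> cT fs; have -> : [set: U] = f @` [set: T].
  by apply/seteqP; split=> // u _; have [t <-] := fs u; exists t.
exact: sub_countable (card_image_le _ _) cT.
Qed.

Lemma countable_Qadj (C : numFieldType) (k : C) : countable [set: Qadj k].
Proof.
pose f (pq : {poly rat} * {poly rat}) : Qadj k :=
  insubd 0 ((map_poly ratr pq.1).[k] / (map_poly ratr pq.2).[k]).
apply: (@countable_surj _ _ f) => [|[z hz]]; first exact: countableP.
have /asboolP[p [q [q0 ez]]] := hz; exists (p, q).
by apply: val_inj; rewrite /f /= val_insubd /= -ez hz.
Qed.

Lemma countable_poly (F : fieldType) : countable [set: F] -> countable [set: {poly F}].
Proof.
move=> /countable_injP[f finj].
have {}finj : injective f by move=> a b; apply: finj; rewrite in_setT.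
apply/countable_injP; exists (fun p : {poly F} => choice.pickle (map f p)).
move=> p q _ _ /(pcan_inj (@choice.pickleK _)) e.
by apply: poly_inj; exact: inj_map e.
Qed.

Lemma countable_algebraic (R : rcfType) (F : fieldType) (psi : {rmorphism F -> R[i]}) :
  countable [set: F] -> countable [set z | ~ transcendental psi z].
Proof.
move=> /countable_poly cF.
have roots (p : {poly F}) : exists r : seq R[i], p != 0 ->
    forall z, (map_poly psi p).[z] == 0 -> z \in r.
  have [r er] := closed_field_poly_normal (map_poly psi p).
  exists r => p0 z; rewrite er hornerZ mulf_eq0 lead_coef_eq0 map_poly_eq0 (negbTE p0) /=.
  by rewrite -/(root _ _) root_prod_XsubC.
have [r hr] := choice roots.
apply: (@sub_countable _ _ _ (\bigcup_(p in [set: {poly F}]) [set` r p])).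
  apply: subset_card_le => z /= /existsNP[p /not_implyP[p0 /negP]].
  by rewrite negbK => pz; exists p => //; exact: hr.
by apply: bigcup_countable => // p _; exact/finite_set_countable/finite_seq.
Qed.

Lemma itv_not_countable (R : realType) (a b : R) (A : set R) : a < b ->
  countable A -> exists2 r, a < r < b & ~ A r.
Proof.
move=> ab cA; apply: contrapT => h.
have sub : [set` `]a, b[] `<=` A.
  move=> r; rewrite /= in_itv /= => hr; apply: contrapT => nA; apply: h.
  by exists r.
have : countable [set` `]a, b[] by apply: sub_countable cA; exact: subset_card_le.
move=> /countable_lebesgue_measure0; rewrite lebesgue_measure_itv /= lte_fin ab.
by move=> /eqP; rewrite -EFinB eqe subr_eq0 gt_eqF.
Qed.

(** A radius is excluded only if it equals [|z|] or [|z + 1|] for some [z] algebraic over the image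
    of [F], and there are countably many of these. One radius then serves both centres, 0 and -1. *)
Lemma generic_radius (R : realType) (F : fieldType) (psi : {rmorphism F -> R[i]})
    (a b : R) : a < b -> countable [set: F] ->
  exists2 r, a < r < b & forall z, `|z| = r%:C ->
    transcendental psi z /\ transcendental psi (z - 1).
Proof.
move=> ab /(countable_algebraic psi) cA.
pose A := (fun z : R[i] => complex.Re `|z|) @` [set z | ~ transcendental psi z] `|`
  (fun z : R[i] => complex.Re `|z + 1|) @` [set z | ~ transcendental psi z].
have : countable A.
  have c2 (f : R[i] -> R) : countable (f @` [set z | ~ transcendental psi z]).
    exact: sub_countable (card_image_le _ _) cA.
  have -> : A = \bigcup_(c in [set: bool]) (if c then
    (fun z : R[i] => complex.Re `|z|) @` [set z | ~ transcendental psi z] else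
  (fun z : R[i] => complex.Re `|z + 1|) @` [set z | ~ transcendental psi z]).
    apply/seteqP; split=> r; first by move=> [h|h]; [exists true | exists false].
    by move=> [[] _ h]; [left | right].
  by apply: bigcup_countable => // -[].
move=> /(itv_not_countable ab)[r hr nA]; exists r => // z hz.
split; apply: contrapT => nt; apply: nA.
  by left; exists z => //; rewrite hz.
by right; exists (z - 1) => //; rewrite subrK hz.
Qed.

(** * The fourteen families *)

(** Horner evaluation with the constant term first. Keeping integral coefficient lists lets the same
    data be evaluated in F[x,y], in the function field and in the complex numbers. *)
Fixpoint intpoly (A : pzRingType) (s : seq int) (x : A) : A :=
  if s is c :: s' then c%:~R + x * intpoly s' x else 0.

(* The [i]-th family is [Phi^m (y^2 + x^l) + (k x^r (x + 1)^s + b) y] with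
   [Phi = x^2 + x + 1]. *)
Definition fam_m (i : 'I_14) : nat := nth 0%N [:: 0; 1; 1; 2; 0; 0; 1; 1; 2; 2; 2; 2; 3; 3]%N i.
Definition fam_l (i : 'I_14) : nat := nth 0%N [:: 3; 1; 1; 0; 4; 4; 2; 2; 0; 0; 0; 0; 0; 0]%N i.
Definition fam_r (i : 'I_14) : nat := nth 0%N [:: 1; 1; 1; 1; 1; 1; 1; 1; 1; 1; 1; 1; 2; 2]%N i.
Definition fam_s (i : 'I_14) : nat := nth 0%N [:: 1; 1; 1; 2; 2; 2; 2; 2; 2; 2; 2; 2; 2; 2]%N i.
Definition fam_b (i : 'I_14) : seq int := nth [::]
  [:: [:: 1; 0; 0; 1]; [:: 1; 0; 0; 1]; [::]; [:: 0; 0; 2];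
      [:: 1; 0; -4; 0; 1]; [:: 1; 0; 0; 0; 1]; [:: 1; 0; -4; 0; 1]; [:: 1; 0; 0; 0; 1];
      [:: 1; 0; -4; 0; 1]; [:: 1; 0; 0; 0; 1]; [:: 2; 0; -6; 0; 2]; [:: 2; 0; -2; 0; 2];
      [:: 2; 6; 0; -6; 0; 6; 2]; [:: 2; 6; 0; -10; 0; 6; 2]] i.

Definition fam_B (A : comNzRingType) (i : 'I_14) (k x : A) : A :=
  k * x ^+ fam_r i * (x + 1) ^+ fam_s i + intpoly (fam_b i) x.

Definition fam_Q (A : comNzRingType) (i : 'I_14) (k x y : A) : A :=
  (x ^+ 2 + x + 1) ^+ fam_m i * (y ^+ 2 + x ^+ fam_l i) + fam_B i k x * y.

Ltac fam_case i := case: i => [[|[|[|[|[|[|[|[|[|[|[|[|[|[|?]]]]]]]]]]]]]] ?] //.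

Lemma fam_QE (A : comNzRingType) (i : 'I_14) (k x y : A) :
  nth 0 (Q_families k x y) i = fam_Q i k x y.
Proof.
rewrite /fam_Q /fam_B /fam_m /fam_l /fam_r /fam_s /fam_b.
by fam_case i => /=; rewrite ?expr0 ?expr1; ring.
Qed.

Lemma intpoly_rmorph (A B : pzRingType) (f : {rmorphism A -> B}) s x :
  f (intpoly s x) = intpoly s (f x).
Proof. by elim: s => [|c s IH] /=; rewrite ?rmorph0 // rmorphD rmorphM IH rmorph_int. Qed.

Lemma fam_B_rmorph (A B : comNzRingType) (f : {rmorphism A -> B}) i k x :
  f (fam_B i k x) = fam_B i (f k) (f x).
Proof. by rewrite /fam_B rmorphD !rmorphM !rmorphXn rmorphD rmorph1 intpoly_rmorph. Qed.

Lemma fam_Q_rmorph (A B : comNzRingType) (f : {rmorphism A -> B}) i k x y :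
  f (fam_Q i k x y) = fam_Q i (f k) (f x) (f y).
Proof.
by rewrite /fam_Q rmorphD !rmorphM fam_B_rmorph !(rmorphXn, rmorphD, rmorph1).
Qed.

Lemma fam_Q_inv (K : fieldType) i (k x y : K) : x != 0 ->
  fam_Q i k x^-1 (y / x ^+ fam_l i) =
  fam_Q i k x y / x ^+ (2 * fam_m i + 2 * fam_l i).
Proof.
move=> x0; rewrite /fam_Q /fam_B /fam_m /fam_l /fam_r /fam_s /fam_b.
by fam_case i; rewrite /= ?expr0 ?expr1; field; rewrite ?x0 ?expf_neq0 ?oner_neq0.
Qed.

(** * Tame symbols *)

Section Valuation.
Variables (K : fieldType) (v : K -> int).
Hypothesis hv : discrete_valuation v.

Lemma valuationM a b : a != 0 -> b != 0 -> v (a * b) = v a + v b.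
Proof. by case: hv => h _ _; exact: h. Qed.

Lemma valuationD a b : a != 0 -> b != 0 -> a + b != 0 ->
  Num.min (v a) (v b) <= v (a + b).
Proof. by case: hv => _ h _; exact: h. Qed.

Lemma valuation1 : v 1 = 0.
Proof.
have := valuationM (oner_neq0 K) (oner_neq0 K).
by rewrite mulr1; move: (v 1) => w; lia.
Qed.

Lemma valuationN1 : v (-1) = 0.
Proof.
have N0 : (-1 : K) != 0 by rewrite oppr_eq0 oner_neq0.
by have := valuationM N0 N0; rewrite mulrNN mulr1 valuation1; move: (v _) => w; lia.
Qed.

Lemma valuationN a : a != 0 -> v (- a) = v a.
Proof.
move=> a0; have N0 : (-1 : K) != 0 by rewrite oppr_eq0 oner_neq0.
by rewrite -mulN1r valuationM // valuationN1 add0r.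
Qed.

Lemma valuationV a : a != 0 -> v a^-1 = - v a.
Proof.
move=> a0; have := valuationM a0 (invr_neq0 a0); rewrite mulfV // valuation1; lia.
Qed.

Lemma valuationX a n : a != 0 -> v (a ^+ n) = v a * n%:Z.
Proof.
move=> a0; elim: n => [|n IH]; first by rewrite expr0 valuation1 mulr0.
by rewrite exprS valuationM ?expf_neq0 // IH -addn1 PoszD mulrDr mulr1 addrC.
Qed.

(** The valuation ring, and below its maximal ideal and its units. The value of [v] at 0 is
    arbitrary, hence the separate treatment of 0. *)
Definition val_int (a : K) := (a == 0) || (0 <= v a).
Definition val_max (a : K) := (a == 0) || (0 < v a).
Definition val_unit (a : K) := (a != 0) && (v a == 0).

Lemma vmax_int a : val_max a -> val_int a.
Proof. by rewrite /val_int /val_max => /orP[-> //|/ltW ->]; rewrite orbT. Qed.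

Lemma vunit_int a : val_unit a -> val_int a.
Proof. by rewrite /val_int => /andP[_ /eqP ->]; rewrite orbT. Qed.

Lemma vint_unit a : val_int a -> ~~ val_max a -> val_unit a.
Proof.
rewrite /val_int /val_max /val_unit; case: (eqVneq a 0) => //= _; lia.
Qed.

Lemma vmax_unit a : val_unit a -> val_max a = false.
Proof. by rewrite /val_unit /val_max => /andP[/negbTE -> /eqP ->]. Qed.

Lemma vint0 : val_int 0. Proof. by rewrite /val_int eqxx. Qed.
Lemma vmax0 : val_max 0. Proof. by rewrite /val_max eqxx. Qed.
Lemma vunit1 : val_unit 1. Proof. by rewrite /val_unit oner_neq0 valuation1. Qed.

Lemma vintD a b : val_int a -> val_int b -> val_int (a + b).
Proof.
rewrite /val_int; case: (eqVneq a 0) => [->|a0]; first by rewrite add0r.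
case: (eqVneq b 0) => [->|b0]; first by rewrite addr0 (negbTE a0).
case: (eqVneq (a + b) 0) => //= ab0; have := valuationD a0 b0 ab0.
by rewrite ge_min => /orP[] h ha hb; exact: le_trans h.
Qed.

Lemma vmaxD a b : val_max a -> val_max b -> val_max (a + b).
Proof.
rewrite /val_max; case: (eqVneq a 0) => [->|a0]; first by rewrite add0r.
case: (eqVneq b 0) => [->|b0]; first by rewrite addr0 (negbTE a0).
case: (eqVneq (a + b) 0) => //= ab0; have := valuationD a0 b0 ab0.
by rewrite ge_min => /orP[] h ha hb; exact: lt_le_trans h.
Qed.

Lemma vintN a : val_int a -> val_int (- a).
Proof. by rewrite /val_int oppr_eq0; case: (eqVneq a 0) => //= a0; rewrite valuationN. Qed.
Lemma vmaxN a : val_max a -> val_max (- a).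
Proof. by rewrite /val_max oppr_eq0; case: (eqVneq a 0) => //= a0; rewrite valuationN. Qed.

Lemma vintM a b : val_int a -> val_int b -> val_int (a * b).
Proof.
rewrite /val_int mulf_eq0; case: (eqVneq a 0) => //= a0; case: (eqVneq b 0) => //= b0.
by rewrite valuationM //; lia.
Qed.
Lemma vmaxM a b : val_int a -> val_max b -> val_max (a * b).
Proof.
rewrite /val_max /val_int mulf_eq0; case: (eqVneq a 0) => //= a0; case: (eqVneq b 0) => //= b0.
by rewrite valuationM //; lia.
Qed.
Lemma vunitM a b : val_unit a -> val_unit b -> val_unit (a * b).
Proof.
rewrite /val_unit => /andP[a0 /eqP va] /andP[b0 /eqP vb].
by rewrite mulf_neq0 //= valuationM // va vb.
Qed.
Lemma vunitX a n : val_unit a -> val_unit (a ^+ n).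
Proof. by move=> h; elim: n => [|n IH]; rewrite ?vunit1 // exprS vunitM. Qed.
Lemma vunitV a : val_unit a -> val_unit a^-1.
Proof. by rewrite /val_unit => /andP[a0 /eqP va]; rewrite invr_neq0 //= valuationV // va. Qed.

Lemma vmax_prime a b : val_int a -> val_int b -> val_max (a * b) -> val_max a || val_max b.
Proof.
rewrite /val_max /val_int mulf_eq0; case: (eqVneq a 0) => //= a0; case: (eqVneq b 0) => //= b0.
  by rewrite ?orbT.
by rewrite valuationM //; lia.
Qed.

Lemma vint1 : val_int 1. Proof. exact: vunit_int vunit1. Qed.
Lemma vintX a n : val_int a -> val_int (a ^+ n).
Proof. by move=> h; elim: n => [|n IH]; rewrite ?vint1 // exprS vintM. Qed.
Lemma vint_nat n : val_int n%:R.
Proof. by elim: n => [|n IH]; rewrite ?vint0 // -addn1 natrD vintD // vint1. Qed.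
Lemma vint_int (n : int) : val_int n%:~R.
Proof. by case: n => n; rewrite ?NegzE ?rmorphN /= ?vintN // vint_nat. Qed.

Lemma vint_intpoly s x : val_int x -> val_int (intpoly s x).
Proof.
by move=> hx; elim: s => [|c s IH] /=; rewrite ?vint0 // vintD ?vint_int // vintM.
Qed.

Definition val_cong a b := val_max (a - b).

Lemma vcong_refl a : val_cong a a. Proof. by rewrite /val_cong subrr vmax0. Qed.
Lemma vcong_sym a b : val_cong a b -> val_cong b a.
Proof. by move=> /vmaxN; rewrite /val_cong opprB. Qed.
Lemma vcong_trans a b c : val_cong a b -> val_cong b c -> val_cong a c.
Proof. by move=> h /(vmaxD h); rewrite /val_cong addrA subrK. Qed.
Lemma vcongD a b c d : val_cong a b -> val_cong c d -> val_cong (a + c) (b + d).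
Proof. by move=> h /(vmaxD h); rewrite /val_cong opprD addrACA. Qed.
Lemma vcongN a b : val_cong a b -> val_cong (- a) (- b).
Proof. by move=> /vmaxN; rewrite /val_cong opprD. Qed.
Lemma vcong_int a b : val_int b -> val_cong a b -> val_int a.
Proof. by move=> hb /vmax_int h; rewrite -[a](subrK b) vintD. Qed.
Lemma vcongM a b c d : val_int b -> val_int d -> val_cong a b -> val_cong c d ->
  val_cong (a * c) (b * d).
Proof.
move=> hb hd h h'; rewrite /val_cong.
have -> : a * c - b * d = c * (a - b) + b * (c - d) by ring.
by rewrite vmaxD // vmaxM //; exact: vcong_int h'.
Qed.
Lemma vcongX a b n : val_int b -> val_cong a b -> val_cong (a ^+ n) (b ^+ n).
Proof.
move=> hb h; elim: n => [|n IH]; first exact: vcong_refl.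
by rewrite !exprS vcongM // vintX.
Qed.
Lemma vcong_intpoly s a b : val_int b -> val_cong a b -> val_cong (intpoly s a) (intpoly s b).
Proof.
move=> hb h; elim: s => [|c s IH] /=; first exact: vcong_refl.
by rewrite vcongD ?vcong_refl // vcongM // vint_intpoly.
Qed.
Lemma vcong0 a : val_cong a 0 = val_max a. Proof. by rewrite /val_cong subr0. Qed.
Lemma vcong_unit a b : val_unit b -> val_cong a b -> val_unit a.
Proof.
move=> hb h; apply: vint_unit; first exact: vcong_int (vunit_int hb) h.
apply/negP => ha; have := vmax_unit hb; suff -> : val_max b by [].
have -> : b = a - (a - b) by ring.
by rewrite vmaxD // vmaxN.
Qed.

Lemma vint_root a b c y : val_unit a -> val_int b -> val_int c ->
  a * y ^+ 2 + b * y + c = 0 -> val_int y.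
Proof.
move=> ha hb hc e; rewrite /val_int; case: (eqVneq y 0) => //= y0.
rewrite leNgt; apply/negP => vy.
have my : val_max y^-1 by rewrite /val_max valuationV //; lia.
have : val_max a.
  have -> : a = - ((b + c * y^-1) * y^-1).
    apply: (mulIf (expf_neq0 2 y0)); move: e => /eqP.
    by rewrite -addrA addr_eq0 => /eqP ->; field.
  by rewrite vmaxN // vmaxM // vintD // vintM // vmax_int.
by rewrite vmax_unit.
Qed.

Lemma vunit_root a b c y : val_unit a -> val_int b -> val_unit c ->
  a * y ^+ 2 + b * y + c = 0 -> val_unit y.
Proof.
move=> ha hb hc e; apply: vint_unit.
  exact: vint_root ha hb (vunit_int hc) e.
apply/negP => hy; have := vmax_unit hc; suff -> : val_max c by [].
have yi := vmax_int hy; have := vunit_int ha => ai.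
have -> : c = - ((a * y + b) * y).
  by apply/eqP; rewrite -addr_eq0 addrC; apply/eqP; rewrite -[RHS]e; ring.
by rewrite vmaxN // vmaxM // vintD // vintM.
Qed.

End Valuation.

Lemma tomulM (K : fieldType) (a b : K) : a != 0 -> b != 0 ->
  tomul (a * b) = tomul a + tomul b.
Proof. by move=> a0 b0; apply: val_inj; rewrite val_mulgrpD !tomulE ?mulf_neq0. Qed.

Lemma tomul1 (K : fieldType) : tomul (1 : K) = 0.
Proof. by apply: val_inj; rewrite tomulE ?oner_neq0. Qed.

Lemma tomulX (K : fieldType) (a : K) n : a != 0 -> tomul (a ^+ n) = tomul a *+ n.
Proof.
move=> a0; elim: n => [|n IH]; first by rewrite expr0 tomul1.
by rewrite exprS tomulM ?expf_neq0 // IH mulrS.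
Qed.

Lemma tomulV (K : fieldType) (a : K) : a != 0 -> tomul a^-1 = - tomul a.
Proof.
move=> a0; apply/eqP; rewrite -addr_eq0 -tomulM ?invr_neq0 // mulVf //.
by rewrite tomul1.
Qed.

Lemma tomulXz (K : fieldType) (a : K) (n : int) : a != 0 -> tomul (a ^ n) = tomul a *~ n.
Proof.
move=> a0; case: n => n; first by rewrite -pmulrn -exprnP tomulX.
by rewrite NegzE mulrNz -pmulrn -exprnN tomulV ?expf_neq0 // tomulX.
Qed.

Lemma signz_sqr (K : fieldType) (n : int) : ((-1) ^ n) ^+ 2 = 1 :> K.
Proof. by rewrite expr2 -expfzMl mulrNN mulr1 exp1rz. Qed.

Section TameSymbol.
Variables (K : fieldType) (v : K -> int).
Hypothesis hv : discrete_valuation v.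
Local Notation vint := (val_int v).
Local Notation vmax := (val_max v).
Local Notation vunit := (val_unit v).
Local Notation vcong := (val_cong v).

HB.instance Definition _ := GRing.isZmodMorphism.Build _ _ (tame v)
  (tame_is_zmod_morphism hv).

Lemma tame_mulrn u n : tame v (u *+ n) = tame v u *+ n.
Proof. exact: raddfMn. Qed.

Definition tsym (a b : K) : quotient (one_units v) := tame v (symbol a b).

Lemma tsymE a b : a != 0 -> b != 0 ->
  tsym a b = qpi (one_units v) (tomul ((-1) ^ (v a * v b) * (a ^ v b / b ^ v a))).
Proof. by move=> a0 b0; rewrite /tsym tameE // /tame_symb !tomulE. Qed.

Lemma tsymMl a a' b : a != 0 -> a' != 0 -> tsym (a * a') b = tsym a b + tsym a' b.
Proof. by move=> a0 a0'; rewrite /tsym !tameE // tomulM // tame_symbDl. Qed.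

Lemma tsymMr a b b' : b != 0 -> b' != 0 -> tsym a (b * b') = tsym a b + tsym a b'.
Proof. by move=> b0 b0'; rewrite /tsym !tameE // tomulM // tame_symbDr. Qed.

Lemma tsymXr a b n : b != 0 -> tsym a (b ^+ n) = tsym a b *+ n.
Proof.
move=> b0; elim: n => [|n IH].
  apply: (addrI (tsym a 1)); rewrite expr0 -tsymMr ?oner_neq0 // mulr1.
  by rewrite mulr0n addr0.
by rewrite exprS tsymMr ?expf_neq0 // IH mulrS.
Qed.

Lemma tsym_div a b c : b != 0 -> c != 0 -> tsym a (b / c) = tsym a b - tsym a c.
Proof.
move=> b0 c0; apply/eqP; rewrite -subr_eq opprK -tsymMr ?divfK //.
by rewrite mulf_neq0 ?invr_neq0.
Qed.

Lemma one_unit_qpi (a : K) : a != 0 -> vcong a 1 -> qpi (one_units v) (tomul a) = 0.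
Proof.
move=> a0; rewrite /val_cong /val_max subr_eq0 => h; apply/qpi0P => H [_].
apply; rewrite /one_units /= tomulE //.
by case/orP: h => [/eqP ->|h]; [left | right].
Qed.

Lemma tsym_unit a b : a != 0 -> b != 0 -> v a = 0 ->
  tsym a b = qpi (one_units v) (tomul a) *~ v b.
Proof.
move=> a0 b0 va; rewrite tsymE // va mul0r !expr0z mul1r divr1 -raddfMz /=.
by rewrite tomulXz.
Qed.

Lemma tsym_anti a b : a != 0 -> b != 0 -> tsym a b = - tsym b a.
Proof.
move=> a0 b0; apply/eqP; rewrite -addr_eq0 !tsymE // -raddfD -tomulM; last 2 first.
- by rewrite !mulf_neq0 ?invr_neq0 ?expfz_neq0 // oppr_eq0 oner_neq0.
- by rewrite !mulf_neq0 ?invr_neq0 ?expfz_neq0 // oppr_eq0 oner_neq0.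
apply/eqP; have -> : (-1) ^ (v a * v b) * (a ^ v b / b ^ v a) *
  ((-1) ^ (v b * v a) * (b ^ v a / a ^ v b)) = ((-1) ^ (v a * v b)) ^+ 2.
  rewrite [v b * v a]mulrC; field.
  by rewrite !expfz_neq0.
by rewrite signz_sqr tomul1 raddf0.
Qed.

(** The exponent 12 is the least common multiple of 4, for the roots of [y^2 + 1], and 6, for
    [x + 1], congruent to [- x^2], when [x] is a cube root of unity. The other roots of unity that
    occur have order dividing 2 or 3. *)
Definition tor (u : quotient (one_units v)) := u *+ 12 = 0.

Lemma torD u w : tor u -> tor w -> tor (u + w).
Proof. by rewrite /tor mulrnDl => -> ->; rewrite addr0. Qed.
Lemma torN u : tor u -> tor (- u).
Proof. by rewrite /tor mulNrn => ->; rewrite oppr0. Qed.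
Lemma torMn u n : tor u -> tor (u *+ n).
Proof. by rewrite /tor mulrnAC => ->; rewrite mul0rn. Qed.
Lemma tor0 : tor 0. Proof. by rewrite /tor mul0rn. Qed.

Lemma tor_unit a b : a != 0 -> b != 0 -> v a = 0 -> vcong (a ^+ 12) 1 -> tor (tsym a b).
Proof.
move=> a0 b0 va h; rewrite /tor tsym_unit // pmulrn mulrzAC -pmulrn -raddfMn /=.
by rewrite -tomulX // one_unit_qpi ?expf_neq0 // mul0rz.
Qed.

Lemma tsym_cong1 a b : a != 0 -> b != 0 -> vcong a 1 -> tsym a b = 0.
Proof.
move=> a0 b0 h; have /andP[_ /eqP va] := vcong_unit hv (vunit1 hv) h.
by rewrite tsym_unit // one_unit_qpi // mul0rz.
Qed.

Lemma tsym_units a b : a != 0 -> b != 0 -> v a = 0 -> v b = 0 -> tsym a b = 0.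
Proof. by move=> a0 b0 va vb; rewrite tsym_unit // vb mulr0z. Qed.

Lemma tor_self a : a != 0 -> tor (tsym a a).
Proof.
move=> a0; rewrite /tor tsymE // mulfV ?expfz_neq0 // mulr1 -raddfMn /= -tomulX; last first.
  by rewrite expfz_neq0 // oppr_eq0 oner_neq0.
by rewrite -[12%N]/(2 * 6)%N exprM signz_sqr expr1n tomul1 raddf0.
Qed.

Lemma tsym_selfN a : a != 0 -> tsym a (- a) = 0.
Proof.
move=> a0; rewrite tsymE ?oppr_eq0 // valuationN //.
have -> : (-1) ^ (v a * v a) * (a ^ v a / (- a) ^ v a) = 1; last by rewrite tomul1 raddf0.
have -> : (-1) ^ (v a * v a) = (-1) ^ (v a) :> K.
  rewrite -exprz_exp; have /eqP := signz_sqr K (v a); rewrite sqrf_eq1 => /orP[] /eqP E.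
    by rewrite E exp1rz.
  by rewrite {1}E.
rewrite -[- a]mulN1r expfzMl invfM [a ^ _ * _]mulrC -mulrA mulVf ?expfz_neq0 // mulr1.
by rewrite mulfV // expfz_neq0 // oppr_eq0 oner_neq0.
Qed.

End TameSymbol.

(** * Tame symbols of the families at an arbitrary discrete valuation *)

Lemma fam_r_gt0 i : (0 < fam_r i)%N. Proof. by fam_case i. Qed.
Lemma fam_s_gt0 i : (0 < fam_s i)%N. Proof. by fam_case i. Qed.

(** The shapes of the equation near [x = 0]. With [l = 0] it reduces to [y^2 + c y + 1] with [c]
    among 0, 1, 2; with [l > 0] and [b (0) = 1] it reduces to [y (y + 1)]; in the third family
    [b = 0], and [y^2] is close to [- x]. *)
Lemma fam_at0 (A : comNzRingType) i :
  [\/ fam_l i = 0%N /\ [\/ intpoly (fam_b i) (0 : A) = 0, intpoly (fam_b i) (0 : A) = 1 |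
        intpoly (fam_b i) (0 : A) = 2],
      (0 < fam_l i)%N /\ intpoly (fam_b i) (0 : A) = 1 |
      [/\ fam_m i = 1%N, fam_l i = 1%N, fam_b i = [::], fam_r i = 1%N & fam_s i = 1%N]].
Proof.
fam_case i; rewrite /fam_l /fam_b /=;
  try (by apply: Or33);
  try (by apply: Or32; split=> //; rewrite mul0r addr0).
all: apply: Or31; split=> //; rewrite mul0r addr0;
  solve [by apply: Or31 | by apply: Or32 | by apply: Or33].
Qed.

(** At [x = -1] the equation reduces to [y^2 - 1], [(y + 1)^2] or [(y - 1)^2], so that [y] becomes 1
    or -1. *)
Lemma fam_atN1 (A : comNzRingType) i :
  (-1) ^+ fam_l i = -1 :> A /\ intpoly (fam_b i) (-1 : A) = 0 \/
  (-1) ^+ fam_l i = 1 :> A /\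
    (intpoly (fam_b i) (-1 : A) = 2 \/ intpoly (fam_b i) (-1 : A) = -2).
Proof.
fam_case i; rewrite /fam_l /fam_b /=;
  solve [left; split; ring | right; split; [ring | left; ring]
    | right; split; [ring | right; ring]].
Qed.

Section TameFamilies.
Variables (K : fieldType) (v : K -> int).
Hypothesis hv : discrete_valuation v.
Local Notation vint := (val_int v).
Local Notation vmax := (val_max v).
Local Notation vunit := (val_unit v).
Local Notation vcong := (val_cong v).
Local Notation tsym := (tsym v).
Variables (i : 'I_14) (k : K).
Hypothesis hk : vint k.

Let Phi (x : K) := x ^+ 2 + x + 1.

Lemma fam_Q_quadratic x y : fam_Q i k x y = 0 ->
  Phi x ^+ fam_m i * y ^+ 2 + fam_B i k x * y + Phi x ^+ fam_m i * x ^+ fam_l i = 0.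
Proof. by rewrite /fam_Q /Phi => <-; ring. Qed.

Lemma vint_Phi x : vint x -> vint (Phi x).
Proof. by move=> hx; rewrite /Phi (vintD hv) ?(vint1 hv) // (vintD hv) // (vintX hv). Qed.

Lemma vint_fam_B x : vint x -> vint (fam_B i k x).
Proof.
move=> hx; rewrite /fam_B (vintD hv) ?(vint_intpoly hv) //.
by rewrite !(vintM hv) ?(vintX hv) // (vintD hv) // (vint1 hv).
Qed.

Lemma vmax_expn a n : (0 < n)%N -> vmax a -> vmax (a ^+ n).
Proof.
case: n => // n _ ha; rewrite exprSr (vmaxM hv) // (vintX hv) //; exact: vmax_int.
Qed.

Lemma fam_B_at0 x : vmax x -> vcong (fam_B i k x) (intpoly (fam_b i) 0).
Proof.
move=> mx; have ix := vmax_int mx.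
rewrite /fam_B -[intpoly _ 0]add0r (vcongD hv) //; last first.
  by rewrite (vcong_intpoly hv) ?vint0 // vcong0.
rewrite vcong0 mulrAC (vmaxM hv) ?vmax_expn ?fam_r_gt0 //.
by rewrite (vintM hv) // (vintX hv) // (vintD hv) // (vint1 hv).
Qed.

Lemma fam_B_atN1 x : vmax (x + 1) -> vcong (fam_B i k x) (intpoly (fam_b i) (-1)).
Proof.
move=> mx; have cx : vcong x (-1) by rewrite /val_cong opprK.
have iN1 : vint (-1) by rewrite (vintN hv) // (vint1 hv).
have ix : vint x := vcong_int hv iN1 cx.
rewrite /fam_B -[intpoly _ (-1)]add0r (vcongD hv) //; last first.
  by rewrite (vcong_intpoly hv).
rewrite vcong0 (vmaxM hv) ?vmax_expn ?fam_s_gt0 //.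
by rewrite (vintM hv) // (vintX hv).
Qed.

Lemma Phi_at0 x : vmax x -> vcong (Phi x) 1.
Proof.
move=> mx; have ix := vmax_int mx; rewrite /val_cong /Phi addrK.
by rewrite (vmaxD hv) // vmax_expn.
Qed.

Lemma Phi_atN1 x : vint x -> vmax (x + 1) -> vcong (Phi x) 1.
Proof.
move=> ix mx; rewrite /val_cong /Phi.
have -> : x ^+ 2 + x + 1 - 1 = x * (x + 1) by ring.
by rewrite (vmaxM hv).
Qed.

Lemma Phi_exp_cong1 x n : vcong (Phi x) 1 -> vcong (Phi x ^+ n) 1.
Proof. by move=> h; rewrite -[1](expr1n _ n) (vcongX hv) ?(vint1 hv). Qed.

Lemma root_of_unity y c : vint y -> [\/ c = 0, c = 1 | c = 2] ->
  vmax (y ^+ 2 + c * y + 1) -> vcong (y ^+ 12) 1.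
Proof.
move=> iy hc h; rewrite /val_cong.
have I := (vintX hv, vintM hv, vintD hv, vintN hv, vint1 hv, iy, vint_nat hv).
case: hc h => ->.
- have -> : y ^+ 12 - 1 =
    (y ^+ 10 - y ^+ 8 + y ^+ 6 - y ^+ 4 + y ^+ 2 - 1) * (y ^+ 2 + 0 * y + 1) by ring.
  by move=> h; rewrite (vmaxM hv) // !I.
- have -> : y ^+ 12 - 1 =
    (y ^+ 9 + y ^+ 6 + y ^+ 3 + 1) * (y - 1) * (y ^+ 2 + 1 * y + 1) by ring.
  by move=> h; rewrite (vmaxM hv) // !I.
have -> : y ^+ 2 + 2 * y + 1 = (y + 1) * (y + 1) by ring.
have i1 : vint (y + 1) by rewrite !I.
move=> /(vmax_prime hv i1 i1); rewrite orbb => h.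
have -> : y ^+ 12 - 1 =
  (y ^+ 10 + y ^+ 8 + y ^+ 6 + y ^+ 4 + y ^+ 2 + 1) * (y - 1) * (y + 1) by ring.
by rewrite (vmaxM hv) // !I.
Qed.

Lemma root_of_unityN y c : vint y -> [\/ c = 0, c = 1 | c = 2] ->
  vmax (y ^+ 2 - c * y + 1) -> vcong (y ^+ 12) 1.
Proof.
move=> iy hc h; have iNy : vint (- y) by rewrite (vintN hv).
have <- : (- y) ^+ 12 = y ^+ 12 by ring.
apply: (root_of_unity iNy hc).
by have -> : (- y) ^+ 2 + c * - y + 1 = y ^+ 2 - c * y + 1 by ring.
Qed.

(** The factor 2 serves the family with [y^2 = - x u], [u] congruent to 1: there
    [{x, y}^2 = {x, - x} {x, u}], and both factors have trivial tame symbol. In the other cases [y],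
    or [x^l / y], is a root of unity modulo the maximal ideal. *)
Lemma tame_at_pos x y : x != 0 -> y != 0 -> vmax x -> fam_Q i k x y = 0 ->
  tor (tsym x y *+ 2).
Proof.
move=> x0 y0 mx /fam_Q_quadratic hQ.
have ix := vmax_int mx.
have cA := Phi_exp_cong1 (fam_m i) (Phi_at0 mx).
have uA := vcong_unit hv (vunit1 hv) cA.
have iB := vint_fam_B ix.
have cB := fam_B_at0 mx.
have iA := vunit_int uA.
have iy : vint y by apply: (vint_root hv uA iB _ hQ); rewrite (vintM hv) // (vintX hv).
have unity_case : vcong (y ^+ 12) 1 -> vunit y -> tor (tsym x y *+ 2).
  move=> h /andP[_ /eqP vy]; apply: torMn; rewrite tsym_anti //; apply: torN.
  exact: tor_unit.
case: (fam_at0 K i) => [[el hb]|[el hb]|[em el eb er es]].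
- rewrite el expr0 mulr1 in hQ.
  have uy : vunit y := vunit_root hv uA iB uA hQ.
  apply: unity_case => //; apply: (root_of_unity iy hb).
  rewrite -vcong0 -[X in vcong _ X]hQ; apply: (vcong_sym hv).
  set b0 := intpoly _ _ in cB *.
  have -> : y ^+ 2 + b0 * y + 1 = 1 * y ^+ 2 + b0 * y + 1 by rewrite mul1r.
  have ib0 : vint b0 by rewrite /b0 (vint_intpoly hv) // vint0.
  by rewrite !(vcongD hv) // (vcongM hv) ?(vcong_refl) ?(vint1 hv) ?(vintX hv).
- have mC : vmax (Phi x ^+ fam_m i * x ^+ fam_l i) by rewrite (vmaxM hv) // vmax_expn.
  have : vmax (y * (Phi x ^+ fam_m i * y + fam_B i k x)).
    have -> : y * (Phi x ^+ fam_m i * y + fam_B i k x) = - (Phi x ^+ fam_m i * x ^+ fam_l i).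
      by apply/eqP; rewrite -addr_eq0; apply/eqP; rewrite -[RHS]hQ; ring.
    by rewrite (vmaxN hv).
  rewrite hb in cB.
  have iw : vint (Phi x ^+ fam_m i * y + fam_B i k x) by rewrite (vintD hv) // (vintM hv).
  move=> /(vmax_prime hv iy iw) /orP[my|h].
  (* [y'] is the second root of the quadratic equation, congruent to -1; the symbol [{x, y}] equals
     [{x, x}^l] divided by [{x, y'}]. *)
  + pose y' := x ^+ fam_l i / y.
    have y'0 : y' != 0 by rewrite mulf_neq0 ?invr_neq0 ?expf_neq0.
    have ey : y = x ^+ fam_l i / y' by rewrite /y'; field; rewrite y0 expf_neq0.
    have hy' : Phi x ^+ fam_m i * y' = - (fam_B i k x + Phi x ^+ fam_m i * y).
      apply: (mulIf y0); rewrite /y' -mulrA divfK //.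
      by apply/eqP; rewrite -subr_eq0; apply/eqP; rewrite -[RHS]hQ; ring.
    have cAy' : vcong (Phi x ^+ fam_m i * y') (-1).
      rewrite hy' (vcongN hv) // -[X in vcong _ X]addr0 (vcongD hv) // vcong0.
      by rewrite (vmaxM hv).
    have uN1 : vunit (-1) by rewrite /val_unit oppr_eq0 oner_neq0 valuationN1.
    have cy' : vcong y' (-1).
      have -> : y' = (Phi x ^+ fam_m i)^-1 * (Phi x ^+ fam_m i * y').
        by rewrite mulKf //; case/andP: uA.
      rewrite -[X in vcong _ X]mul1r (vcongM hv) ?(vint1 hv) ?(vunit_int uN1) //.
      have uAV := vunitV hv uA.
      have -> : (Phi x ^+ fam_m i)^-1 = (Phi x ^+ fam_m i)^-1 * 1 by rewrite mulr1.
      rewrite /val_cong.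
      have -> : (Phi x ^+ fam_m i)^-1 * 1 - 1 =
          - (Phi x ^+ fam_m i)^-1 * (Phi x ^+ fam_m i - 1).
        by field; case/andP: uA.
      by rewrite (vmaxM hv) // (vintN hv) // vunit_int.
    have /andP[_ /eqP vy'] := vcong_unit hv uN1 cy'.
    apply: torMn; rewrite ey tsym_div ?expf_neq0 // tsymXr //.
    apply: torD; first by apply: torMn; exact: tor_self.
    apply: torN; rewrite tsym_anti //; apply: torN; apply: tor_unit => //.
    have <- : (-1) ^+ 12 = 1 :> K by ring.
    by rewrite (vcongX hv) // (vunit_int uN1).
  + have h2 : vmax (y + 1).
      have -> : y + 1 = (Phi x ^+ fam_m i * y + fam_B i k x) -
          (y * (Phi x ^+ fam_m i - 1) + (fam_B i k x - 1)) by ring.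
      by rewrite (vmaxD hv) // (vmaxN hv) // (vmaxD hv) // (vmaxM hv).
    have uN1 : vunit (-1) by rewrite /val_unit oppr_eq0 oner_neq0 valuationN1.
    have cy : vcong y (-1) by rewrite /val_cong opprK.
    apply: unity_case; last exact: (vcong_unit hv uN1 cy).
    have <- : (-1) ^+ 12 = 1 :> K by ring.
    by rewrite (vcongX hv) // (vunit_int uN1).
- move: hQ; rewrite /fam_B em el eb er es !expr1 /= addr0 => hQ.
  rewrite em expr1 in uA cA iA.
  have P0 : Phi x != 0 by case/andP: uA.
  have my : vmax y.
    have : vmax (y * y).
      have -> : y * y = - (((Phi x)^-1 * (k * (x + 1) * y) + 1) * x).
        apply: (mulfI P0); apply/eqP; rewrite -subr_eq0; apply/eqP; rewrite -[RHS]hQ.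
        by field.
      rewrite (vmaxN hv) // (vmaxM hv) // (vintD hv) ?(vint1 hv) // (vintM hv) //.
        exact/vunit_int/(vunitV hv).
      by rewrite !(vintM hv) // (vintD hv) // (vint1 hv).
    by move=> /(vmax_prime hv iy iy); rewrite orbb.
  pose u := 1 + (Phi x)^-1 * (k * (x + 1)) * y.
  have cu : vcong u 1.
    rewrite /val_cong /u addrAC subrr add0r (vmaxM hv) // (vintM hv) //.
      exact/vunit_int/(vunitV hv).
    by rewrite (vintM hv) // (vintD hv) // (vint1 hv).
  have u0 : u != 0 by have /andP[] := vcong_unit hv (vunit1 hv) cu.
  have ey : y ^+ 2 = - x * u.
    rewrite /u; apply: (mulfI P0); apply/eqP; rewrite -subr_eq0; apply/eqP; rewrite -[RHS]hQ.
    by field.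
  rewrite -tsymXr // ey tsymMr ?oppr_eq0 // tsym_selfN // add0r tsym_anti //.
  by rewrite tsym_cong1 // oppr0; exact: tor0.
Qed.

(** If [Phi x] lies in the maximal ideal, [x] and [x + 1] both reduce to roots of unity and [v y]
    may be arbitrary. Otherwise [y] is a unit, and the only possible contribution is that of [x + 1]
    near 0, where [y] reduces to 1 or -1. *)
Lemma tame_at_unit x y : x != 0 -> x + 1 != 0 -> y != 0 -> v x = 0 ->
  fam_Q i k x y = 0 -> tor (tsym x y) /\ tor (tsym (x + 1) y).
Proof.
move=> x0 x10 y0 vx /fam_Q_quadratic hQ.
have ux : vunit x by rewrite /val_unit x0 vx.
have ix := vunit_int ux; have iB := vint_fam_B ix; have iP := vint_Phi ix.
have ix1 : vint (x + 1) by rewrite (vintD hv) // (vint1 hv).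
have [mP|nP] := boolP (vmax (Phi x)).
  have c3 : vcong (x ^+ 3) 1.
    rewrite /val_cong; have -> : x ^+ 3 - 1 = (x - 1) * Phi x by rewrite /Phi; ring.
    by rewrite (vmaxM hv) // (vintD hv) // (vintN hv) // (vint1 hv).
  have c12 n : vcong (x ^+ (3 * n)) 1.
    by rewrite exprM -[1](expr1n _ n) (vcongX hv) // (vint1 hv).
  split; first by apply: tor_unit => //; exact: (c12 4%N).
  have c1 : vcong (x + 1) (- x ^+ 2).
    by rewrite /val_cong opprK; have -> : x + 1 + x ^+ 2 = Phi x by rewrite /Phi; ring.
  have u2 : vunit (- x ^+ 2).
    by rewrite /val_unit oppr_eq0 expf_neq0 //= valuationN ?expf_neq0 // valuationX // vx mul0r.
  have /andP[_ /eqP v1] := vcong_unit hv u2 c1.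
  apply: tor_unit => //; apply: (vcong_trans hv) (c12 8%N).
  have -> : x ^+ (3 * 8) = (- x ^+ 2) ^+ 12 by ring.
  by rewrite (vcongX hv) // (vunit_int u2).
have uP := vint_unit iP nP.
have uA := vunitX hv (fam_m i) uP.
have uy : vunit y.
  by apply: (vunit_root hv uA iB _ hQ); rewrite (vunitM hv) // (vunitX hv).
have iy := vunit_int uy.
have /andP[_ /eqP vy] := uy.
split; first by rewrite tsym_units //; exact: tor0.
have [m1|n1] := boolP (vmax (x + 1)); last first.
  have /andP[_ /eqP v1] := vint_unit ix1 n1.
  by rewrite tsym_units //; exact: tor0.
rewrite tsym_anti //; apply: torN; apply: tor_unit => //.
have cA := Phi_exp_cong1 (fam_m i) (Phi_atN1 ix m1).
have cB := fam_B_atN1 m1.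
have cx : vcong x (-1) by rewrite /val_cong opprK.
have iN1 : vint (-1) by rewrite (vintN hv) // (vint1 hv).
set b := intpoly _ _ in cB.
have ib : vint b by rewrite /b (vint_intpoly hv).
have : vmax (y ^+ 2 + b * y + (-1) ^+ fam_l i).
  rewrite -vcong0 -[X in vcong _ X]hQ; apply: (vcong_sym hv).
  have -> : y ^+ 2 + b * y + (-1) ^+ fam_l i = 1 * y ^+ 2 + b * y + 1 * (-1) ^+ fam_l i.
    by rewrite !mul1r.
  rewrite !(vcongD hv) //.
  - by rewrite (vcongM hv) ?(vint1 hv) ?(vintX hv) // vcong_refl.
  - by rewrite (vcongM hv) // vcong_refl.
  - by rewrite (vcongM hv) ?(vint1 hv) ?(vintX hv) // (vcongX hv).
rewrite /b; case: (fam_atN1 K i) => -[-> hb] h.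
  have -> : y ^+ 12 = (y ^+ 2) ^+ 6 by ring.
  have <- : 1 ^+ 6 = 1 :> K by rewrite expr1n.
  rewrite (vcongX hv) ?(vint1 hv) //.
  by move: h; rewrite hb mul0r addr0.
case: hb h => ->; first by move=> h; apply: (root_of_unity iy _ h); apply: Or33.
by rewrite mulNr => h; apply: (root_of_unityN iy _ h); apply: Or33.
Qed.

End TameFamilies.

Lemma tame_family (K : fieldType) (v : K -> int) i (k x y : K) : discrete_valuation v ->
  val_int v k -> x != 0 -> x + 1 != 0 -> y != 0 -> fam_Q i k x y = 0 ->
  tor (tsym v x y *+ 2) /\ tor (tsym v (x + 1) y *+ 2).
Proof.
move=> hv hk x0 x10 y0 hQ.
have [vx|vx|vx] := ltgtP 0 (v x); last first.
- by have [] := tame_at_unit hv hk x0 x10 y0 (esym vx) hQ; split; apply: torMn.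
- have mx : val_max v x^-1 by rewrite /val_max valuationV // oppr_gt0 vx orbT.
  have xi0 : x^-1 != 0 by rewrite invr_neq0.
  pose y' := y / x ^+ fam_l i.
  have y'0 : y' != 0 by rewrite mulf_neq0 ?invr_neq0 ?expf_neq0.
  have hQ' : fam_Q i k x^-1 y' = 0 by rewrite fam_Q_inv // hQ mul0r.
  have t1 := tame_at_pos hv hk xi0 y'0 mx hQ'.
  have ey : y = y' / x^-1 ^+ fam_l i.
    by rewrite /y' exprVn invrK divfK // expf_neq0.
  have txx (z : K) : z != 0 -> tsym v x z = - tsym v x^-1 z.
    move=> z0; apply/eqP; rewrite -addr_eq0 -tsymMl // mulfV //.
    by rewrite tsym_cong1 ?oner_neq0 // vcong_refl.
  have t2 : tor (tsym v x y *+ 2).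
    rewrite txx // mulNrn; apply: torN; rewrite ey tsym_div ?expf_neq0 // mulrnBl.
    by apply: torD => //; apply: torN; rewrite tsymXr //; do 2!apply: torMn; exact: tor_self.
  split=> //.
  (* At a pole of [x] the second symbol reduces to the first, as [1 + 1 / x] is congruent to 1. *)
  have -> : x + 1 = x * (1 + x^-1) by field.
  have x1' : 1 + x^-1 != 0.
    by have -> : 1 + x^-1 = (x + 1) / x; [field | rewrite mulf_neq0].
  rewrite tsymMl // mulrnDl; apply: torD => //.
  rewrite tsym_cong1 ?mul0rn //; first exact: tor0.
  by rewrite /val_cong addrAC subrr add0r.
- have mx : val_max v x by rewrite /val_max vx orbT.
  split; first exact: tame_at_pos hQ.
  rewrite tsym_cong1 ?mul0rn //; first exact: tor0.
  by rewrite /val_cong addrK.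
Qed.

(** * Rational coefficients *)

Section TensorQ.
Variables (A B : zmodType).

Lemma tensDl (a a' : A) (b : B) : tens (a + a') b = tens a b + tens a' b.
Proof.
apply/eqP; rewrite -subr_eq0 opprD addrA -!raddfB; apply/eqP/qpi0P => H [_].
by apply; left; exists a, a', b.
Qed.

Lemma tensDr (a : A) (b b' : B) : tens a (b + b') = tens a b + tens a b'.
Proof.
apply/eqP; rewrite -subr_eq0 opprD addrA -!raddfB; apply/eqP/qpi0P => H [_].
by apply; right; exists a, b, b'.
Qed.

Lemma tens_mulrn (a : A) (b : B) n : tens (a *+ n) b = tens a (b *+ n).
Proof.
elim: n => [|n IH]; last by rewrite !mulrS tensDl tensDr IH.
rewrite !mulr0n; transitivity (0 : tensor A B).
  by apply: (addrI (tens 0 b)); rewrite -tensDl !addr0.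
by apply: (addrI (tens a 0)); rewrite -tensDr !addr0.
Qed.
End TensorQ.

Lemma in_tensorQ_mulrn (A : zmodType) (B : set A) (a : A) n :
  (0 < n)%N -> B (a *+ n) -> in_tensorQ B a.
Proof.
move=> n0 h H [_]; apply; exists (a *+ n), n%:R^-1; split=> //.
rewrite tens_mulrn; congr (tens _ _); rewrite -[RHS]mulr_natr mulVf //.
by rewrite pnatr_eq0 -lt0n.
Qed.

(** * Integrality of the two symbols on the curve *)

Section FunctionField.
Variables (F K : fieldType) (iota : {rmorphism F -> K}) (i : 'I_14) (k : F) (x y : K).

Lemma QpolyE : Qpoly i k = fam_Q i k%:P%:P 'X%:P 'X.
Proof. exact: fam_QE. Qed.

Lemma eval2_Qpoly : eval2 iota (Qpoly i k) x y = fam_Q i (iota k) x y.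
Proof.
rewrite QpolyE -ev2E.
pose e : {rmorphism {poly {poly F}} -> K} := ev2 iota x y.
have := fam_Q_rmorph e i k%:P%:P 'X%:P 'X; rewrite /e /= => ->.
by congr fam_Q; [exact: ev2CC | exact: ev2XC | exact: ev2X].
Qed.

Lemma size_Qpoly : size (Qpoly i k) = 3%N.
Proof.
pose P : {poly F} := 'X^2 + 'X + 1.
have P0 : P ^+ fam_m i != 0.
  apply: expf_neq0; apply/eqP => /(congr1 (fun p => p.[0])).
  by rewrite !hornerE expr0n /= !add0r => /eqP; rewrite oner_eq0.
have -> : Qpoly i k = (P ^+ fam_m i)%:P * 'X^2 +
   ((fam_B i k%:P 'X)%:P * 'X + (P ^+ fam_m i * 'X^(fam_l i))%:P).
  have eB : fam_B i k%:P%:P 'X%:P = (fam_B i k%:P 'X)%:P by rewrite (fam_B_rmorph polyC).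
  have eP : 'X%:P ^+ 2 + 'X%:P + 1 = P%:P :> {poly {poly F}}.
    by rewrite /P !rmorphD rmorphXn rmorph1.
  rewrite QpolyE /fam_Q eB eP rmorphM !rmorphXn /=; ring.
have s3 : size ((P ^+ fam_m i)%:P * 'X^2) = 3%N by rewrite size_Cmul // size_polyXn.
rewrite size_polyDl s3 // ltnS size_MXaddC; case: ifP => // _.
by rewrite ltnS size_polyC; case: eqP.
Qed.

Hypothesis hK : function_field_of iota (Qpoly i k) x y.

Lemma family_equation : fam_Q i (iota k) x y = 0.
Proof. by rewrite -eval2_Qpoly; apply/hK.1; exists 1; rewrite mul1r. Qed.

Lemma family_neq0 (P : {poly {poly F}}) : P != 0 -> (size P < 3)%N -> eval2 iota P x y != 0.
Proof.
move=> P0 sP; apply/eqP => h; move/eqP: P0; apply.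
exact: (function_field_dvd hK size_Qpoly h sP).
Qed.

Lemma family_x_neq0 : x != 0.
Proof.
rewrite -(ev2XC iota x y); apply: family_neq0; rewrite ?polyC_eq0 ?polyX_eq0 //.
by rewrite size_polyC polyX_eq0.
Qed.

Lemma family_x1_neq0 : x + 1 != 0.
Proof.
have -> : x + 1 = ev2 iota x y ('X + 1)%:P.
  by rewrite ev2C rmorphD rmorph1 /= map_polyX !hornerE.
have X0 : 'X + 1 != 0 :> {poly F} by rewrite -size_poly_eq0 size_XaddC.
by apply: family_neq0; rewrite ?polyC_eq0 // size_polyC X0.
Qed.

Lemma family_y_neq0 : y != 0.
Proof.
rewrite -(ev2X iota x y); apply: family_neq0; rewrite ?polyX_eq0 //.
by rewrite size_polyX.
Qed.

(** The multiple is [24 = 2 * 12]: the factor 2 of [tame_at_pos] and the exponent of [tor]. *)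
Lemma family_tame v : discrete_valuation v -> val_int v (iota k) ->
  tame v (symbol x y *+ 24) = 0 /\ tame v (symbol (x + 1) y *+ 24) = 0.
Proof.
move=> hv ik.
have [] := tame_family hv ik family_x_neq0 family_x1_neq0 family_y_neq0 family_equation.
by rewrite /tor /tsym !(tame_mulrn hv) -!mulrnA.
Qed.

Lemma family_K2T : K2T iota (symbol x y *+ 24) /\ K2T iota (symbol (x + 1) y *+ 24).
Proof.
have h v : closed_point iota v -> tame v (symbol x y *+ 24) = 0 /\
   tame v (symbol (x + 1) y *+ 24) = 0.
  move=> [hv hc]; apply: family_tame => //; rewrite /val_int.
  by have [->|k0] := eqVneq k 0; [rewrite rmorph0 eqxx | rewrite hc // lexx orbT].
by split=> v /h[].
Qed.

Lemma family_K2T_int n X : iota k = n%:~R ->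
  K2T_int iota X (symbol x y *+ 24) /\ K2T_int iota X (symbol (x + 1) y *+ 24).
Proof.
move=> ek; have [h1 h2] := family_K2T.
have h v : discrete_valuation v -> tame v (symbol x y *+ 24) = 0 /\
   tame v (symbol (x + 1) y *+ 24) = 0.
  by move=> hv; apply: family_tame => //; rewrite ek vint_int.
by split; split=> // p D v _ _ /h[].
Qed.
End FunctionField.

Lemma Qadj_gen_int (C : numFieldType) (n : int) : Qadj_gen (n%:~R : C) = n%:~R.
Proof. by apply: val_inj; rewrite [RHS]rmorph_int. Qed.

(** * Linear independence *)

Definition nice (g : RR -> CC) := C1c g /\ g twopi = g 0.

Lemma nice_const c : nice (fun=> c). Proof. by split=> //; exact: (C1c_const c).1. Qed.
Lemma niceD g h : nice g -> nice h -> nice (fun t => g t + h t).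
Proof. by move=> [c p] [c' p']; split; [exact: (C1c_add c c').1 | rewrite p p']. Qed.
Lemma niceM g h : nice g -> nice h -> nice (fun t => g t * h t).
Proof. by move=> [c p] [c' p']; split; [exact: (C1c_mul c c').1 | rewrite p p']. Qed.
Lemma niceN g : nice g -> nice (fun t => - g t).
Proof. by move=> [c p]; split; [exact: (C1c_opp c).1 | rewrite p]. Qed.
Lemma niceV g : nice g -> (forall t, g t != 0) -> nice (fun t => (g t)^-1).
Proof. by move=> [c p] h; split; [exact: C1c_inv | rewrite p]. Qed.
Lemma niceX g n : nice g -> nice (fun t => g t ^+ n).
Proof.
move=> h; elim: n => [|n IH].
  by have -> : (fun t => g t ^+ 0) = fun=> 1; [apply/funext | exact: nice_const].
have -> : (fun t => g t ^+ n.+1) = fun t => g t * g t ^+ n.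
  by apply/funext => t; rewrite exprS.
exact: niceM.
Qed.
Lemma nice_intpoly s g : nice g -> nice (fun t => intpoly s (g t)).
Proof.
move=> h; elim: s => [|c s IH] /=; first exact: nice_const.
by apply: niceD; [exact: nice_const | exact: niceM].
Qed.
Lemma nice_poly (p : {poly CC}) g : nice g -> nice (fun t => p.[g t]).
Proof.
move=> h; elim/poly_ind: p => [|p c IH].
  have -> : (fun t => (0 : {poly CC}).[g t]) = fun=> 0 by apply/funext => t; rewrite horner0.
  exact: nice_const.
have -> : (fun t => (p * 'X + c%:P).[g t]) = fun t => p.[g t] * g t + c.
  by apply/funext => t; rewrite !hornerE.
by apply: niceD; [exact: niceM | exact: nice_const].
Qed.
Lemma nice_eval2 (F : fieldType) (psi : {rmorphism F -> CC}) P X Y :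
  nice X -> nice Y -> nice (fun t => ev2 psi (X t) (Y t) P).
Proof.
move=> hX hY; elim/poly_ind: P => [|P p IH].
  have -> : (fun t => ev2 psi (X t) (Y t) 0) = fun=> 0 by apply/funext => t; rewrite rmorph0.
  exact: nice_const.
have -> : (fun t => ev2 psi (X t) (Y t) (P * 'X + p%:P)) =
  fun t => ev2 psi (X t) (Y t) P * Y t + (map_poly psi p).[X t].
  by apply/funext => t; rewrite rmorphD rmorphM /= ev2C ev2X.
by apply: niceD; [exact: niceM | exact: nice_poly].
Qed.

(** * The regulator attached to a loop of embeddings *)

Section Regulator.
Variables (K : fieldType) (sigma : RR -> {rmorphism K -> CC}).
Hypothesis sigma_nice : forall z, nice (fun t => sigma t z).

Definition regulator (a b : mulgrp K) : RR :=
  reg (fun t => sigma t (val a)) (fun t => sigma t (val b)).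

Lemma sigma_nonvan z : z != 0 -> nonvan (fun t => sigma t z).
Proof. by move=> z0; split=> [|t]; [exact: (sigma_nice z).1 | rewrite fmorph_eq0]. Qed.

Lemma regulatorDl a a' b : regulator (a + a') b = regulator a b + regulator a' b.
Proof.
rewrite /regulator -(reg_mull (sigma_nonvan (valP a)) (sigma_nonvan (valP a'))
  (sigma_nonvan (valP b))).
by congr reg; apply/funext => t; rewrite val_mulgrpD rmorphM.
Qed.

Lemma regulator_anti a b : regulator a b = - regulator b a.
Proof. exact: reg_anti (sigma_nonvan (valP a)) (sigma_nonvan (valP b)). Qed.

Lemma regulatorDr a b b' : regulator a (b + b') = regulator a b + regulator a b'.
Proof. by rewrite !(regulator_anti a) regulatorDl opprD. Qed.

Lemma regulator_steinberg (a b : mulgrp K) : val a + val b = 1 -> regulator a b = 0.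
Proof.
move=> e; have eb : val b = 1 - val a by rewrite -e addrAC subrr add0r.
rewrite /regulator eb -[RHS](reg_steinberg (sigma_nonvan (valP a))).
- by congr reg; apply/funext => t; rewrite rmorphB rmorph1.
- move=> t; rewrite -(rmorph1 (sigma t)) (inj_eq (fmorph_inj _)).
  by have := valP b; rewrite eb subr_eq0 eq_sym.
- exact: (sigma_nice _).2.
Qed.

HB.instance Definition _ := GRing.isZmodMorphism.Build _ _ (K2_lift regulator)
  (K2_lift_is_zmod_morphism regulatorDl regulatorDr regulator_steinberg).

Definition regulator_hom : {additive K2 K -> RR} := K2_lift regulator.

Definition rsym (a b : K) : RR := K2_lift regulator (symbol a b).

Lemma rsymE a b : a != 0 -> b != 0 ->
  rsym a b = reg (fun t => sigma t a) (fun t => sigma t b).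
Proof.
move=> a0 b0; rewrite /rsym (K2_liftE regulatorDl regulatorDr regulator_steinberg).
by rewrite /regulator !tomulE.
Qed.

Lemma rsymMl a a' b : a != 0 -> a' != 0 -> rsym (a * a') b = rsym a b + rsym a' b.
Proof.
move=> a0 a0'; rewrite /rsym !(K2_liftE regulatorDl regulatorDr regulator_steinberg).
by rewrite tomulM // regulatorDl.
Qed.

Lemma rsymMr a b b' : b != 0 -> b' != 0 -> rsym a (b * b') = rsym a b + rsym a b'.
Proof.
move=> a0 a0'; rewrite /rsym !(K2_liftE regulatorDl regulatorDr regulator_steinberg).
by rewrite tomulM // regulatorDr.
Qed.

Lemma rsym_anti a b : rsym a b = - rsym b a.
Proof.
rewrite /rsym !(K2_liftE regulatorDl regulatorDr regulator_steinberg).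
exact: regulator_anti.
Qed.

Lemma rsym_steinberg a b : a != 0 -> b != 0 -> a + b = 1 -> rsym a b = 0.
Proof.
move=> a0 b0 e; rewrite /rsym (K2_liftE regulatorDl regulatorDr regulator_steinberg).
by apply: regulator_steinberg; rewrite !tomulE.
Qed.

Lemma rsym_self a : rsym a a = 0.
Proof. by have := rsym_anti a a; move: (rsym a a) => u; lra. Qed.

Lemma rsym1 a : rsym a 1 = 0.
Proof.
have := @rsymMr a 1 1 (oner_neq0 _) (oner_neq0 _); rewrite mulr1.
by move: (rsym a 1) => u; lra.
Qed.

Lemma rsymN1 a : rsym a (-1) = 0.
Proof.
have N0 : (-1 : K) != 0 by rewrite oppr_eq0 oner_neq0.
have := @rsymMr a (-1) (-1) N0 N0; rewrite mulrNN mulr1 rsym1.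
by move: (rsym a (-1)) => u; lra.
Qed.

Lemma rsymN a b : b != 0 -> rsym a (- b) = rsym a b.
Proof.
by move=> b0; rewrite -mulN1r rsymMr ?rsymN1 ?add0r // oppr_eq0 oner_neq0.
Qed.

Lemma rsymV a b : b != 0 -> rsym a b^-1 = - rsym a b.
Proof.
move=> b0; apply/eqP; rewrite -addr_eq0 -rsymMr ?invr_neq0 // mulVf //.
by rewrite rsym1.
Qed.

Lemma rsymX a b n : b != 0 -> rsym a (b ^+ n) = rsym a b *+ n.
Proof.
move=> b0; elim: n => [|n IH]; first by rewrite expr0 rsym1.
by rewrite exprS rsymMr ?expf_neq0 // IH mulrS.
Qed.

Lemma rsym_x_x1 x : x != 0 -> x + 1 != 0 -> rsym x (x + 1) = 0.
Proof.
move=> x0 x10; rewrite rsym_anti -rsymN // rsym_anti rsym_steinberg ?oppr0 ?oppr_eq0 //.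
by rewrite addrA addNr add0r.
Qed.

(* The two Steinberg relations [1 = - x (x + 1) + Phi] and
   [1 = Phi / (x + 1) - x^2 / (x + 1)] determine both symbols. *)
Lemma rsym_Phi x : x != 0 -> x + 1 != 0 -> x ^+ 2 + x + 1 != 0 ->
  rsym x (x ^+ 2 + x + 1) = 0 /\ rsym (x + 1) (x ^+ 2 + x + 1) = 0.
Proof.
move=> x0 x10; set P := _ + 1 => P0.
have e1 : rsym x P + rsym (x + 1) P = 0.
  rewrite -rsymMl // rsym_anti -rsymN ?mulf_neq0 // rsym_steinberg ?oppr0 //.
    by rewrite oppr_eq0 mulf_neq0.
  by rewrite /P; ring.
have e2 : rsym (P / (x + 1)) (x ^+ 2 / (x + 1)) = 0.
  rewrite -rsymN ?mulf_neq0 ?invr_neq0 ?expf_neq0 // rsym_steinberg //.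
  - by rewrite mulf_neq0 ?invr_neq0.
  - by rewrite oppr_eq0 mulf_neq0 ?invr_neq0 ?expf_neq0.
  - by rewrite /P; field.
have x1V : (x + 1)^-1 != 0 by rewrite invr_neq0.
have e3 := rsym_x_x1 x0 x10.
have e4 : rsym (x + 1) x = 0 by rewrite rsym_anti e3 oppr0.
move: e2; rewrite rsymMr ?expf_neq0 // rsymV // rsymX //.
rewrite !(rsym_anti (P / _)) !rsymMr // !rsymV // rsym_self e3.
move: e1; move: (rsym x P) (rsym (x + 1) P) => u w; rewrite mulr2n.
by split; lra.
Qed.

(** The regulator kills the pairings of [x] and [x + 1] with [x], [x + 1] and [Phi], so of the
    leading term of [y] only the constant [k] contributes. *)
Lemma rsym_decomp z x k V r s m : (z = x \/ z = x + 1) -> z != 0 ->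
  x != 0 -> x + 1 != 0 -> x ^+ 2 + x + 1 != 0 -> k != 0 -> V != 0 ->
  rsym z (- (k * x ^+ r * (x + 1) ^+ s / (x ^+ 2 + x + 1) ^+ m * V)) =
  rsym z k + rsym z V.
Proof.
move=> hz z0 x0 x10 P0 k0 V0.
have [p1 p2] := rsym_Phi x0 x10 P0.
have e3 := rsym_x_x1 x0 x10.
have e4 : rsym (x + 1) x = 0 by rewrite rsym_anti e3 oppr0.
have n1 : x ^+ r != 0 by rewrite expf_neq0.
have n2 : (x + 1) ^+ s != 0 by rewrite expf_neq0.
have n3 : (x ^+ 2 + x + 1) ^+ m != 0 by rewrite expf_neq0.
have n4 : ((x ^+ 2 + x + 1) ^+ m)^-1 != 0 by rewrite invr_neq0.
rewrite rsymN; last by rewrite !mulf_neq0.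
rewrite rsymMr ?mulf_neq0 // rsymMr ?mulf_neq0 // rsymMr ?mulf_neq0 // rsymMr //.
rewrite rsymV // !rsymX //.
by case: hz => ->; rewrite ?rsym_self ?p1 ?p2 ?e3 ?e4 !mul0rn oppr0 !addr0.
Qed.

End Regulator.

(** * The branch of large modulus along the circles *)

Lemma intpoly_bound s : exists M : nat, forall x : CC, `|x| <= 2 ->
  `|intpoly s x| <= M%:R.
Proof.
elim: s => [|c s [M hM]] /=; first by exists 0%N => x _; rewrite normr0.
exists (`|c|%N + 2 * M)%N => x hx; apply: le_trans (ler_normD _ _) _.
rewrite natrD natrM lerD // ?normrM; last by rewrite ler_pM ?hM.
by rewrite -intr_norm -abszE.
Qed.

(** The conditions on [X] are those satisfied on both circles. The bound 10 is twice the constant 5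
    of the error terms, as [dominant_zero] requires. *)
Definition has_large_branch (i : 'I_14) (k : CC) : Prop :=
  [/\ k != 0, 10 < lnn k & forall X : RR -> CC, nice X ->
   (forall t, [/\ `|X t| <= 2, 1/4 <= `|X t|, 1/4 <= `|X t + 1| &
      X t ^+ 2 + X t + 1 != 0]) ->
   exists V : RR -> CC, [/\ nice V, forall t, `|V t - 1| <= (1/2)%:C
     & forall t, fam_Q i k (X t) (- (k * X t ^+ fam_r i * (X t + 1) ^+ fam_s i /
          (X t ^+ 2 + X t + 1) ^+ fam_m i * V t)) = 0]].

(** With [D = k x^r (x + 1)^s] and [y = - D / Phi^m * V], the equation becomes [V^2 - (1 + b / D) V
    + Phi^(2 m) x^l / D^2 = 0], a small perturbation of [V^2 - V = 0] when [|k|] is large. *)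
Lemma exists_large_branch i : exists N : nat,
  forall k : CC, (N%:R)%:C < `|k| -> has_large_branch i k.
Proof.
have [M hM] := intpoly_bound (fam_b i).
(* [c1] bounds [|k b / D|] and [c2] bounds [|k^2 Phi^(2 m) x^l / D^2|], using
   [|1 / x|, |1 / (x + 1)| <= 4] and [|Phi| <= 7]; the terms [20 * c1] and [20 * c2] of [N] bring
   both perturbations below 1/20. Since [c3] is at least [exp 20], [log|k|^2 > 20]. *)
pose c1 := (M * 4 ^ (fam_r i + fam_s i))%N.
pose c2 := (7 ^ (2 * fam_m i) * 2 ^ fam_l i * 4 ^ (2 * (fam_r i + fam_s i)))%N.
pose c3 := Num.bound (Rtrigo_def.exp (20%:R : RR)).
pose N := (1 + 20 * c1 + 20 * c2 + c3)%N.
have N0 : 0 < N%:R :> CC by rewrite ltr0n.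
exists N => k hk.
have hk' : N%:R < `|k| by move: hk; rewrite rmorph_nat.
have k0 : k != 0 by rewrite -normr_gt0; exact: lt_trans hk'.
have kV : `|k^-1| <= N%:R^-1.
  by rewrite normfV lef_pV2 ?posrE ?normr_gt0 //; exact: ltW.
have N1 : N%:R^-1 <= 1 :> CC by rewrite invf_le1 // ler1n.
split=> //.
  have h1 : (N%:R : RR) ^+ 2 <= nrm2 (complex.Re k) (complex.Im k).
    by rewrite -nrm2_norm_ge ?ler0n //; exact: ltW.
  have h2 : Rtrigo_def.exp (20%:R : RR) < N%:R.
    apply: lt_le_trans (archi_boundP _) _; first by apply/ltW/RltP; exact: Exp_prop.exp_pos.
    by rewrite ler_nat /N leq_addl.
  have h3 : Rtrigo_def.exp (20%:R : RR) < nrm2 (complex.Re k) (complex.Im k).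
    apply: lt_le_trans h2 _; apply: le_trans h1.
    by rewrite expr2 ler_peMl ?ler0n // ler1n.
  have : (20%:R : RR) < Rpower.ln (nrm2 (complex.Re k) (complex.Im k)).
    rewrite -[ltLHS]Rpower.ln_exp; apply/RltP; apply: Rpower.ln_increasing; last exact/RltP.
    exact: Exp_prop.exp_pos.
  rewrite /lnn /lnabs RmultE RinvE => h.
  have -> : Rdefinitions.IZR (BinNums.Zpos (BinNums.xO BinNums.xH)) = 2 :> RR.
    by rewrite -[RHS]/(2%:R) -INRE RIneq.INR_IZR_INZ.
  move: h; set u := Rpower.ln _; move=> h.
  have -> : (10 : RR) = 2^-1 * 20 by field.
  by rewrite ltr_pM2l // invr_gt0.
move=> X nX hX.
have X0 t : X t != 0.
  have [_ h _ _] := hX t; rewrite -normr_gt0; apply: lt_le_trans h.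
  by rewrite divr_gt0.
have X10 t : X t + 1 != 0.
  have [_ _ h _] := hX t; rewrite -normr_gt0; apply: lt_le_trans h.
  by rewrite divr_gt0.
have bV (z : CC) : 1/4 <= `|z| -> z != 0 -> `|z^-1| <= 4.
  move=> h z0; rewrite normfV -[leRHS]invrK lef_pV2 ?posrE ?normr_gt0 ?invr_gt0 //.
  by rewrite -div1r.
have bX t : `|(X t)^-1| <= 4 by have [_ h _ _] := hX t; exact: bV.
have bX1 t : `|(X t + 1)^-1| <= 4 by have [_ _ h _] := hX t; exact: bV.
have bP t : `|X t ^+ 2 + X t + 1| <= 7.
  have [h _ _ _] := hX t.
  have -> : (7 : CC) = 2 ^+ 2 + 2 + 1 by ring.
  apply: le_trans (ler_normD _ _) _; rewrite normr1 lerD //.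
  apply: le_trans (ler_normD _ _) _; rewrite lerD // normrX.
  by rewrite lerXn2r ?nnegrE.
have nX1 : nice (fun t => X t + 1) by apply: niceD => //; exact: nice_const.
have nXV : nice (fun t => (X t)^-1) := niceV nX X0.
have nX1V : nice (fun t => (X t + 1)^-1) := niceV nX1 X10.
have nP : nice (fun t => X t ^+ 2 + X t + 1).
  by apply: niceD; [apply: niceD => //; exact: niceX | exact: nice_const].
pose w t := k^-1 * ((X t)^-1 ^+ fam_r i * (X t + 1)^-1 ^+ fam_s i).
have nw : nice w := niceM (nice_const _) (niceM (niceX _ nXV) (niceX _ nX1V)).
have bw t : `|w t| <= N%:R^-1 * 4 ^+ (fam_r i + fam_s i).
  by rewrite /w !normrM !normrX exprD !ler_pM ?mulr_ge0 ?exprn_ge0 //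
    lerXn2r ?nnegrE.
pose e t := intpoly (fam_b i) (X t) * w t.
pose d t := (X t ^+ 2 + X t + 1) ^+ (2 * fam_m i) * X t ^+ fam_l i * w t ^+ 2.
have ne : nice e := niceM (nice_intpoly _ nX) nw.
have nd : nice d := niceM (niceM (niceX _ nP) (niceX _ nX)) (niceX _ nw).
have e20 : (1/20)%:C = 20^-1 :> CC by rewrite div1r fmorphV rmorph_nat.
have be t : `|e t| <= (1/20)%:C.
  have [h2 _ _ _] := hX t.
  rewrite e20 /e normrM; apply: le_trans (ler_pM _ _ (hM _ h2) (bw t)) _ => //.
  rewrite mulrCA mulrC ler_pdivrMr // [leRHS]mulrC ler_pdivlMr ?ltr0n //.
  by rewrite -natrX -!natrM ler_nat /N /c1; lia.
have bd t : `|d t| <= (1/20)%:C.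
  have [h2 _ _ _] := hX t.
  have b1 : `|(X t ^+ 2 + X t + 1) ^+ (2 * fam_m i) * X t ^+ fam_l i| <=
      7 ^+ (2 * fam_m i) * 2 ^+ fam_l i.
    by rewrite normrM !normrX ler_pM ?exprn_ge0 // lerXn2r ?nnegrE.
  have b2 : `|w t ^+ 2| <= N%:R^-1 * 4 ^+ (2 * (fam_r i + fam_s i)).
    rewrite normrX; apply: (@le_trans _ _ ((N%:R^-1 * 4 ^+ (fam_r i + fam_s i)) ^+ 2)).
      by rewrite lerXn2r ?nnegrE ?mulr_ge0 ?invr_ge0 ?exprn_ge0 // ltW.
    rewrite exprMn -exprM mulnC ler_wpM2r ?exprn_ge0 // expr2 ler_piMl // invr_ge0 ltW //.
  rewrite e20 /d normrM; apply: le_trans (ler_pM _ _ b1 b2) _ => //.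
  rewrite mulrCA mulrC ler_pdivrMr // [leRHS]mulrC ler_pdivlMr ?ltr0n //.
  by rewrite -!natrX -!natrM ler_nat /N /c2; lia.
have [V [cV pV rV bV1]] := exists_root_near1 ne.1 nd.1 ne.2 nd.2 be bd.
exists V; split=> // t.
have P0 : X t ^+ 2 + X t + 1 != 0 by have [] := hX t.
have wE : w t = (k * X t ^+ fam_r i * (X t + 1) ^+ fam_s i)^-1.
  by rewrite /w !exprVn !invfM mulrA.
pose D := k * X t ^+ fam_r i * (X t + 1) ^+ fam_s i.
have D0 : D != 0 by rewrite !mulf_neq0 ?expf_neq0.
have := rV t; rewrite /e /d wE -/D exprM => h.
rewrite /fam_Q /fam_B -/D.
move: h; set A := (X t ^+ 2 + X t + 1) in P0 *.
rewrite -exprM mulnC exprM; set Am := A ^+ fam_m i.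
have Am0 : Am != 0 by rewrite expf_neq0.
set b := intpoly _ _; set xl := X t ^+ fam_l i; set Vt := V t => h.
have -> : Am * ((- (D / Am * Vt)) ^+ 2 + xl) + (D + b) * - (D / Am * Vt) =
  D ^+ 2 / Am * (Vt ^+ 2 - (1 + b / D) * Vt + Am ^+ 2 * xl * D^-1 ^+ 2).
  by field; rewrite D0 Am0.
by rewrite h mulr0.
Qed.

(** On either circle one of [|x|], [|x + 1|] is at most 1/2 and the other at most 3/2, so
    [|x (x + 1)| <= 3/4] and [Phi = x (x + 1) + 1] cannot vanish. *)
Lemma circ_conditions (p rho : RR) t : (p == 0) || (p == -1) -> 1/4 < rho < 1/2 ->
  [/\ `|circ p rho t| <= 2, 1/4 <= `|circ p rho t|, 1/4 <= `|circ p rho t + 1| &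
      circ p rho t ^+ 2 + circ p rho t + 1 != 0].
Proof.
move=> hp hr.
have sh q : circ q rho t + 1 = circ (q + 1) rho t.
  by apply/eqP; rewrite eq_complex /= addr0 eqxx andbT; apply/eqP; ring.
have n0 : `|circ 0 rho t| = rho%:C.
  rewrite normc_def -nrm2E circ0_nrm2 sqrtr_sqr ger0_norm //; lra.
have r0 : 0 < rho < 1/2 by lra.
have lo : 1/4 <= `|circ 0 rho t|.
  rewrite n0 (_ : 1/4 = (1/4)%:C); first by rewrite lecR; lra.
  by rewrite rmorphM fmorphV rmorph1 rmorph_nat.
have hi : `|circ 0 rho t| <= 1/2.
  rewrite n0 (_ : 1/2 = (1/2)%:C); first by rewrite lecR; lra.
  by rewrite rmorphM fmorphV rmorph1 rmorph_nat.
have lo1 (q : RR) : q ^+ 2 = 1 -> 1/4 <= `|circ q rho t|.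
  move=> hq; rewrite (_ : 1/4 = (1/4)%:C); last by rewrite rmorphM fmorphV rmorph1 rmorph_nat.
  rewrite nrm2_norm_ge; last by lra.
  by have := circ1_nrm2 t hq r0; lra.
have up (z : CC) : `|z| <= 1/2 -> `|1 + z| <= 3/2 /\ `|z - 1| <= 3/2.
  move=> hz; have e3 : 3/2 = 1 + 1/2 :> CC by field.
  by split; rewrite e3; [|rewrite addrC]; apply: le_trans (ler_normD _ _) _;
    rewrite ?normrN normr1 lerD2l.
have Phi_neq0 (z : CC) : `|z * (z + 1)| <= 3/4 -> z ^+ 2 + z + 1 != 0.
  move=> hz; apply/eqP => e.
  have : z * (z + 1) = - 1 by apply/eqP; rewrite -addr_eq0 -[X in _ == X]e; apply/eqP; ring.
  move=> e2; move: hz; rewrite e2 normrN normr1 ler_pdivlMr ?ltr0n // mul1r.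
  by rewrite ler_nat.
have h34 : 1/2 * (3/2) = 3/4 :> CC by field.
have hi2 : 1/2 <= 2 :> CC by rewrite ler_pdivrMr ?ltr0n // -natrM ler1n.
have hi32 : 3/2 <= 2 :> CC by rewrite ler_pdivrMr ?ltr0n // -natrM ler_nat.
case/orP: hp => /eqP ->.
  split=> //; first exact: le_trans hi hi2.
    by rewrite sh add0r lo1 // expr1n.
  by apply: Phi_neq0; rewrite normrM -h34 ler_pM // addrC; exact: (up _ hi).1.
have eN : circ (-1) rho t = circ 0 rho t - 1.
  by have := sh (-1); rewrite addNr => <-; rewrite addrK.
split.
- by rewrite eN; apply: le_trans hi32; exact: (up _ hi).2.
- by apply: lo1; rewrite sqrrN expr1n.
- by rewrite sh addNr.
- apply: Phi_neq0; rewrite sh addNr mulrC normrM -h34 ler_pM // eN; exact: (up _ hi).2.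
Qed.

Lemma rmorph_ev2 (F K L : fieldType) (iota : {rmorphism F -> K})
    (psi : {rmorphism F -> L}) (s : {rmorphism K -> L}) x y P :
  (forall c, s (iota c) = psi c) -> s (ev2 iota x y P) = ev2 psi (s x) (s y) P.
Proof.
move=> e.
have ep (p : {poly F}) : s (map_poly iota p).[x] = (map_poly psi p).[s x].
  by rewrite -horner_map -map_poly_comp /=; congr (_.[_]); apply: eq_map_poly => c /=.
elim/poly_ind: P => [|P p IH]; first by rewrite !rmorph0.
by rewrite !rmorphD !rmorphM /= !ev2C !ev2X IH ep.
Qed.

Section FamilyRegulator.
Variables (F K : fieldType) (iota : {rmorphism F -> K}) (psi : {rmorphism F -> CC}).
Variables (i : 'I_14) (k : F) (x y : K).
Hypothesis hK : function_field_of iota (Qpoly i k) x y.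
Variables (p rho : RR).
Hypothesis hp : (p == 0) || (p == -1).
Hypothesis hrho : 1/4 < rho < 1/2.
Hypothesis generic : forall t, transcendental psi (circ p rho t).
Variable N : nat.
Hypothesis hN : (N%:R)%:C < `|psi k|.
Hypothesis hbranch : forall k : CC, (N%:R)%:C < `|k| -> has_large_branch i k.

Lemma family_regulator : exists r : {additive K2 K -> RR},
  `|r (symbol x y) + lnn (psi k) * wind (circ p rho)| <= 5 * twopi /\
  `|r (symbol (x + 1) y) + lnn (psi k) * wind (circ (p + 1) rho)| <= 5 * twopi.
Proof.
have [k0 lk hV] := hbranch hN.
pose X := circ p rho.
have nX : nice X by split; [exact: (C1c_circ p rho).1 | exact: circ_periodic].
have hX t := circ_conditions t hp hrho.
have [V [nV bV qV]] := hV X nX hX.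
pose Y t := - (psi k * X t ^+ fam_r i * (X t + 1) ^+ fam_s i /
          (X t ^+ 2 + X t + 1) ^+ fam_m i * V t).
have X0 t : X t != 0.
  have [_ h _ _] := hX t; rewrite -normr_gt0; apply: lt_le_trans h.
  by rewrite divr_gt0.
have X10 t : X t + 1 != 0.
  have [_ _ h _] := hX t; rewrite -normr_gt0; apply: lt_le_trans h.
  by rewrite divr_gt0.
have P0 t : X t ^+ 2 + X t + 1 != 0 by have [] := hX t.
have nX1 : nice (fun t => X t + 1) := niceD nX (nice_const 1).
have nP : nice (fun t => X t ^+ 2 + X t + 1) :=
  niceD (niceD (niceX 2 nX) nX) (nice_const 1).
have nY : nice Y.
  exact: niceN (niceM (niceM (niceM (niceM (nice_const (psi k)) (niceX _ nX)) (niceX _ nX1))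
    (niceV (niceX _ nP) (fun t => expf_neq0 _ (P0 t)))) nV).
have ex_sigma t : exists s : {rmorphism K -> CC},
    [/\ s x = X t, s y = Y t & forall c, s (iota c) = psi c].
  apply: (function_field_embedding hK); apply: (function_field_kernel hK).
  - exact: size_Qpoly.
  - exact: generic.
  - by rewrite eval2_Qpoly; exact: qV.
have [sigma hs] := choice ex_sigma.
have sx t : sigma t x = X t by have [] := hs t.
have sy t : sigma t y = Y t by have [] := hs t.
have sc t c : sigma t (iota c) = psi c by have [] := hs t.
have sE t P : sigma t (ev2 iota x y P) = ev2 psi (X t) (Y t) P.
  by rewrite (rmorph_ev2 x y P (sc t)) sx sy.
(* An element of [K] is a quotient of polynomials in [x] and [y]; injectivity of [sigma t] keeps the
   denominator away from 0 along the loop. *)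
have snice z : nice (fun t => sigma t z).
  have [A [B [B0 ez]]] := hK.2 z.
  have -> : (fun t => sigma t z) = fun t => ev2 psi (X t) (Y t) A * (ev2 psi (X t) (Y t) B)^-1.
    by apply/funext => t; rewrite -!sE ez fmorph_div.
  apply: (niceM (nice_eval2 psi A nX nY) (niceV (nice_eval2 psi B nX nY) _)) => t.
  by rewrite -sE fmorph_eq0.
have x0 := family_x_neq0 hK; have x10 := family_x1_neq0 hK; have y0 := family_y_neq0 hK.
have ik0 : iota k != 0.
  by rewrite -(fmorph_eq0 (sigma 0)) sc.
have PK0 : x ^+ 2 + x + 1 != 0.
  by rewrite -(fmorph_eq0 (sigma 0)) !rmorphD rmorphXn rmorph1 sx.
pose D := iota k * x ^+ fam_r i * (x + 1) ^+ fam_s i / (x ^+ 2 + x + 1) ^+ fam_m i.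
have D0 : D != 0 by rewrite !mulf_neq0 ?invr_neq0 ?expf_neq0.
(* [W] is the function on the curve that becomes the factor [V], close to 1, along the loop; [k]
   contributes the main term and [W] the bounded error. *)
pose W := - (y / D).
have W0 : W != 0 by rewrite oppr_eq0 mulf_neq0 ?invr_neq0.
have ey : y = - (D * W) by rewrite /W; field.
have sW t : sigma t W = V t.
  have DX0 : psi k * X t ^+ fam_r i * (X t + 1) ^+ fam_s i /
      (X t ^+ 2 + X t + 1) ^+ fam_m i != 0.
    by rewrite !mulf_neq0 ?invr_neq0 ?expf_neq0.
  rewrite /W rmorphN fmorph_div sy /D fmorph_div !rmorphM !rmorphXn.
  rewrite !rmorphD rmorph1 rmorphXn sx sc.
  by rewrite /Y mulNr opprK mulrAC mulfV // mul1r.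
pose r := regulator_hom snice.
have main z q : (z = x \/ z = x + 1) -> z != 0 -> (fun t => sigma t z) = circ q rho ->
   (q == 0) || (q ^+ 2 == 1) ->
   `|r (symbol z y) + lnn (psi k) * wind (circ q rho)| <= 5 * twopi.
  move=> hz z0 sz hq.
  have -> : r (symbol z y) = rsym sigma z (iota k) + rsym sigma z W.
    rewrite -(rsym_decomp snice (fam_r i) (fam_s i) (fam_m i) hz z0 x0 x10 PK0
      ik0 W0).
    by rewrite -/D -ey.
  have hr : 0 < rho < 1/2.
    by case/andP: hrho => h1 h2; rewrite h2 andbT; apply: lt_trans h1; rewrite divr_gt0.
  have -> : rsym sigma z (iota k) = - lnn (psi k) * wind (circ q rho).
    rewrite rsymE // sz.
    have -> : (fun t => sigma t (iota k)) = fun=> psi k by apply/funext => t; rewrite sc.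
    by rewrite reg_const //; exact: nonvan_circ.
  rewrite mulNr addrAC addNr add0r rsymE // sz.
  have -> : (fun t => sigma t W) = V by apply/funext.
  exact: (reg_bound hq hr nV.1 nV.2 bV).
exists r; split.
  apply: main => //; first by left.
    by apply/funext.
  by case/orP: hp => /eqP ->; rewrite ?eqxx // sqrrN expr1n eqxx orbT.
apply: main => //; first by right.
  apply/funext => t; rewrite rmorphD rmorph1 sx /X.
  by apply/eqP; rewrite eq_complex /= addr0 eqxx andbT; apply/eqP; ring.
by case/orP: hp => /eqP ->; rewrite ?addNr ?add0r ?expr1n ?eqxx ?orbT.
Qed.
End FamilyRegulator.

(** * From the regulator matrix to linear independence *)

Lemma tens_pairing (A : zmodType) (r : {additive A -> RR}) (a b : A) (q q' : rat) :
  tens a q + tens b q' = 0 -> r a * ratr q + r b * ratr q' = 0.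
Proof.
pose f (a : A) (q : rat) : RR := r a * ratr q.
have fDl a1 a2 c : f (a1 + a2) c = f a1 c + f a2 c by rewrite /f raddfD mulrDl.
have fDr c a1 a2 : f c (a1 + a2) = f c a1 + f c a2 by rewrite /f rmorphD mulrDr.
pose g : {additive tensor A rat -> RR} :=
  HB.pack (tensor_lift f) (GRing.isZmodMorphism.Build _ _ (tensor_lift f)
    (tensor_lift_is_zmod_morphism fDl fDr)).
have gE c d : g (tens c d) = f c d by exact: tensor_liftE.
by move=> /(congr1 g); rewrite raddfD raddf0 !gE.
Qed.

(** As [c > 10], both diagonal entries are less than [- 5 M] while the others are at most [5 M] in
    absolute value, so the determinant is positive and Cramer's rule applies. *)
Lemma dominant_zero (a b c d q s M : RR) : 0 < M -> 
  `|a + c * M| <= 5 * M -> `|b| <= 5 * M -> `|d| <= 5 * M -> 10 < c ->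
  forall a', `|a' + c * M| <= 5 * M ->
  a * q + b * s = 0 -> d * q + a' * s = 0 -> q = 0 /\ s = 0.
Proof.
move=> M0; rewrite !ler_norml => /andP[a1 a2] /andP[b1 b2] /andP[d1 d2] c10 a'.
rewrite ler_norml => /andP[a3 a4] e1 e2.
have cM : 10 * M < c * M by rewrite ltr_pM2r.
have A1 : a < - (5 * M) by lra.
have A2 : a' < - (5 * M) by lra.
have det : a * a' - b * d != 0.
  rewrite gt_eqF // subr_gt0.
  have h1 : b * d <= (5 * M) * (5 * M).
    apply: le_trans (ler_norm _) _; rewrite normrM ler_pM // ler_norml; lra.
  have h2 : (5 * M) * (5 * M) < a * a'.
    rewrite -[ltRHS]mulrNN; apply: ltr_pM; lra.
  lra.
have q0 : (a * a' - b * d) * q = 0.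
  have -> : (a * a' - b * d) * q = a' * (a * q + b * s) - b * (d * q + a' * s) by ring.
  by rewrite e1 e2 !mulr0 subrr.
have s0 : (a * a' - b * d) * s = 0.
  have -> : (a * a' - b * d) * s = a * (d * q + a' * s) - d * (a * q + b * s) by ring.
  by rewrite e1 e2 !mulr0 subrr.
by split; apply: (mulfI det); rewrite ?q0 ?s0 mulr0.
Qed.

Lemma family_independence (R : realType) (i : 'I_14) : exists N : nat,
  forall (k : R[i]) (K : fieldType) (iota : {rmorphism Qadj k -> K}) (x y : K),
  (N%:R)%:C < `|k| -> function_field_of iota (Qpoly i (Qadj_gen k)) x y ->
  Q_lin_indep2 (symbol x y) (symbol (x + 1) y).
Proof.
have [N hN] := exists_large_branch i; exists N => k K iota x y hk hK q s rel.
have [f hf] := complex_embedding R RR.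
pose psi : {rmorphism Qadj k -> CC} := f \o \val.
have hpsi : (N%:R)%:C < `|psi (Qadj_gen k)| by exact: hf.
(* Radii above 1/4 keep the loop at distance at least 1/4 from its centre, and radii below 1/2 keep
   it away from the other of the two points 0 and -1. *)
have [rho hrho gen] := generic_radius psi (ltac:(lra) : 1/4 < 1/2 :> RR) (countable_Qadj k).
have r0 : 0 < rho < 1/2 by lra.
have n0 t : `|circ 0 rho t| = rho%:C.
  rewrite normc_def -nrm2E circ0_nrm2 sqrtr_sqr ger0_norm //; lra.
have gen0 t : transcendental psi (circ 0 rho t) := (gen _ (n0 t)).1.
have gen1 t : transcendental psi (circ (-1) rho t).
  have -> : circ (-1) rho t = circ 0 rho t - 1.
    by apply/eqP; rewrite eq_complex /= oppr0 addr0 eqxx andbT; apply/eqP; ring.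
  exact: (gen _ (n0 t)).2.
have p0 : ((0 : RR) == 0) || ((0 : RR) == -1) by rewrite eqxx.
have p1 : ((-1 : RR) == 0) || ((-1 : RR) == -1) by rewrite eqxx orbT.
have [r [r1 r2]] := family_regulator hK p0 hrho gen0 hpsi hN.
have [r' [r1' r2']] := family_regulator hK p1 hrho gen1 hpsi hN.
have [_ lk _] := hN _ hpsi.
have e1 := tens_pairing r rel; have e2 := tens_pairing r' rel.
have M0 : 0 < twopi.
  apply/RltP; apply: RIneq.Rmult_lt_0_compat; first exact: RIneq.Rlt_0_2.
  exact: Rtrigo1.PI_RGT_0.
rewrite wind_circ0 in r1; last by case/andP: r0 => h _; rewrite gt_eqF.
rewrite add0r wind_circ1 // mulr0 addr0 in r2.
rewrite addNr wind_circ0 in r2'; last by case/andP: r0 => h _; rewrite gt_eqF.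
rewrite wind_circN1 // mulr0 addr0 in r1'.
have [q0 s0] := dominant_zero M0 r1 r2 r1' lk r2' e1 e2.
by split; apply/eqP; rewrite -(fmorph_eq0 (ratr : {rmorphism rat -> RR})) /= ?q0 ?s0 eqxx.
Qed.

Theorem theorem3p11 (R : realType) (i : 'I_14) :
  [/\ forall (n : int) (K : fieldType)
        (iota : {rmorphism Qadj (n%:~R : R[i]) -> K}) (x y : K)
        (X : set (set K)),
        absolutely_irreducible i (n%:~R : R[i]) ->
        function_field_of iota (Qpoly i (Qadj_gen (n%:~R : R[i]))) x y ->
        regular_proper_model iota X ->
        in_tensorQ (K2T_int iota X) (symbol x y)
        /\ in_tensorQ (K2T_int iota X) (symbol (x + 1) y),
      exists2 c : R, 0 < c &
        forall (k : R[i]) (K : fieldType)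
          (iota : {rmorphism Qadj k -> K}) (x y : K),
          c%:C < `|k| ->
          absolutely_irreducible i k ->
          function_field_of iota (Qpoly i (Qadj_gen k)) x y ->
          [/\ in_tensorQ (K2T iota) (symbol x y),
              in_tensorQ (K2T iota) (symbol (x + 1) y)
            & Q_lin_indep2 (symbol x y) (symbol (x + 1) y)]
    & exists2 c : R, 0 < c &
        forall (n : int) (K : fieldType)
          (iota : {rmorphism Qadj (n%:~R : R[i]) -> K}) (x y : K)
          (X : set (set K)),
          c < `|n%:~R| ->
          absolutely_irreducible i (n%:~R : R[i]) ->
          function_field_of iota (Qpoly i (Qadj_gen (n%:~R : R[i]))) x y ->
          regular_proper_model iota X ->
          [/\ in_tensorQ (K2T_int iota X) (symbol x y),
              in_tensorQ (K2T_int iota X) (symbol (x + 1) y)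
            & Q_lin_indep2 (symbol x y) (symbol (x + 1) y)]].
Proof.
have integral (n : int) (K : fieldType) (iota : {rmorphism Qadj (n%:~R : R[i]) -> K})
    (x y : K) (X : set (set K)) :
    function_field_of iota (Qpoly i (Qadj_gen (n%:~R : R[i]))) x y ->
    in_tensorQ (K2T_int iota X) (symbol x y) /\
    in_tensorQ (K2T_int iota X) (symbol (x + 1) y).
  move=> hK; have ek : iota (Qadj_gen (n%:~R : R[i])) = n%:~R.
    by rewrite Qadj_gen_int rmorph_int.
  have [h1 h2] := family_K2T_int hK X ek.
  by split; apply: (@in_tensorQ_mulrn _ _ _ 24).
have [N hN] := family_independence R i.
(* The natural number [N] may be 0 while the constant has to be positive, hence the successor. *)
have N1 : 0 < N.+1%:R :> R by rewrite ltr0n.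
have NS : (N%:R)%:C <= (N.+1%:R)%:C :> R[i] by rewrite lecR ler_nat.
split.
- by move=> n K iota x y X _ hK _; exact: integral.
- exists N.+1%:R => // k K iota x y hk _ hK.
  have [h1 h2] := family_K2T hK.
  split; try by apply: (@in_tensorQ_mulrn _ _ _ 24).
  by apply: hN hK; exact: le_lt_trans hk.
exists N.+1%:R => // n K iota x y X hn _ hK _.
have [h1 h2] := integral n K iota x y X hK.
split=> //; apply: hN hK; apply: le_lt_trans NS _.
have -> : `|n%:~R : R[i]| = (`|n%:~R| : R)%:C by rewrite -!intr_norm rmorph_int.
by rewrite ltcR.
Qed.
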